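(* Fix $n\ge 1$ and let $B_r=B_r(0)\subset\mathbb{R}^n$. Suppose $u\in W^{2,\infty}(B_1)$ satisfies $$\int_{B_1}\left[c^{ij,kl}(x)\,u_{ij}(x)+f^{kl}(x)\right]\eta_{kl}(x)\,dx=0\qquad\text{for all }\eta\in C_0^\infty(B_1),$$ where $c^{ij,kl},f^{kl}\in W^{1,2}(B_1)$ for $1\le i,j,k,l\le n$, and where, for some constant $\Lambda>0$, $$c^{ij,kl}(x)\,\xi_{ij}\xi_{kl}\ge\Lambda|\xi|^2\qquad\text{for a.e. }x\in B_1\text{ and all real symmetric }n\times n\text{ matrices }\xi.$$ Then $u\in W^{3,2}(B_{1/2})$ and $$\|D^3u\|_{L^2(B_{1/2})}\le C,$$ where $C$ is a constant depending only on $\|u\|_{W^{2,\infty}(B_1)}$, $\|f^{kl}\|_{W^{1,2}(B_1)}$, $\|c^{ij,kl}\|_{W^{1,2}(B_1)}$ and $\Lambda$ (for the fixed dimension $n$).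
   Context: Repeated indices are summed from $1$ to $n$; subscripts on $u,\eta$ denote partial derivatives; $C_0^\infty(B_1)$ denotes smooth functions compactly supported in $B_1$. The norms $\|f^{kl}\|_{W^{1,2}(B_1)}$ and $\|c^{ij,kl}\|_{W^{1,2}(B_1)}$ stand for the norms of the whole families of coefficients. *)

(* Defs.v *)
From HB Require Import structures.
From mathcomp Require Import all_boot all_order all_algebra.
From mathcomp Require Import all_classical all_reals all_analysis.

Set Implicit Arguments.
Unset Strict Implicit.
Unset Printing Implicit Defensive.

Import Order.TTheory GRing.Theory Num.Theory.
Import numFieldNormedType.Exports.

Local Open Scope classical_set_scope.
Local Open Scope ring_scope.

(* The Borel sigma-algebra of R^n, generated by the coordinate projections
   (as for n.-tuple R in the library). *)
Definition rV_display : measure_display. Proof. exact. Qed.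

Section measurable_rV.
Context {R : realType} {n : nat}.

Definition rV_coord (i : 'I_n) (x : 'rV[R]_n) : measurableTypeR R := x ord0 i.

Let rV_set0 : g_sigma_preimage rV_coord set0.
Proof. exact: sigma_algebra0. Qed.

Let rV_setC A : g_sigma_preimage rV_coord A -> g_sigma_preimage rV_coord (~` A).
Proof. exact: sigma_algebraC. Qed.

Let rV_bigcup (F : (set 'rV[R]_n)^nat) :
  (forall i, g_sigma_preimage rV_coord (F i)) ->
  g_sigma_preimage rV_coord (\bigcup_i (F i)).
Proof. exact: sigma_algebra_bigcup. Qed.

HB.instance Definition _ := @isMeasurable.Build rV_display
  'rV[R]_n (g_sigma_preimage rV_coord) rV_set0 rV_setC rV_bigcup.

End measurable_rV.

Section lebesgue_measure_rV.
Context {R : realType}.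

Lemma measurable_rV_coord n (i : 'I_n) :
  measurable_fun [set: 'rV[R]_n] (rV_coord i).
Proof.
move=> _ Y mY; rewrite setTI; apply: sub_sigma_algebra => /=.
rewrite -bigcup_seq/=; exists i => /=; first by rewrite mem_index_enum.
by exists Y => //; rewrite setTI.
Qed.

Lemma measurable_fun_rVP d (T : measurableType d) n (f : T -> 'rV[R]_n) :
  (forall i, measurable_fun [set: T] (rV_coord i \o f)) ->
  measurable_fun [set: T] f.
Proof.
move=> mf _ Y mY; move: Y mY.
suff : g_sigma_preimage (@rV_coord R n) `<=`
    image_set_system [set: T] f measurable by exact.
apply: smallest_sub.
  exact: sigma_algebra_image (sigma_algebra_measurable T).
rewrite -bigcup_seq; apply: bigcup_sub => i _ _ [B mB <-].
rewrite /image_set_system /= !setTI -comp_preimage.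
by rewrite -[X in measurable X]setTI; exact: mf.
Qed.

Definition rV_cons n (x : 'rV[R]_n * measurableTypeR R) : 'rV[R]_n.+1 :=
  \row_i oapp (x.1 ord0) x.2 (unlift ord0 i).

Lemma measurable_rV_cons n :
  measurable_fun [set: 'rV[R]_n * measurableTypeR R] (@rV_cons n).
Proof.
apply: measurable_fun_rVP => i; case: (unliftP ord0 i) => [j|] ->.
  rewrite (_ : _ \o _ = rV_coord j \o fst).
    by apply: measurableT_comp => //; exact: measurable_rV_coord.
  by apply/funext => x; rewrite /rV_coord /= mxE liftK.
rewrite (_ : _ \o _ = snd) //.
by apply/funext => x; rewrite /rV_coord /= mxE unlift_none.
Qed.

Section lebesgue_rV_step.
Variables (n : nat) (m : {measure set 'rV[R]_n -> \bar R}).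

Definition lebesgue_rV_step : set 'rV[R]_n.+1 -> \bar R :=
  pushforward (m \x lebesgue_measure)%E (@rV_cons n).

Let mcons := @measurable_rV_cons n.

Let step0 : lebesgue_rV_step set0 = 0%E.
Proof. by rewrite /lebesgue_rV_step measure0. Qed.

Let step_ge0 A : (0 <= lebesgue_rV_step A)%E.
Proof. by rewrite /lebesgue_rV_step measure_ge0. Qed.

Let step_sigma_additive : semi_sigma_additive lebesgue_rV_step.
Proof. rewrite /lebesgue_rV_step; exact: measure_semi_sigma_additive. Qed.

HB.instance Definition _ := isMeasure.Build _ _ _ lebesgue_rV_step
  step0 step_ge0 step_sigma_additive.

End lebesgue_rV_step.

Fixpoint lebesgue_rV n : {measure set 'rV[R]_n -> \bar R} :=
  if n is n'.+1 then lebesgue_rV_step (lebesgue_rV n') else \d_(0 : 'rV[R]_0).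

Lemma lebesgue_rV_box n (A : 'I_n -> set (measurableTypeR R)) :
  (forall i, measurable (A i)) ->
  lebesgue_rV n [set x : 'rV[R]_n | forall i, A i (x ord0 i)] =
  (\prod_(i < n) lebesgue_measure (A i))%E.
Proof.
elim: n A => [|n IHn] A mA.
  by rewrite big_ord0 /= diracE mem_set// => -[].
rewrite big_ord_recl /= /lebesgue_rV_step /pushforward.
rewrite (_ : _ @^-1` _ =
  [set x : 'rV[R]_n | forall i, A (lift ord0 i) (x ord0 i)] `*` A ord0).
  have mB : measurable
      [set x : 'rV[R]_n | forall i, A (lift ord0 i) (x ord0 i)].
    rewrite (_ : [set _ | _] =
      \bigcap_(i in [set: 'I_n]) (rV_coord i @^-1` A (lift ord0 i))).
      apply: fin_bigcap_measurable => [|i _]; first exact: finite_finset.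
      by rewrite -[X in measurable X]setTI; exact: measurable_rV_coord.
    by apply/seteqP; split => [x /= Ax i _|x /= Ax i]; exact: Ax.
  have -> := @product_measure1E _ _ _ _ _ (lebesgue_rV n) lebesgue_measure _ _ mB (mA ord0).
  by rewrite (IHn (fun i => A (lift ord0 i)))// [LHS]muleC.
apply/seteqP; split => -[x a] /=.
  move=> Ax; split => [i|]; first by have := Ax (lift ord0 i); rewrite mxE liftK.
  by have := Ax ord0; rewrite mxE unlift_none.
move=> [Ax Aa] i; rewrite mxE.
by case: (unliftP ord0 i) => [j|] -> /=; [exact: Ax|].
Qed.

End lebesgue_measure_rV.

Section sobolev.
Context {R : realType} {n : nat}.
Implicit Types (U : set 'rV[R]_n) (f g : 'rV[R]_n -> R) (s : seq 'I_n).

Local Notation mu := (lebesgue_rV n : {measure set 'rV[R]_n -> \bar R}).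

(* The norm of 'rV[R]_n is the sup norm, hence the explicit Euclidean ball. *)
Definition eball (r : R) : set 'rV[R]_n :=
  [set x | \sum_i x ord0 i ^+ 2 < r ^+ 2].

(* Classical derivative along the coordinate directions listed in s:
   pderiv [:: k; l] f = d_k (d_l f). *)
Definition pderiv s f : 'rV[R]_n -> R :=
  foldr (fun i g x => 'D_(delta_mx ord0 i) g x) f s.

Definition smooth f : Prop := forall s,
  continuous (pderiv s f) /\
  forall i x, derivable (pderiv s f) x (delta_mx ord0 i).

Definition test_function U f : Prop :=
  [/\ smooth f, compact (closure [set x | f x != 0]) &
      closure [set x | f x != 0] `<=` U].

Definition locally_integrable_rV U f : Prop :=
  measurable_fun U f /\
  forall K, compact K -> K `<=` U -> mu.-integrable K (EFin \o f).

Definition is_weak_deriv U s f g : Prop :=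
  [/\ locally_integrable_rV U f, locally_integrable_rV U g &
      forall eta, test_function U eta ->
        (\int[mu]_(x in U) (f x * pderiv s eta x)%:E =
         ((-1) ^+ size s)%:E * \int[mu]_(x in U) (g x * eta x)%:E)%E].

(* Meaningful only when a weak derivative exists; it is then determined
   almost everywhere in U. *)
Definition weak_deriv U s f : 'rV[R]_n -> R := get (is_weak_deriv U s f).

Definition in_Lp U (p : \bar R) f : Prop := (f \_ U) \in Lfun mu p.

Definition Lp_norm U (p : \bar R) f : \bar R := 'N[mu]_p[EFin \o (f \_ U)].

Definition sobolev U (k : nat) (p : \bar R) f : Prop :=
  in_Lp U p f /\
  forall s, (size s <= k)%N -> exists2 g, is_weak_deriv U s f g & in_Lp U p g.

(* |D^j f|, the Euclidean norm of the tensor of all the weak derivatives of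
   order j, indexed by all n ^ j sequences of directions. *)
Definition weak_grad U (j : nat) f (x : 'rV[R]_n) : R :=
  Num.sqrt (\sum_(s : j.-tuple 'I_n) weak_deriv U s f x ^+ 2).

(* For p = 2 this is the usual norm (sum of the squares of the L^2 norms of
   the derivatives up to order k); for p = +oo it is the essential supremum of
   the Euclidean norm of the k-jet. *)
Definition sobolev_norm U (k : nat) (p : \bar R) f : \bar R :=
  Lp_norm U p (fun x => Num.sqrt (\sum_(j < k.+1) weak_grad U j f x ^+ 2)).

End sobolev.

(* Main.v *)
Require Import Defs.
From HB Require Import structures.
From mathcomp Require Import all_boot all_order all_algebra.
From mathcomp Require Import all_classical all_reals all_analysis.
From mathcomp Require Import ring lra measurable_realfun.

Set Implicit Arguments.
Unset Strict Implicit.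
Unset Printing Implicit Defensive.

Import Order.TTheory GRing.Theory Num.Theory.
Import numFieldNormedType.Exports.

Local Open Scope classical_set_scope.
Local Open Scope ring_scope.

(* Friedrichs' mollifiers replace the difference quotients of the classical
   argument. Write u^e for the mollification of u by rho_e, and test the
   equation, translated by z and averaged against d_p rho_e(z), with
   eta = g^2 d_p u^e, where g is a cutoff which is positive on B_{1/2} and
   satisfies |D(g^2)|, |D^2(g^2)| <= K g. In the principal part the coefficient
   c(x + z) becomes c(x) at the price of the commutator
   (c(x + z) - c(x)) u_ij(x + z), whose L^2 norm is at most e |Dc| |D^2 u|_oo
   and compensates the L^1 norm O(1 / e) of d_p rho_e; this is where the bound
   on D^2 u is used. With X = |g D^2 d_p u^e|_2, ellipticity yields
   Lambda X^2 <= a X + b with a and b independent of e. Hence eta |-> int u_ij d_p eta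
   is bounded in L^2 on the test functions of B_{1/2}, and the Riesz
   representation theorem produces the third weak derivatives with their
   bounds. Coefficients and solution are extended by zero outside B_1. *)

(** * Lebesgue measure on R^n *)

(** The coefficients lie only in W^{1,2}, so they may be unbounded, and ellipticity controls them
    from below only. The principal term can therefore be used in one direction only. In every other
    term [c], or its gradient, takes one L^2 factor, and at most one further factor may contain D^2
    d_p u^e; what remains has to be bounded uniformly in e. This is the role of D u^e and D^2 u^e,
    which are bounded by the W^{2,oo} norm of u. The cutoff is a square for the same reason: a term
    in which derivatives fall on g^2 still keeps one factor g, and g D^2 d_p u^e is what X measures.
    Such a cutoff comes from exp(-1/t), whose square root exp(-1/(2t)) is of the same kind and
    dominates every t^(-k) exp(-1/t) up to a constant. The term in f^{kl} goes through the same
    commutator estimate, with the indicator function of B_1 in place of u_ij. Its frozen part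
    vanishes, because a derivative of rho_e has integral zero. *)

Section box.
Context {R : realType} {n : nat}.
Implicit Types A : 'I_n -> set R.

Definition box A : set 'rV[R]_n := [set x | forall i, A i (x ord0 i)].

Lemma boxE A : box A = \bigcap_(i in [set: 'I_n]) (rV_coord i @^-1` A i).
Proof. by apply/seteqP; split => [x Ax i _|x Ax i]; [exact: Ax|exact: (Ax i)]. Qed.

Lemma boxI A B : box A `&` box B = box (fun i => A i `&` B i).
Proof.
apply/seteqP; split => [x [Ax Bx] i|x ABx]; first by split; [exact: Ax|exact: Bx].
by split => i; case: (ABx i).
Qed.

Lemma measurable_box A : (forall i, measurable (A i : set (measurableTypeR R))) ->
  measurable (box A).
Proof.
move=> mA; rewrite boxE; apply: fin_bigcap_measurable => [|i _].
  exact: finite_finset.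
by rewrite -[X in measurable X]setTI; exact: measurable_rV_coord.
Qed.

(** The generator must contain the whole line, since the preimage of [Z] under one coordinate is the
    box with side [Z] there and R elsewhere. It is used with all measurable sets for translation
    invariance and with rays for the du Bois-Reymond lemma. *)
Lemma measurable_rV_boxE (G : set (set R)) : G setT ->
  @measurable _ (measurableTypeR R) = <<s G >> ->
  @measurable _ 'rV[R]_n = <<s [set box A | A in [set A | forall i, G (A i)]] >>.
Proof.
move=> GT mG; set H := [set box A | A in _].
apply/seteqP; split; last first.
  apply: smallest_sub; first exact: sigma_algebra_measurable.
  move=> _ [A GA <-]; apply: measurable_box => i.
  by rewrite mG; exact: sub_sigma_algebra.
apply: smallest_sub; first exact: smallest_sigma_algebra.
rewrite -bigcup_seq; apply: bigcup_sub => i _ _ [Y mY <-].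
rewrite setTI; rewrite mG in mY.
have : <<s G >> `<=` image_set_system [set: 'rV[R]_n] (rV_coord i) <<s H >>.
  apply: smallest_sub.
    exact: sigma_algebra_image (smallest_sigma_algebra _ _).
  move=> Z GZ; rewrite /image_set_system /= setTI.
  apply: sub_sigma_algebra; exists (fun j => if j == i then Z else setT).
    by move=> j /=; case: ifP.
  apply/seteqP; split => [x /(_ i)/=|x /= Zx j]; first by rewrite eqxx.
  by case: ifPn => // /eqP ->.
by move=> /(_ _ mY); rewrite /image_set_system /= setTI.
Qed.

End box.

Section leb.
Context {R : realType}.

(** A constant on which the sigma-finite structure required by Fubini's theorem can be declared;
    [lebm_lebesgue] returns to [lebesgue_rV]. *)
Definition lebm n : set 'rV[R]_n -> \bar R := lebesgue_rV n.

HB.instance Definition _ n := Measure.on (@lebm n).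

Lemma lebm_box n (A : 'I_n -> set R) :
  (forall i, measurable (A i : set (measurableTypeR R))) ->
  lebm (box A) = (\prod_(i < n) lebesgue_measure (A i))%E.
Proof. exact: lebesgue_rV_box. Qed.

Lemma lebm_oo n (a b : 'I_n -> R) : (forall i, a i < b i) ->
  lebm (box (fun i => `]a i, b i[%classic)) = (\prod_i (b i - a i))%:E.
Proof.
move=> ab; rewrite lebm_box// -prodEFin; apply: eq_bigr => i _.
by rewrite lebesgue_measure_itv/= lte_fin ab EFinB.
Qed.

Lemma bigcup_box_nat n :
  \bigcup_k box (fun _ : 'I_n => `](- k.+1%:R), k.+1%:R[%classic) = [set: 'rV[R]_n].
Proof.
apply/seteqP; split => // x _; pose M := (\sum_i `|x ord0 i|)%R.
exists (Num.truncn M) => // i /=; rewrite in_itv /= -ltr_norml.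
apply: le_lt_trans (truncnS_gt _).
by rewrite /M (bigD1 i)//= lerDl sumr_ge0.
Qed.

Lemma lebm_sigma_finite n : sigma_finite [set: 'rV[R]_n] (@lebm n).
Proof.
exists (fun k => box (fun=> `](- k.+1%:R), k.+1%:R[%classic)).
  by rewrite bigcup_box_nat.
move=> k; split; first exact: measurable_box.
by rewrite lebm_oo ?ltry// => i; rewrite gtrN.
Qed.

HB.instance Definition _ n :=
  @Measure_isSigmaFinite.Build _ _ _ (@lebm n) (lebm_sigma_finite n).

(** Lebesgue measure is determined by its values on half-open intervals, and the preimage of ]x, y]
    is ]x - a, y - a], of the same length. *)
Lemma lebesgue_measure_shift (a : R) (A : set (measurableTypeR R)) :
  measurable A -> lebesgue_measure ((fun x => x + a) @^-1` A) = lebesgue_measure A.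
Proof.
have ma : measurable_fun [set: measurableTypeR R]
    ((fun x => x + a) : measurableTypeR R -> measurableTypeR R).
  exact: measurable_funD.
move=> mA.
pose m2 := measure_function_pushforward__canonical__measure_function_Measure lebesgue_measure ma.
apply/esym; apply: (@lebesgue_measure_unique R m2) => // _ [[x y] /= _ <-].
rewrite /pushforward.
rewrite (_ : _ @^-1` _ = `]x - a, y - a]%classic).
  by rewrite !lebesgue_measure_itv/= !lte_fin ltrD2r -!EFinB opprB addrA addrNK.
by apply/seteqP; split => z /=; rewrite !in_itv/= ltrBlDr lerBrDr.
Qed.

Context {n : nat}.
Notation T := 'rV[R]_n.

(** The sigma-algebra is generated by the coordinates, so an open set is exhibited as the countable
    union of the rational boxes contained in it. *)
Lemma open_measurable_rV (A : set T) : open A -> measurable A.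
Proof.
move=> oA.
pose B (q : 'rV[rat]_n * 'rV[rat]_n) : set T :=
  box (fun i => `]ratr (q.1 ord0 i), ratr (q.2 ord0 i)[%classic).
rewrite (_ : A = \bigcup_(q : 'rV[rat]_n * 'rV[rat]_n)
    (if `[< B q `<=` A >] then B q else set0)); last first.
  apply/seteqP; split; last first.
    by move=> x [q _]; case: asboolP => // qA /qA.
  move=> x Ax; have : nbhs x A by apply: open_nbhs_nbhs.
  move=> /nbhs_ballP [e /= e0 xeA].
  have hq (i : 'I_n) : {q : rat * rat | x ord0 i - e < ratr q.1 /\ ratr q.1 < x ord0 i /\
      x ord0 i < ratr q.2 /\ ratr q.2 < x ord0 i + e}.
    apply: cid.
    have /rat_in_itvoo[q1] : x ord0 i - e < x ord0 i by rewrite ltrBlDr ltrDl.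
    rewrite in_itv/= => /andP[? ?].
    have /rat_in_itvoo[q2] : x ord0 i < x ord0 i + e by rewrite ltrDl.
    by rewrite in_itv/= => /andP[? ?]; exists (q1, q2).
  exists (\row_i (sval (hq i)).1, \row_i (sval (hq i)).2) => //.
  rewrite asboolT; last first.
    move=> y By; apply: xeA; split => // i j; rewrite (ord1 i) /ball/=.
    have := By j; rewrite /= !mxE in_itv/=; have [] := svalP (hq j).
    by move=> h1 [h2 [h3 h4]] /andP[h5 h6]; rewrite /ball/= ltr_distlC; apply/andP; split; lra.
  move=> i /=; rewrite !mxE in_itv/=; have [] := svalP (hq i).
  by move=> h1 [h2 [h3 h4]]; apply/andP.
apply: countable_bigcupT_measurable => // q; case: asboolP => // _.
exact: measurable_box.
Qed.

Lemma continuous_measurable_rV (f : T -> R) :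
  continuous f -> measurable_fun [set: T] f.
Proof.
move=> /continuousP cf; apply: (measurability _ (RGenOpens.measurableE R)).
move=> _ [_ [a [b ->] <-]]; rewrite setTI; apply: open_measurable_rV.
exact/cf/interval_open.
Qed.

Lemma measurable_shift (z : T) : measurable_fun [set: T] (fun x : T => x + z).
Proof.
apply: measurable_fun_rVP => i.
rewrite (_ : _ \o _ = (fun x => rV_coord i x + rV_coord i z)).
  by apply: measurable_funD => //; exact: measurable_rV_coord.
by apply/funext => x; rewrite /rV_coord /= mxE.
Qed.

(** Boxes form a generating pi-system on which the claim reduces to dimension one, and cubes of
    finite measure exhaust the space; uniqueness of measures concludes. *)
Lemma lebm_shift (z : T) (A : set T) : measurable A ->
  lebm ((fun x : T => x + z) @^-1` A) = lebm A.
Proof.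
move=> mA.
pose m2 := measure_function_pushforward__canonical__measure_function_Measure (@lebm n) (measurable_shift z).
apply/esym; apply: (measure_unique [set box A | A in [set A : 'I_n -> _ | forall i, measurable (A i : set (measurableTypeR R))]]
   (fun k => box (fun=> `](- k.+1%:R), k.+1%:R[%classic)) _ _ _ _ (@lebm n) m2) => //.
- by apply: measurable_rV_boxE => //; rewrite sigma_algebra_id//; exact: sigma_algebra_measurable.
- move=> _ _ [B mB <-] [C mC <-]; rewrite boxI; eexists; last by [].
  by move=> i /=; exact: measurableI.
- by move=> k; eexists; last by [].
- exact: bigcup_box_nat.
- move=> _ [B mB <-].
  rewrite (_ : m2 (box B) = lebm ((fun x : T => x + z) @^-1` box B))//.
  rewrite (_ : _ @^-1` _ = box (fun i => (fun t => t + z ord0 i) @^-1` B i)).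
    rewrite [LHS]lebm_box// [RHS]lebm_box//; last first.
      move=> i; rewrite -[X in measurable X]setTI; apply: measurable_funD => //.
      exact: mB.
    by apply: eq_bigr => i _; rewrite lebesgue_measure_shift//; exact: mB.
  by apply/seteqP; split => x Bx i; have := Bx i; rewrite /= mxE.
- move=> k; have := @lebm_oo n (fun=> - k.+1%:R) (fun=> k.+1%:R) => /= E.
  by apply: (@le_lt_trans _ _ (\prod_(i < n) (k.+1%:R - - k.+1%:R))%:E); rewrite ?ltry// -E// => i; rewrite gtrN.
Qed.
End leb.

(** * Integrable and square-integrable functions *)

Section real_integral.
Context d {X : measurableType d} {R : realType} (mu : {measure set X -> \bar R}).
Implicit Types f g h : X -> R.

Definition L1 f := mu.-integrable setT (EFin \o f).
Definition rint f : R := \int[mu]_x f x.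

Lemma L1_measurable f : L1 f -> measurable_fun setT f.
Proof. by move=> /(measurable_int mu)/measurable_EFinP. Qed.

Lemma rintE f : L1 f -> (\int[mu]_x (f x)%:E = (rint f)%:E)%E.
Proof. by move=> f1; rewrite /rint /Rintegral fineK//; exact: integrable_fin_num. Qed.

Lemma L1D f g : L1 f -> L1 g -> L1 (fun x => f x + g x).
Proof. by move=> f1 g1; exact: (integrableD measurableT f1 g1). Qed.

Lemma L1Z k f : L1 f -> L1 (fun x => k * f x).
Proof. by move=> f1; exact: (integrableZl measurableT k f1). Qed.

Lemma L1N f : L1 f -> L1 (fun x => - f x).
Proof. by move=> f1; exact: (integrableN f1). Qed.

Lemma L1B f g : L1 f -> L1 g -> L1 (fun x => f x - g x).
Proof. by move=> f1 g1; apply: L1D => //; exact: L1N. Qed.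

Lemma L10 : L1 (fun=> 0).
Proof. exact: integrable0. Qed.

Lemma L1_sum (I : Type) (s : seq I) (F : I -> X -> R) :
  (forall i, L1 (F i)) -> L1 (fun x => \sum_(i <- s) F i x).
Proof.
move=> F1; elim: s => [|i s ih].
  by rewrite (_ : (fun _ => _) = (fun=> 0)); [exact: L10|apply/funext => x; rewrite big_nil].
rewrite (_ : (fun _ => _) = (fun x => F i x + \sum_(i <- s) F i x)); first exact: L1D.
by apply/funext => x; rewrite big_cons.
Qed.

Lemma L1_norm f : L1 f -> L1 (fun x => `|f x|).
Proof. exact: integrable_norm. Qed.

Lemma L1_le f g : measurable_fun setT f -> L1 g -> (forall x, `|f x| <= g x) -> L1 f.
Proof.
move=> mf g1 fg; apply: (le_integrable _ _ _ g1) => //; first exact/measurable_EFinP.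
by move=> x _ /=; rewrite lee_fin (le_trans (fg x))// ler_norm.
Qed.

Lemma L1_ext f g : f =1 g -> L1 f -> L1 g.
Proof. by move=> /funext ->. Qed.

Lemma rint_ext f g : f =1 g -> rint f = rint g.
Proof. by move=> /funext ->. Qed.

Lemma rintD f g : L1 f -> L1 g -> rint (fun x => f x + g x) = rint f + rint g.
Proof. by move=> f1 g1; exact: RintegralD. Qed.

Lemma rintB f g : L1 f -> L1 g -> rint (fun x => f x - g x) = rint f - rint g.
Proof. by move=> f1 g1; exact: RintegralB. Qed.

Lemma rintZ k f : L1 f -> rint (fun x => k * f x) = k * rint f.
Proof. by move=> f1; exact: RintegralZl. Qed.

Lemma rintN f : L1 f -> rint (fun x => - f x) = - rint f.
Proof.
by move=> f1; rewrite -mulN1r -rintZ//; apply: rint_ext => x; rewrite mulN1r.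
Qed.

Lemma rint0 : rint (fun=> 0) = 0.
Proof. by rewrite /rint /Rintegral integral0. Qed.

Lemma rint_sum (I : Type) (s : seq I) (F : I -> X -> R) :
  (forall i, L1 (F i)) ->
  rint (fun x => \sum_(i <- s) F i x) = \sum_(i <- s) rint (F i).
Proof.
move=> F1; elim: s => [|i s ih].
  by rewrite (@rint_ext _ (fun=> 0)) ?rint0 ?big_nil// => x; rewrite big_nil.
rewrite big_cons -ih -rintD//; last exact: L1_sum.
by apply: rint_ext => x; rewrite big_cons.
Qed.

Lemma rint_ge0 f : (forall x, 0 <= f x) -> 0 <= rint f.
Proof. by move=> f0; apply: Rintegral_ge0 => x _. Qed.

Lemma le_rint f g : L1 f -> L1 g -> (forall x, f x <= g x) -> rint f <= rint g.
Proof. by move=> f1 g1 fg; apply: le_Rintegral => // x _. Qed.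

Lemma rint_ae_ext f g : L1 f -> measurable_fun setT g ->
  {ae mu, forall x, f x = g x} -> L1 g /\ rint f = rint g.
Proof.
move=> f1 mg fg; have mf := L1_measurable f1.
have ae : ae_eq mu setT (EFin \o f) (EFin \o g).
  by apply: filterS fg => x /= -> _.
have E : (\int[mu]_x (f x)%:E = \int[mu]_x (g x)%:E)%E.
  by apply: ae_eq_integral => //; exact/measurable_EFinP.
split; last by rewrite /rint /Rintegral E.
apply/integrableP; split; first exact/measurable_EFinP.
move/integrableP : f1 => [_]; rewrite (ae_eq_integral (abse \o EFin \o g))//.
- by apply: measurableT_comp => //; exact/measurable_EFinP.
- by apply: measurableT_comp => //; exact/measurable_EFinP.
- by apply: filterS fg => x /= -> _.
Qed.

Lemma le_rint_ae f g : L1 f -> L1 g -> {ae mu, forall x, f x <= g x} -> rint f <= rint g.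
Proof.
move=> f1 g1 fg.
(* The maximum equals [g] almost everywhere and lies above [f] everywhere, which brings the claim
   back to the pointwise comparison. *)
have m1 : measurable_fun setT (fun x => Num.max (f x) (g x)).
  by apply: measurable_maxr; exact: L1_measurable.
have [|h1 ->] := rint_ae_ext g1 m1.
  by apply: filterS fg => x fgx; rewrite max_r.
by apply: le_rint => // x; rewrite le_max lexx.
Qed.

Lemma le_norm_rint f g : L1 f -> L1 g -> (forall x, `|f x| <= g x) -> `|rint f| <= rint g.
Proof.
move=> f1 g1 fg; apply: (le_trans (le_normr_Rintegral _ f1)) => //.
by apply: le_rint => //; exact: L1_norm.
Qed.

Definition L2 f := measurable_fun setT f /\ L1 (fun x => f x ^+ 2).
Definition nrm2 f : R := Num.sqrt (rint (fun x => f x ^+ 2)).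

Lemma nrm2_ge0 f : 0 <= nrm2 f.
Proof. exact: sqrtr_ge0. Qed.

Lemma nrm2_sqr f : nrm2 f ^+ 2 = rint (fun x => f x ^+ 2).
Proof. by rewrite sqr_sqrtr//; apply: rint_ge0 => x; exact: sqr_ge0. Qed.

Lemma L2M f g : L2 f -> L2 g -> L1 (fun x => f x * g x).
Proof.
move=> [mf f2] [mg g2]; apply: (L1_le _ (L1D f2 g2)); first exact: measurable_funM.
move=> x; have := sqr_ge0 (`|f x| - `|g x|); rewrite normrM sqrrB -!normrX.
rewrite (ger0_norm (sqr_ge0 (f x))) (ger0_norm (sqr_ge0 (g x))).
by have := normr_ge0 (f x); have := normr_ge0 (g x); nra.
Qed.

Lemma L2D f g : L2 f -> L2 g -> L2 (fun x => f x + g x).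
Proof.
move=> f2 g2; have [mf ff] := f2; have [mg gg] := g2; split; first exact: measurable_funD.
apply: L1_ext (L1D (L1D ff (L1Z 2 (L2M f2 g2))) gg) => x /=.
by rewrite sqrrD mulr2n mulrDl mul1r.
Qed.

Lemma L2Z k f : L2 f -> L2 (fun x => k * f x).
Proof.
move=> [mf ff]; split; first exact: measurable_funM.
by apply: L1_ext (L1Z (k ^+ 2) ff) => x /=; rewrite exprMn.
Qed.

Lemma nrm2Z k f : L2 f -> nrm2 (fun x => k * f x) = `|k| * nrm2 f.
Proof.
move=> [mf ff]; rewrite /nrm2 -sqrtr_sqr -sqrtrM ?sqr_ge0// -rintZ//.
by congr Num.sqrt; apply: rint_ext => x; rewrite exprMn.
Qed.

Lemma L2N f : L2 f -> L2 (fun x => - f x).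
Proof.
move=> [mf ff]; split; first exact: measurable_funN.
by apply: L1_ext ff => x /=; rewrite sqrrN.
Qed.

Lemma L2B f g : L2 f -> L2 g -> L2 (fun x => f x - g x).
Proof. by move=> f2 g2; apply: L2D => //; exact: L2N. Qed.

Lemma L20 : L2 (fun=> 0).
Proof. by split; [exact: measurable_cst|rewrite expr0n; exact: L10]. Qed.

Lemma L2_sum (I : Type) (s : seq I) (F : I -> X -> R) :
  (forall i, L2 (F i)) -> L2 (fun x => \sum_(i <- s) F i x).
Proof.
move=> F1; elim: s => [|i s ih].
  by rewrite (_ : (fun _ => _) = (fun=> 0)); [exact: L20|apply/funext => x; rewrite big_nil].
rewrite (_ : (fun _ => _) = (fun x => F i x + \sum_(i <- s) F i x)); first exact: L2D.
by apply/funext => x; rewrite big_cons.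
Qed.

Lemma L2_bound (b : X -> R) f (K : R) : measurable_fun setT b -> (forall x, `|b x| <= K) -> L2 f ->
  L2 (fun x => b x * f x) /\ nrm2 (fun x => b x * f x) <= K * nrm2 f.
Proof.
move=> mb bK [mf ff].
have le x : (b x * f x) ^+ 2 <= K ^+ 2 * f x ^+ 2.
  rewrite exprMn ler_wpM2r ?sqr_ge0// -(ger0_norm (sqr_ge0 (b x))) normrX.
  by rewrite lerXn2r ?nnegrE// (le_trans _ (bK x)).
have L : L2 (fun x => b x * f x).
  split; first exact: measurable_funM.
  apply: (L1_le _ (L1Z (K ^+ 2) ff)) => [|x].
    by apply: measurable_funX; exact: measurable_funM.
  by rewrite ger0_norm ?sqr_ge0.
split=> //.
(* The sign of [K] is read off from a point of [X]; on an empty space every integral is zero. *)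
have [[x0]|X0] := pselect (inhabited X); last first.
  have e0 h : rint h = 0.
    by rewrite -rint0; apply: rint_ext => x; exfalso; apply: X0.
  by rewrite /nrm2 !e0 sqrtr0 mulr0.
have K0 : 0 <= K by rewrite (le_trans _ (bK x0)).
rewrite -[K]ger0_norm// -nrm2Z; last by split.
rewrite ler_sqrt; last by apply: rint_ge0 => x; exact: sqr_ge0.
apply: le_rint => [| |x]; first by case: L.
  by apply: L1_ext (L1Z (K ^+ 2) ff) => x /=; rewrite exprMn.
by rewrite [leRHS]exprMn.
Qed.

(** The polynomial t -> int (f + t g)^2 is nonnegative; t = - B / C gives the inequality. If C = 0
    the polynomial is affine, and a nonzero B would make it equal to -1 at t = - (A + 1) / (2 B). *)
Lemma cauchy_schwarz f g : L2 f -> L2 g ->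
  `|rint (fun x => f x * g x)| <= nrm2 f * nrm2 g.
Proof.
move=> f2 g2; have [mf ff] := f2; have [mg gg] := g2.
set A := rint (fun x => f x ^+ 2); set C := rint (fun x => g x ^+ 2).
set B := rint _.
have A0 : 0 <= A by apply: rint_ge0 => x; exact: sqr_ge0.
have C0 : 0 <= C by apply: rint_ge0 => x; exact: sqr_ge0.
have H t : 0 <= A + (2 * t) * B + t ^+ 2 * C.
  rewrite -rintZ; last exact: L2M.
  rewrite -[t ^+ 2 * C]rintZ// -rintD//; last exact/L1Z/L2M.
  rewrite -rintD//; last exact: L1Z; last first.
    by apply: L1D => //; exact/L1Z/L2M.
  by apply: rint_ge0 => x; have := sqr_ge0 (f x + t * g x); nra.
suff BB : B ^+ 2 <= A * C.
  by rewrite /nrm2 -sqrtrM// -[`|B|]sqrtr_sqr ler_sqrt// mulr_ge0.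
have [C00|Cn0] := eqVneq C 0.
  have [->|Bn0] := eqVneq B 0; first by rewrite expr0n mulr_ge0.
  have := H (- (A + 1) / (2 * B)); rewrite C00 mulr0 addr0.
  rewrite (_ : 2 * _ * B = - (A + 1)); first by lra.
  by field.
have Cp : 0 < C by rewrite lt_neqAle eq_sym Cn0.
have := H (- B / C); rewrite (_ : _ + _ = A - B ^+ 2 / C); last by field.
by rewrite subr_ge0 ler_pdivrMr.
Qed.

Lemma nrm2D f g : L2 f -> L2 g -> nrm2 (fun x => f x + g x) <= nrm2 f + nrm2 g.
Proof.
move=> f2 g2; have := cauchy_schwarz f2 g2; have [mf ff] := f2; have [mg gg] := g2.
rewrite ler_norml => /andP[_ cs].
rewrite -(@ler_pXn2r _ 2)// ?nnegrE ?addr_ge0 ?nrm2_ge0// nrm2_sqr sqrrD !nrm2_sqr.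
rewrite (_ : rint _ = rint (fun x => f x ^+ 2) + 2 * rint (fun x => f x * g x) + rint (fun x => g x ^+ 2)).
  by rewrite lerD2r lerD2l mulr2n; lra.
rewrite -rintZ; last exact: L2M.
rewrite -rintD//; last exact/L1Z/L2M.
rewrite -rintD//; last by apply: L1D => //; exact/L1Z/L2M.
by apply: rint_ext => x; rewrite sqrrD mulr2n mulrDl mul1r.
Qed.

Lemma le_nrm2 f g : L2 f -> L2 g -> (forall x, `|f x| <= `|g x|) -> nrm2 f <= nrm2 g.
Proof.
move=> [mf ff] [mg gg] fg; rewrite ler_sqrt; last by apply: rint_ge0 => x; exact: sqr_ge0.
apply: le_rint => // x; rewrite -(ger0_norm (sqr_ge0 (f x))) -(ger0_norm (sqr_ge0 (g x))).
by rewrite !normrX lerXn2r ?nnegrE.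
Qed.

Lemma L2_le f g : measurable_fun setT f -> L2 g -> (forall x, `|f x| <= `|g x|) -> L2 f.
Proof.
move=> mf [mg gg] fg; split => //.
apply: (L1_le _ gg) => [|x]; first exact: measurable_funX.
by rewrite normrX -(ger0_norm (sqr_ge0 (g x))) normrX lerXn2r ?nnegrE.
Qed.

Lemma L2_ext f g : f =1 g -> L2 f -> L2 g.
Proof. by move=> /funext ->. Qed.

Lemma nrm2_ext f g : f =1 g -> nrm2 f = nrm2 g.
Proof. by move=> /funext ->. Qed.

End real_integral.

Section lebm_integral.
Context {R : realType} {n : nat}.
Notation T := 'rV[R]_n.
Notation mu := (@lebm R n).
Implicit Types f g w : T -> R.

Lemma ge0_integral_shift (f : T -> \bar R) (z : T) :
  measurable_fun setT f -> (forall x, 0 <= f x)%E ->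
  (\int[mu]_x f ((x : T) + z)%R = \int[mu]_x f x)%E.
Proof.
move=> mf f0; have ms := measurable_shift z.
have := ge0_integral_pushforward ms mu measurableT mf (fun x _ => f0 x).
rewrite preimage_setT => <-; apply: eq_measure_integral => A mA _.
exact: (lebm_shift z mA).
Qed.

Lemma measurable_comp_shift f z : measurable_fun setT f ->
  measurable_fun setT (fun x : T => f (x + z)).
Proof. by move=> mf; apply: measurableT_comp (measurable_shift z). Qed.

Lemma L1_shift f z : L1 mu f -> L1 mu (fun x : T => f (x + z)).
Proof.
move=> f1; have mf := L1_measurable f1.
apply/integrableP; split.
  by apply/measurable_EFinP; exact: measurable_comp_shift.
rewrite (ge0_integral_shift (f := fun x => `|(f x)%:E|%E))//.
  by case/integrableP : f1.
by apply: measurableT_comp => //; exact/measurable_EFinP.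
Qed.

Lemma rint_shift f z : L1 mu f -> rint mu (fun x : T => f (x + z)) = rint mu f.
Proof.
move=> f1; have mf := L1_measurable f1; have ms := measurable_shift z.
rewrite /rint /Rintegral; congr fine.
have := integral_pushforward ms (f := EFin \o f) (mu := mu) (D := setT).
rewrite preimage_setT => /= <-//; last 2 first.
- exact/measurable_EFinP.
- exact: L1_shift.
by apply: eq_measure_integral => A mA _; exact: (lebm_shift z mA).
Qed.

Lemma L2_shift f z : L2 mu f -> L2 mu (fun x : T => f (x + z)).
Proof.
move=> [mf ff]; split; first exact: measurable_comp_shift.
exact: (L1_shift (f := fun x => f x ^+ 2)).
Qed.

Lemma nrm2_shift f z : L2 mu f -> nrm2 mu (fun x : T => f (x + z)) = nrm2 mu f.
Proof. by move=> [mf ff]; rewrite /nrm2 (rint_shift z ff). Qed.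

Lemma measurable_addrV : measurable_fun [set: T * T] (fun p : T * T => p.2 + p.1).
Proof.
apply: measurable_fun_rVP => i.
rewrite (_ : _ \o _ = (fun p : T * T => rV_coord i p.2 + rV_coord i p.1)).
  by apply: measurable_funD; apply: measurableT_comp (measurable_rV_coord i) _.
by apply/funext => x; rewrite /rV_coord /= mxE.
Qed.

(** By Cauchy-Schwarz and translation invariance, int |f (x + z) g x| dx is at most |f|_2 |g|_2 for
    every z, so integrability of [w] makes the double integral absolutely convergent. That [w] is
    also in L^2 makes the inner integral over z converge for every x. *)
Lemma fubini_corr w f g : L1 mu w -> L2 mu w -> L2 mu f -> L2 mu g ->
  L1 mu (fun z : T => w z * rint mu (fun x : T => f (x + z) * g x)) /\
  rint mu (fun z : T => w z * rint mu (fun x : T => f (x + z) * g x)) =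
  rint mu (fun x => g x * rint mu (fun z : T => w z * f (x + z))).
Proof.
move=> w1 w2 f2 g2; have mw := L1_measurable w1; have [mf _] := f2; have [mg _] := g2.
pose F (p : T * T) : \bar R := (w p.1 * (f (p.2 + p.1) * g p.2))%:E.
have mF : measurable_fun setT F.
  apply/measurable_EFinP; apply: measurable_funM.
    exact: measurableT_comp mw _.
  apply: measurable_funM; last exact: measurableT_comp mg _.
  exact: measurableT_comp mf measurable_addrV.
have fg1 z : L1 mu (fun x : T => f (x + z) * g x) by apply: L2M => //; exact: L2_shift.
have iF : (mu \x mu)%E.-integrable setT F.
  have QQ := proj2 (integrable12ltyP mu mu mF). apply: QQ.
  have /integrableP [_] := L1Z (nrm2 mu f * nrm2 mu g) (L1_norm w1).
  apply: le_lt_trans; apply: ge0_le_integral => //.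
  - by move=> z _; exact: integral_ge0.
  - apply: (measurable_fun_fubini_tonelli_F (abse \o F)) => //=.
    exact: measurableT_comp.
  - apply: measurableT_comp => //; apply/measurable_EFinP.
    by apply: measurable_funM => //; exact: measurableT_comp mw.
  move=> z _ /=; rewrite [leLHS](_ : _ = (\int[mu]_x (`|w z| * `|f (x + z) * g x|)%:E)%E); last first.
    by apply: eq_integral => x _; rewrite /F /= normrM.
  rewrite rintE; last exact/L1Z/L1_norm.
  rewrite lee_fin rintZ; last exact/L1_norm.
  rewrite [leRHS]ger0_norm ?mulr_ge0 ?nrm2_ge0// mulrC ler_wpM2r//.
  have nf2 : L2 mu (fun x : T => `|f (x + z)|).
    apply: L2_le (L2_shift z f2) _ => [|x]; last by rewrite normr_id.
    by apply: measurableT_comp => //; exact: measurable_comp_shift.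
  have ng2 : L2 mu (fun x => `|g x|).
    by apply: L2_le g2 _ => [|x]; [exact: measurableT_comp|rewrite normr_id].
  have := cauchy_schwarz nf2 ng2.
  rewrite (@rint_ext _ _ _ _ (fun x : T => `|f (x + z)| * `|g x|) (fun x : T => `|f (x + z) * g x|)); last first.
    by move=> x; rewrite normrM.
  move=> /(le_trans (ler_norm _)) /le_trans; apply; rewrite -(nrm2_shift z f2).
  by apply: ler_pM; rewrite ?nrm2_ge0//; apply: le_nrm2 => //; [exact: L2_shift|move=> x; rewrite normr_id..].
have Ez z : fubini_F mu F z = (w z * rint mu (fun x : T => f (x + z) * g x))%:E.
  by rewrite /fubini_F -rintZ// -rintE//; exact: L1Z.
split.
  by have := integrable_fubini_F iF; apply: eq_integrable => // z _; exact: Ez.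
rewrite /rint /Rintegral; congr fine.
transitivity (\int[mu]_z \int[mu]_x F (z, x))%E.
  by apply: eq_integral => z _; rewrite -[RHS]/(fubini_F mu F z) Ez.
rewrite (Fubini iF); apply: eq_integral => x _.
have wf1 : L1 mu (fun z : T => w z * f (x + z)).
  apply: L2M => //; apply: L2_ext (L2_shift x f2) => z.
  by rewrite addrC.
rewrite -[X in _ = X%:E]/(g x * rint mu (fun z : T => w z * f (x + z))) -rintZ// -rintE; last exact: L1Z.
by apply: eq_integral => z _; rewrite /F /=; congr EFin; ring.
Qed.

End lebm_integral.

(** * Calculus of smooth functions *)

Section line_derivative.
Context {R : realType} {V : normedModType R}.
Implicit Types (f : V -> R) (x v : V).

Lemma is_derive_lineP f x v (t d : R) :
  is_derive (t *: v + x) v f d <-> is_derive t (1 : R) (fun s => f (s *: v + x)) d.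
Proof.
have E : (fun h : R => h^-1 *: ((f \o shift (t *: v + x)) (h *: v) - f (t *: v + x))) =
  (fun h : R => h^-1 *: (((fun s : R => f (s *: v + x)) \o shift t) (h *: (1 : R)) - f (t *: v + x))).
  by apply/funext => h /=; rewrite addrA -scalerDl [h *: 1]mulr1.
split=> -[dv dd]; split.
- by rewrite /derivable -E.
- by rewrite -dd /derive -E.
- by rewrite /derivable E.
- by rewrite -dd /derive E.
Qed.

Lemma is_derive_line0 f x v d : is_derive x v f d <-> is_derive (0 : R) (1 : R) (fun s : R => f (s *: v + x)) d.
Proof. by rewrite -[X in is_derive X v f d](add0r x) -[X in X + x](scale0r v); exact: is_derive_lineP. Qed.

(** Most derivatives below are obtained in this way, because a remainder bound survives summation
    and integration, and so allows differentiation under the integral sign. *)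
Lemma quadratic_is_derive f x v (d K : R) :
  (forall h : R, `|h| < 1 -> `|f (h *: v + x) - f x - h * d| <= K * h ^+ 2) -> is_derive x v f d.
Proof.
move=> H.
have cv : h^-1 *: ((f \o shift x) (h *: v) - f x) @[h --> 0^'] --> d.
  apply/cvgrPdist_le => e e0; have K1 : 0 < `|K| + 1 by rewrite ltr_wpDl.
  near=> h.
  have h0 : h != 0 by near: h; exact: nbhs_dnbhs_neq.
  have hd : `|h| < Num.min 1 (e / (`|K| + 1)).
    near: h; apply: dnbhs0_lt; rewrite lt_min ltr01 divr_gt0//.
  move: hd; rewrite lt_min => /andP[h1 hd].
  rewrite /= /shift/= distrC.
  rewrite (_ : _ - d = h^-1 * (f (h *: v + x) - f x - h * d)); last first.
    by rewrite [_ *: _]mulrBr mulrBr mulrBr mulrA mulVf// mul1r.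
  rewrite normrM normfV ler_pdivrMl ?normr_gt0// (le_trans (H _ h1))//.
  rewrite -real_normK ?num_real// expr2 mulrA mulrC ler_wpM2l//.
  rewrite (le_trans (ler_wpM2r _ (ler_norm K)))// mulrC.
  move: hd; rewrite ltr_pdivlMr// => /ltW; apply: le_trans.
  by rewrite ler_wpM2l// lerDl.
split; first by apply/cvg_ex; exists d.
exact/cvg_lim.
Unshelve. all: by end_near. Qed.

End line_derivative.

(** * The functions t^(-k) exp(-1/t) and the algebra of smooth functions *)

Section flat.
Context {R : realType}.
Implicit Types (k : nat) (t : R).

(** The whole family in k is introduced because exp(-1/t) alone is not closed under differentiation,
    whereas each derivative is a combination of two members of the family. *)
Definition flat k t : R := if 0 < t then t^-1 ^+ k * expR (- t^-1) else 0.

Lemma flat_ge0 k t : 0 <= flat k t.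
Proof.
rewrite /flat; case: ltP => // t0.
by rewrite mulr_ge0 ?expR_ge0// exprn_ge0// invr_ge0 ltW.
Qed.

Lemma exprn_expR_le m (s : R) : 0 <= s -> s ^+ m * expR (- s) <= m`!%:R.
Proof.
move=> s0; rewrite expRN ler_pdivrMr ?expR_gt0//.
case: m => [|m]; first by rewrite expr0 fact0 mul1r (le_trans _ (expR_ge1Dx s))// lerDl.
rewrite mulrC -ler_pdivrMr ?ltr0n ?fact_gt0//.
by apply: le_trans (expR_ge1Dxn m s0); rewrite lerDr.
Qed.

Lemma flat_le k t : flat k t <= (k.+2)`!%:R * t ^+ 2.
Proof.
rewrite /flat; case: ltP => t0; last by rewrite mulr_ge0 ?sqr_ge0.
have s0 : 0 <= t^-1 by rewrite invr_ge0 ltW.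
apply: le_trans (ler_wpM2r (sqr_ge0 t) (exprn_expR_le k.+2 s0)).
rewrite -addn2 exprD mulrAC -[_ * t^-1 ^+ 2 * _]mulrA -exprMn mulVf ?gt_eqF//.
by rewrite expr1n mulr1.
Qed.

Lemma is_derive_flat k t :
  is_derive t 1 (flat k) (flat k.+2 t - k%:R * flat k.+1 t).
Proof.
have [t0|t0] := leP t 0.
  have f0 j s : s <= 0 -> flat j s = 0 by move=> s0; rewrite /flat ltNge s0.
  rewrite !(f0 _ t)// mulr0 subr0.
  (* At and to the left of the origin the bound s^m exp(-s) <= m! with s = 1/t and m = k + 2 makes
     the function O(t^2), so the derivative is zero there. *)
  apply: (@quadratic_is_derive _ _ _ _ _ _ (k.+2)`!%:R) => h _.
  rewrite (f0 _ t)// mulr0 !subr0 [_ *: _]mulr1 ger0_norm ?flat_ge0//.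
  have [ht|ht] := leP (h + t) 0; first by rewrite f0// mulr_ge0 ?sqr_ge0.
  apply: (le_trans (flat_le _ _)); rewrite ler_wpM2l//.
  by rewrite lerXn2r ?nnegrE; lra.
pose g (s : R) := s^-1 ^+ k * expR (- s^-1).
have tn0 : t != 0 by rewrite gt_eqF.
have dg : is_derive t 1 g (flat k.+2 t - k%:R * flat k.+1 t).
  have di : is_derive t 1 (fun s : R => s^-1) (- t^-1 ^+ 2).
    apply: (is_derive_eq (is_deriveV (f := id) tn0 (is_derive_id t 1))).
    by rewrite [_ *: _]mulr1 exprVn.
  have dx := @is_deriveX _ _ _ k t 1 _ di.
  have dn := is_deriveN di.
  have de := @is_derive1_comp _ expR _ t _ _ (is_derive_expR _) dn.
  have -> : g = ((fun s => s^-1) ^+ k : R -> R) * (expR \o - (fun s => s^-1)).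
    by apply/funext => s; rewrite /g exprfctE.
  apply: (is_derive_eq (is_deriveM dx de)).
  rewrite /flat t0 exprfctE /=.
  transitivity (t^-1 ^+ k * (expR (- t^-1) * - - t^-1 ^+ 2) +
    expR (- t^-1) * (k%:R * t^-1 ^+ k.-1 * - t^-1 ^+ 2)); first by [].
  case: k {dx g} => [|k]; first by ring.
  by rewrite /= !exprS; ring.
apply: near_eq_is_derive dg.
near=> s; rewrite /flat ifT//; near: s; exact: lt_nbhsr.
Unshelve. all: by end_near. Qed.

End flat.

Section smooth.
Context {R : realType} {n : nat}.
Notation T := 'rV[R]_n.
Implicit Types (f g : T -> R) (x y z : T) (i j : 'I_n) (s : seq 'I_n).

Definition vec i : T := delta_mx ord0 i.
Definition partial i f : T -> R := fun x => 'D_(vec i) f x.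

Lemma pderiv_cons i s f : pderiv (i :: s) f = partial i (pderiv s f).
Proof. by []. Qed.

Lemma pderiv_rcons i s f : pderiv (rcons s i) f = pderiv s (partial i f).
Proof. by rewrite /pderiv foldr_rcons. Qed.

(** [smooth] quantifies over words of directions, which suits translation and restriction but not
    the product rule; this recursion peels off the innermost derivative and allows induction on the
    order. *)
Fixpoint Ck k f : Prop :=
  continuous f /\ if k is k'.+1 then
    forall i, (forall x, derivable f x (vec i)) /\ Ck k' (partial i f) else True.

Lemma CkS k f : Ck k.+1 f -> Ck k f.
Proof.
elim: k f => [|k ih] f [cf df]; first by split.
by split=> // i; have [d1 d2] := df i; split => //; exact: ih.
Qed.

Lemma smooth_Ck f : smooth f <-> forall k, Ck k f.
Proof.
split=> [+ k|].
  elim: k f => [|k ih] f sf; first by have [] := sf [::].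
  split; first by have [] := sf [::].
  move=> i; split; first by move=> x; have [_ +] := sf [::]; exact.
  by apply: ih => s; rewrite -pderiv_rcons; exact: sf.
move=> + s; elim/last_ind: s f => [|s i ih] f Cf.
  by have [cf df] := Cf 1; split => // i x; have [] := df i.
rewrite pderiv_rcons; apply: ih => k; have [_ /(_ i)[]] := Cf k.+1; by [].
Qed.

Lemma smooth_continuous f : smooth f -> continuous f.
Proof. by move=> /(_ [::])[]. Qed.

Lemma smooth_derivable f i x : smooth f -> is_derive x (vec i) f (partial i f x).
Proof. by move=> /(_ [::])[_ /(_ i x)]; exact: derivableP. Qed.

Lemma smooth_pderiv s f : smooth f -> smooth (pderiv s f).
Proof.
by move=> sf t; rewrite /pderiv -foldr_cat; exact: sf.
Qed.

Lemma smooth_partial i f : smooth f -> smooth (partial i f).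
Proof. exact: (@smooth_pderiv [:: i]). Qed.

Lemma partialE i f (g : T -> R) : (forall x, is_derive x (vec i) f (g x)) -> partial i f = g.
Proof. by move=> fg; apply/funext => x; exact: derive_val. Qed.

Lemma smooth_cst (a : R) : smooth (fun _ : T => a).
Proof.
apply/smooth_Ck => k; elim: k a => [|k ih] a; first by split => //; exact: cst_continuous.
split=> [|i]; first exact: cst_continuous.
split=> [x|]; first exact: derivable_cst.
by have -> : partial i (fun=> a) = (fun=> 0) by apply: partialE => x; exact: is_derive_cst.
Qed.

Lemma partialD i f g : smooth f -> smooth g ->
  partial i (fun x => f x + g x) = (fun x => partial i f x + partial i g x).
Proof.
by move=> sf sg; apply: partialE => x; apply: is_deriveD; exact: smooth_derivable.
Qed.

Lemma partialM i f g : smooth f -> smooth g ->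
  partial i (fun x => f x * g x) = (fun x => partial i f x * g x + f x * partial i g x).
Proof.
move=> sf sg; apply: partialE => x.
apply: (is_derive_eq (is_deriveM (smooth_derivable i x sf) (smooth_derivable i x sg))).
by rewrite addrC mulrC.
Qed.

Lemma partialZ i a f : smooth f ->
  partial i (fun x => a * f x) = (fun x => a * partial i f x).
Proof.
move=> sf; apply: partialE => x; exact: (is_deriveZ a (smooth_derivable i x sf)).
Qed.

Lemma Ck_D k f g : Ck k f -> Ck k g -> Ck k (fun x => f x + g x).
Proof.
elim: k f g => [|k ih] f g [cf df] [cg dg]; first by split => // x; exact: (continuousD (cf x) (cg x)).
split=> [x|i]; first exact: (continuousD (cf x) (cg x)).
have [df1 df2] := df i; have [dg1 dg2] := dg i.
split=> [x|]; first exact: derivableD.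
have -> : partial i (fun x => f x + g x) = (fun x => partial i f x + partial i g x).
  by apply: partialE => x; apply: is_deriveD; exact: derivableP.
exact: ih.
Qed.

Lemma Ck_M k f g : Ck k f -> Ck k g -> Ck k (fun x => f x * g x).
Proof.
elim: k f g => [|k ih] f g Cf Cg.
  by have [cf _] := Cf; have [cg _] := Cg; split => // x; exact: (continuousM (cf x) (cg x)).
have [cf df] := Cf; have [cg dg] := Cg.
split=> [x|i]; first exact: (continuousM (cf x) (cg x)).
have [df1 df2] := df i; have [dg1 dg2] := dg i.
split=> [x|]; first exact: derivableM.
have -> : partial i (fun x => f x * g x) = (fun x => f x * partial i g x + g x * partial i f x).
  by apply: partialE => x; exact: (is_deriveM (derivableP (df1 x)) (derivableP (dg1 x))).
by apply: Ck_D; apply: ih => //; exact: CkS.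
Qed.

Lemma smoothD f g : smooth f -> smooth g -> smooth (fun x => f x + g x).
Proof. by move=> /smooth_Ck sf /smooth_Ck sg; apply/smooth_Ck => k; exact: Ck_D. Qed.

Lemma smoothM f g : smooth f -> smooth g -> smooth (fun x => f x * g x).
Proof. by move=> /smooth_Ck sf /smooth_Ck sg; apply/smooth_Ck => k; exact: Ck_M. Qed.

Lemma smoothZ a f : smooth f -> smooth (fun x => a * f x).
Proof. by move=> sf; apply: smoothM; [exact: smooth_cst|exact: sf]. Qed.

Lemma smooth_sum (I : Type) (r : seq I) (F : I -> T -> R) :
  (forall k, smooth (F k)) -> smooth (fun x => \sum_(i <- r) F i x).
Proof.
move=> sF; elim: r => [|i r ih].
  rewrite (_ : (fun _ => _) = (fun=> 0)); first exact: smooth_cst.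
  by apply/funext => x; rewrite big_nil.
rewrite (_ : (fun _ => _) = (fun x => F i x + \sum_(i <- r) F i x)); first by apply: smoothD; [exact: sF|exact: ih].
by apply/funext => x; rewrite big_cons.
Qed.

Lemma smooth_prod (I : Type) (r : seq I) (F : I -> T -> R) :
  (forall k, smooth (F k)) -> smooth (fun x => \prod_(i <- r) F i x).
Proof.
move=> sF; elim: r => [|i r ih].
  rewrite (_ : (fun _ => _) = (fun=> 1)); first exact: smooth_cst.
  by apply/funext => x; rewrite big_nil.
rewrite (_ : (fun _ => _) = (fun x => F i x * \prod_(i <- r) F i x)); first by apply: smoothM; [exact: sF|exact: ih].
by apply/funext => x; rewrite big_cons.
Qed.

Lemma partial_coord i j : partial i (fun x => x ord0 j) = (fun=> (i == j)%:R).
Proof.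
apply: partialE => x; apply: (@quadratic_is_derive _ _ _ _ _ _ 0) => h _.
by rewrite !mxE eqxx /= [j == i]eq_sym addrK subrr normr0 mul0r.
Qed.

Lemma smooth_coord j : smooth (fun x => x ord0 j).
Proof.
apply/smooth_Ck => -[|k]; (split; first exact: coord_continuous) => // i; split.
  move=> x; suff : is_derive x (vec i) (fun x => x ord0 j) (i == j)%:R by case.
  apply: (@quadratic_is_derive _ _ _ _ _ _ 0) => h _.
  by rewrite !mxE eqxx /= [j == i]eq_sym addrK subrr normr0 mul0r.
by rewrite partial_coord; move: k; exact/smooth_Ck/smooth_cst.
Qed.

Lemma is_derive_flat_comp k i g x : smooth g ->
  is_derive x (vec i) (fun x => flat k (g x))
   ((flat k.+2 (g x) - k%:R * flat k.+1 (g x)) * partial i g x).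
Proof.
move=> sg; apply/is_derive_line0.
have := smooth_derivable i x sg => /is_derive_line0 dg.
apply: is_derive1_comp; rewrite /= scale0r add0r; exact: is_derive_flat.
Qed.

Lemma partial_flat k i g : smooth g -> partial i (fun x => flat k (g x)) =
  (fun x => (flat k.+2 (g x) - k%:R * flat k.+1 (g x)) * partial i g x).
Proof. by move=> sg; apply: partialE => x; exact: is_derive_flat_comp. Qed.

Lemma continuous_flat k : continuous (@flat R k).
Proof.
move=> t; apply: differentiable_continuous; apply/derivable1_diffP.
by case: (is_derive_flat k t).
Qed.

Lemma smooth_flat k g : smooth g -> smooth (fun x => flat k (g x)).
Proof.
(* [k] stays general, since differentiation raises it by one and by two. *)
move=> sg; apply/smooth_Ck => m; elim: m k => [|m ih] k.
  by split => // x; apply: continuous_comp; [exact: smooth_continuous|exact: continuous_flat].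
split=> [x|i].
  by apply: continuous_comp; [exact: smooth_continuous|exact: continuous_flat].
split=> [x|]; first by case: (is_derive_flat_comp k i x sg).
rewrite partial_flat//; apply: Ck_M; last by move: m {ih}; exact/smooth_Ck/smooth_partial.
under eq_fun do rewrite -mulNr.
by apply: Ck_D => //; apply: Ck_M => //; move: m {ih}; exact/smooth_Ck/smooth_cst.
Qed.

Lemma partial_shift i f z : partial i (fun x => f (x + z)) = (fun x => partial i f (x + z)).
Proof.
apply/funext => x; rewrite /partial /derive.
suff -> : (fun h : R => h^-1 *: (((fun x : T => f (x + z)) \o shift x) (h *: vec i) - f (x + z))) =
  (fun h => h^-1 *: ((f \o shift (x + z)) (h *: vec i) - f (x + z))) by [].
by apply/funext => h /=; rewrite addrA.
Qed.

Lemma pderiv_shift s f z : pderiv s (fun x => f (x + z)) = (fun x => pderiv s f (x + z)).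
Proof. by elim: s => // i s ih; rewrite !pderiv_cons ih partial_shift. Qed.

Lemma smooth_shift f z : smooth f -> smooth (fun x => f (x + z)).
Proof.
move=> sf s; rewrite pderiv_shift; have [cf df] := sf s; split.
  move=> x; apply: (@continuous_comp _ _ _ (fun x : T => x + z) (pderiv s f)); last exact: cf.
  apply: (@continuousD _ _ _ (fun x : T => x) (fun=> z)); last exact: cst_continuous.
  by move=> A.
move=> i x; have := df i (x + z); rewrite /derivable.
suff -> : (fun h : R => h^-1 *: (((fun x : T => pderiv s f (x + z)) \o shift x) (h *: delta_mx ord0 i) - pderiv s f (x + z))) =
  (fun h => h^-1 *: ((pderiv s f \o shift (x + z)) (h *: delta_mx ord0 i) - pderiv s f (x + z))) by [].
by apply/funext => h /=; rewrite addrA.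
Qed.

Lemma is_derive_smooth_line f i x (s : R) : smooth f ->
  is_derive s 1 (fun s : R => f (s *: vec i + x)) (partial i f (s *: vec i + x)).
Proof.
by move=> sf; apply: (proj1 (is_derive_lineP f x (vec i) s _)); exact: smooth_derivable.
Qed.

Lemma smooth_taylor1 f i x (t K : R) : smooth f -> (forall y, `|partial i f y| <= K) ->
  `|f (t *: vec i + x) - f x| <= K * `|t|.
Proof.
move=> sf fK.
have D (s : R) : is_derive s 1 (fun s : R => f (s *: vec i + x)) (partial i f (s *: vec i + x)).
  exact: is_derive_smooth_line.
have C (a b : R) : {within `[a, b], continuous (fun s : R => f (s *: vec i + x))}.
  apply/continuous_subspaceT => s; apply: differentiable_continuous.
  by apply/derivable1_diffP; case: (D s).
have f0 : f x = f (0 *: vec i + x) by rewrite scale0r add0r.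
have [t0|t0] := leP 0 t.
  have [c _ E] := MVT_segment t0 (fun (s : R) _ => D s) (C 0 t).
  by rewrite f0 E subr0 normrM ler_wpM2r.
have [c _ E] := MVT_segment (ltW t0) (fun (s : R) _ => D s) (C t 0).
by rewrite f0 distrC E sub0r normrM normrN ler_wpM2r.
Qed.

(** The mean value theorem is applied to f minus its linear part, and [smooth_taylor1] then bounds
    the increment of the derivative; this yields K t^2 instead of the sharp K t^2 / 2. *)
Lemma smooth_taylor2 f i x (t K : R) : smooth f -> (forall y, `|partial i (partial i f) y| <= K) ->
  `|f (t *: vec i + x) - f x - t * partial i f x| <= K * t ^+ 2.
Proof.
move=> sf fK.
pose g (s : R) := f (s *: vec i + x) - s * partial i f x.
have D (s : R) : is_derive s 1 g (partial i f (s *: vec i + x) - partial i f x).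
  have d1 : is_derive s 1 (fun s : R => f (s *: vec i + x)) (partial i f (s *: vec i + x)).
    exact: is_derive_smooth_line.
  have d2 : is_derive s 1 (fun s : R => s * partial i f x) (partial i f x).
    apply: (is_derive_eq (is_deriveM (is_derive_id s 1) (is_derive_cst (partial i f x) s 1))).
    by rewrite scaler0 add0r [_ *: _]mulr1.
  exact: is_deriveB.
have C (a b : R) : {within `[a, b], continuous g}.
  apply/continuous_subspaceT => s; apply: differentiable_continuous.
  by apply/derivable1_diffP; case: (D s).
have g0 : g 0 = f x by rewrite /g scale0r add0r mul0r subr0.
rewrite -addrA -opprD [f x + _]addrC opprD addrA -/(g t) -g0.
have B (c : R) : `|c| <= `|t| -> `|(partial i f (c *: vec i + x) - partial i f x) * t| <= K * t ^+ 2.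
  move=> ct; rewrite normrM -[t ^+ 2]real_normK ?num_real// expr2 mulrA ler_wpM2r//.
  apply: (le_trans (smooth_taylor1 _ _ (smooth_partial i sf) fK)).
  by rewrite ler_wpM2l// (le_trans _ (fK x)).
have [t0|t0] := leP 0 t.
  have [c ct E] := MVT_segment t0 (fun (s : R) _ => D s) (C 0 t).
  rewrite E subr0 B// ger0_norm ?(itvP ct)// ger0_norm//.
  by rewrite (itvP ct).
have [c ct E] := MVT_segment (ltW t0) (fun (s : R) _ => D s) (C t 0).
rewrite distrC E sub0r mulrN normrN B// (ler0_norm (ltW t0)) ler0_norm ?(itvP ct)//.
by rewrite lerN2 (itvP ct).
Qed.

End smooth.

(** * Test functions *)

Section test.
Context {R : realType} {n : nat}.
Notation T := 'rV[R]_n.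
Notation mu := (@lebm R n).
Implicit Types (f g : T -> R) (x y z : T) (i j : 'I_n) (s : seq 'I_n) (U : set T).

Definition sqn x : R := \sum_i x ord0 i ^+ 2.
Definition cball (r : R) : set T := [set x | sqn x <= r ^+ 2].

Lemma smooth_sqn : smooth sqn.
Proof.
apply: (@smooth_sum R n 'I_n _ (fun (i : 'I_n) (x : T) => x ord0 i ^+ 2)) => i.
under eq_fun do rewrite expr2.
by apply: smoothM; exact: smooth_coord.
Qed.

Lemma sqn_coord x i : x ord0 i ^+ 2 <= sqn x.
Proof. by rewrite /sqn (bigD1 i)//= lerDl sumr_ge0// => j _; exact: sqr_ge0. Qed.

Lemma cball_coord (r : R) x i : 0 <= r -> cball r x -> `|x ord0 i| <= r.
Proof.
move=> r0 /(le_trans (sqn_coord x i)).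
by rewrite -[x ord0 i ^+ 2]real_normK ?num_real// ler_pXn2r ?nnegrE.
Qed.

Lemma cball_compact (r : R) : 0 <= r -> compact (cball r).
Proof.
move=> r0; apply: bounded_closed_compact.
  exists r; split; first exact: num_real.
  move=> M rM x xr; apply: (le_trans _ (ltW rM)).
  rewrite [`|x|]mx_normrE; apply: bigmax_le => // -[i j] _ /=.
  by rewrite (ord1 i); exact: cball_coord.
apply: (@closed_comp _ _ sqn [set y : R | y <= r ^+ 2]); last exact: closed_le.
by move=> x _; exact/smooth_continuous/smooth_sqn.
Qed.

Lemma test_functionI U f (K : set T) : smooth f -> compact K -> K `<=` U ->
  (forall x, ~ K x -> f x = 0) -> test_function U f.
Proof.
move=> sf cK KU fK.
have cl : closed K by apply: compact_closed => //; exact: norm_hausdorff.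
have sK : closure [set x | f x != 0] `<=` K.
  rewrite [X in _ `<=` X](proj1 (closure_id K) cl); apply: closure_subset => x /= /eqP fx.
  by apply: contrapT => /fK.
split=> //; last exact: subset_trans KU.
by apply: subclosed_compact cK sK; exact: closed_closure.
Qed.

Definition tsupp f : set T := closure [set x | f x != 0].

Lemma tsupp_out f x : ~ tsupp f x -> f x = 0.
Proof.
move=> fx; apply/eqP; apply: contrapT => /negP/eqP f0; apply: fx.
by apply: subset_closure; exact/eqP.
Qed.

Lemma near_eq_partial i f g x : (\near x, f x = g x) -> partial i f x = partial i g x.
Proof. exact: near_eq_derive. Qed.

Lemma pderiv_out s f x : ~ tsupp f x -> pderiv s f x = 0.
Proof.
move=> fx; have oA : open (~` tsupp f) by apply: closed_openC; exact: closed_closure.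
elim: s x fx => [|i s ih] x fx; first exact: tsupp_out.
rewrite pderiv_cons (@near_eq_partial i _ (fun=> 0)).
  by rewrite /partial derive_cst.
have : nbhs x (~` tsupp f) by exact: open_nbhs_nbhs.
by apply: filterS => y fy; exact: ih.
Qed.

Lemma test_pderiv U s f : test_function U f -> test_function U (pderiv s f).
Proof.
move=> [sf cf fU]; apply: (test_functionI (K := tsupp f)); [exact: smooth_pderiv|exact: cf|exact: fU|].
by move=> x; exact: pderiv_out.
Qed.

Lemma test_partial U i f : test_function U f -> test_function U (partial i f).
Proof. exact: (@test_pderiv U [:: i]). Qed.

Lemma test_smooth U f : test_function U f -> smooth f.
Proof. by case. Qed.

Lemma test_sub U V f : U `<=` V -> test_function U f -> test_function V f.
Proof. by move=> UV [? ? fU]; split => //; exact: subset_trans UV. Qed.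

Lemma testD U f g : test_function U f -> test_function U g ->
  test_function U (fun x => f x + g x).
Proof.
move=> [sf cf fU] [sg cg gU]; apply: (test_functionI (K := tsupp f `|` tsupp g)).
- by apply: smoothD; [exact: sf|exact: sg].
- exact: compactU.
- by move=> x [/fU|/gU].
- by move=> x /not_orP[fx gx]; rewrite !tsupp_out// addr0.
Qed.

Lemma testMl U f g : test_function U f -> smooth g -> test_function U (fun x => f x * g x).
Proof.
move=> [sf cf fU] sg; apply: (test_functionI (K := tsupp f)); [|exact: cf|exact: fU|].
- by apply: smoothM; [exact: sf|exact: sg].
- by move=> x fx; rewrite tsupp_out// mul0r.
Qed.

Lemma testZ U a f : test_function U f -> test_function U (fun x => a * f x).
Proof.
move=> [sf cf fU]; apply: (test_functionI (K := tsupp f)); [|exact: cf|exact: fU|].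
- by apply: smoothZ; exact: sf.
- by move=> x fx; rewrite tsupp_out// mulr0.
Qed.

Lemma test0 U : test_function U (fun=> 0).
Proof.
apply: (test_functionI (K := set0)); [exact: smooth_cst|exact: compact0|exact: sub0set|by []].
Qed.

Lemma test_shift U V f z : test_function U f ->
  (forall x, U (x + z) -> V x) -> test_function V (fun x => f (x + z)).
Proof.
move=> [sf cf fU] UV.
apply: (test_functionI (K := (fun x => x - z) @` tsupp f)).
- by apply: smooth_shift; exact: sf.
- apply: continuous_compact => //; apply: continuous_subspaceT => x.
  apply: (@continuousD _ _ _ (fun x : T => x) (fun=> - z)); last exact: cst_continuous.
  by move=> A.
- by move=> _ [x xf <-]; apply: UV; rewrite subrK; exact: fU.
- move=> x fx; apply: tsupp_out => fxz; apply: fx.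
  by exists (x + z) => //; rewrite addrK.
Qed.

Lemma test_bounded U f : test_function U f -> exists2 K : R, 0 <= K & forall x, `|f x| <= K.
Proof.
move=> [sf cf _].
have : compact (f @` tsupp f).
  by apply: continuous_compact => //; apply: continuous_subspaceT; exact: smooth_continuous.
move=> /compact_bounded [M [_ MM]].
exists (`|M| + 1) => [|x]; first by rewrite addr_ge0.
have [fx|fx] := pselect (tsupp f x); last by rewrite tsupp_out// normr0 addr_ge0.
apply: (MM (`|M| + 1)); first by rewrite ltr_pwDr// ler_norm.
by exists x.
Qed.

Lemma test_measurable U f : test_function U f -> measurable_fun setT f.
Proof.
move=> [sf _ _]; apply: continuous_measurable_rV.
exact: (smooth_continuous sf).
Qed.

Definition cube (M : R) : set T := box (fun=> `](- M), M[%classic).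

Lemma measurable_cube M : measurable (cube M).
Proof. exact: measurable_box. Qed.

Lemma integral_cube M : 0 < M -> (\int[mu]_x (\1_(cube M) x)%:E = ((2 * M) ^+ n)%:E)%E.
Proof.
move=> M0; rewrite integral_indic//; last exact: measurable_cube.
rewrite setIT; apply: (etrans (@lebm_oo R n (fun=> - M) (fun=> M) _)).
  by move=> _; rewrite gtrN.
by rewrite prodr_const card_ord opprK; congr ((_ ^+ _)%:E); ring.
Qed.

Lemma L1_cube M : 0 < M -> L1 mu (\1_(cube M)).
Proof.
move=> M0; apply/integrableP; split.
  by apply/measurable_EFinP/measurable_indic; exact: measurable_cube.
under eq_integral do rewrite /= ger0_norm//.
by rewrite integral_cube// ltry.
Qed.

Lemma rint_cube M : 0 < M -> rint mu (\1_(cube M)) = (2 * M) ^+ n.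
Proof. by move=> M0; rewrite /rint /Rintegral integral_cube. Qed.

Lemma bounded_L1 f (K M : R) : 0 < M -> measurable_fun setT f -> (forall x, `|f x| <= K) ->
  (forall x, f x != 0 -> forall i, `|x ord0 i| < M) ->
  L1 mu f /\ rint mu (fun x => `|f x|) <= K * (2 * M) ^+ n.
Proof.
move=> M0 mf fK fM; have K0 : 0 <= K by rewrite (le_trans _ (fK 0)).
have fB x : `|f x| <= K * \1_(cube M) x.
  have [/fM xM|/negPn/eqP ->] := boolP (f x != 0).
    rewrite indicE mem_set ?mulr1// => i /=.
    by rewrite in_itv/= -ltr_norml.
  by rewrite normr0 mulr_ge0// indicE.
have i1 := L1_cube M0; have L1f : L1 mu f by apply: L1_le mf (L1Z K i1) fB.
split=> //; apply: (le_trans (le_rint (L1_norm L1f) (L1Z K i1) fB)).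
by rewrite rintZ// rint_cube.
Qed.

Lemma tsupp_box U f : test_function U f ->
  exists2 M : R, 0 < M & forall x, tsupp f x -> forall i, `|x ord0 i| < M.
Proof.
move=> [_ cf _]; have /compact_bounded [M [_ MM]] := cf.
exists (`|M| + 2) => [|x fx i]; first by rewrite ltr_wpDl.
have xM : `|x| <= `|M| + 1 by apply: MM => //; rewrite ltr_pwDr// ler_norm.
apply: (le_lt_trans _ (_ : `|M| + 1 < _)); last by rewrite ltrD2l; lra.
apply: le_trans xM; rewrite [`|x|]mx_normrE.
exact: (le_bigmax _ (fun k : 'I_1 * 'I_n => `|x k.1 k.2|) (ord0, i)).
Qed.

Lemma test_L1 U f : test_function U f -> L1 mu f.
Proof.
move=> tf; have [M M0 fM] := tsupp_box tf; have [K _ fK] := test_bounded tf.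
have [] := bounded_L1 M0 (test_measurable tf) fK => // x fx.
by apply: fM; apply: subset_closure.
Qed.

Lemma test_L2 U f : test_function U f -> L2 mu f.
Proof.
move=> tf; split; first exact: test_measurable tf.
rewrite (_ : (fun x => _) = (fun x => f x * f x)); last by apply/funext => x; rewrite expr2.
exact: (test_L1 (testMl tf (test_smooth tf))).
Qed.

Lemma smooth_quotient f i x (t K : R) : 0 < t -> smooth f ->
  (forall y, `|partial i (partial i f) y| <= K) ->
  `|t^-1 * (f (x + t *: vec i) + -1 * f x) - partial i f x| <= K * t.
Proof.
move=> t0 sf fK; rewrite mulN1r [x + _]addrC.
have -> : t^-1 * (f (t *: vec i + x) - f x) - partial i f x =
    t^-1 * (f (t *: vec i + x) - f x - t * partial i f x).
  by field; rewrite gt_eqF.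
rewrite normrM gtr0_norm ?invr_gt0// ler_pdivrMl// (_ : t * (K * t) = K * t ^+ 2).
  exact: smooth_taylor2.
by ring.
Qed.

(* The difference quotients of [f] in direction [i] commute with [partial j]
   and converge, together with their derivatives, uniformly. *)
Lemma partialC U f i j : test_function U f ->
  partial i (partial j f) = partial j (partial i f).
Proof.
move=> tf; apply/esym/partialE => x.
have sf := test_smooth tf; have sj := smooth_partial j sf.
have [K1 K10 B1] := test_bounded (test_partial i (test_partial i tf)).
have [K2 K20 B2] := test_bounded (test_partial i (test_partial i (test_partial j tf))).
have [K3 K30 B3] := test_bounded (test_partial i (test_partial j (test_partial j tf))).
apply: (@quadratic_is_derive _ _ _ _ _ _ K3) => s _; apply/ler_addgt0Pr => e e0.
(* The increment of [Q f] replaces that of [partial i f] with error K1 t at each of the two points,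
   and its slope is wrong by K2 t, multiplied by |s|; this step size keeps the total below [e]. *)
pose t : R := e / (K1 * 2 + K2 * `|s| + 1).
have D0 : 0 < K1 * 2 + K2 * `|s| + 1 by rewrite ltr_wpDl// addr_ge0// mulr_ge0.
have t0 : 0 < t by rewrite divr_gt0.
have te : (K1 * 2 + K2 * `|s|) * t <= e.
  rewrite /t mulrA ler_pdivrMr// mulrC ler_wpM2l ?(ltW e0)//.
  by rewrite lerDl.
pose Q (h : T -> R) (y : T) : R := t^-1 * (h (y + t *: vec i) + -1 * h y).
have sQ h : smooth h -> smooth (Q h).
  by move=> sh; apply: smoothZ; apply: smoothD; [exact: smooth_shift|exact: smoothZ].
have pQ h : smooth h -> partial j (Q h) = Q (partial j h).
  move=> sh; rewrite /Q partialZ; last first.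
    by apply: smoothD; [exact: smooth_shift|exact: smoothZ].
  by rewrite partialD; [rewrite partial_shift partialZ|exact: smooth_shift|exact: smoothZ].
have B4 y : `|partial j (partial j (Q f)) y| <= K3.
  rewrite pQ// pQ// /Q normrM gtr0_norm ?invr_gt0// ler_pdivrMl// mulN1r mulrC addrC addrC.
  by rewrite [y + _]addrC -[X in _ * X]gtr0_norm//; apply: smooth_taylor1 B3; do 2 apply: smooth_partial.
have := smooth_taylor2 x s (sQ _ sf) B4.
have := smooth_quotient x t0 sf B1; have := smooth_quotient (s *: vec j + x) t0 sf B1.
have := smooth_quotient x t0 sj B2; rewrite -!/(Q _ _) pQ//.
set a := Q f _; set b := Q f _; set c := Q _ _; set d := partial i f _; set a' := partial i f _.
set c' := partial i _ _ => h1 h2 h3 h4.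
have h5 : `|s * (c - c')| <= `|s| * (K2 * t) by rewrite normrM ler_wpM2l.
have -> : d - a' - s * c' = (a - b - s * c) - (a - d) + (b - a') + s * (c - c') by ring.
apply: (le_trans (ler_normD _ _)); apply: (le_trans (lerD (ler_normD _ _) (lexx _))).
apply: (le_trans (lerD (lerD (ler_normB _ _) (lexx _)) (lexx _))).
lra.
Qed.

End test.

(** * Cutoff and mollifiers *)

Section flat_bounds.
Context {R : realType}.
Implicit Types (t : R) (k : nat).

Lemma flat_out k t : t <= 0 -> flat k t = 0.
Proof. by move=> t0; rewrite /flat ltNge t0. Qed.

Lemma flat_le_fact k t : flat k t <= k`!%:R.
Proof.
by rewrite /flat; case: ltP => // t0; apply: exprn_expR_le; rewrite invr_ge0 ltW.
Qed.

(** This gives the cutoff exp(-1/q) the smooth square root exp(-1/(2q)). *)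
Lemma flat0_sqr t : flat 0 t = flat 0 (2 * t) ^+ 2.
Proof.
rewrite /flat pmulr_rgt0//; case: ltP => t0; last by rewrite expr0n.
by rewrite !expr0 !mul1r expr2 -expRD; congr expR; field; rewrite gt_eqF.
Qed.

(** Half of the exponential absorbs the powers of 1/t and the other half is the square root of the
    cutoff. Hence all derivatives of the cutoff are bounded by its square root. *)
Lemma flat_le_flat0 k t : flat k t <= 2 ^+ k * k`!%:R * flat 0 (2 * t).
Proof.
rewrite /flat pmulr_rgt0//; case: ltP => t0; last by rewrite mulr0.
rewrite expr0 mul1r.
have -> : t^-1 ^+ k * expR (- t^-1) =
    2 ^+ k * ((2 * t)^-1 ^+ k * expR (- (2 * t)^-1)) * expR (- (2 * t)^-1).
  rewrite !mulrA -exprMn -mulrA -expRD; congr (_ ^+ k * expR _); field; by rewrite gt_eqF.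
rewrite ler_wpM2r ?expR_ge0// ler_wpM2l ?exprn_ge0//.
by apply: exprn_expR_le; rewrite invr_ge0 mulr_ge0// ltW.
Qed.

Lemma flat0_gt0 t : 0 < t -> 0 < flat 0 t.
Proof. by move=> t0; rewrite /flat t0 mulr_gt0 ?expR_gt0. Qed.

Lemma flat0_mono t1 t2 : 0 < t1 -> t1 <= t2 -> flat 0 t1 <= flat 0 t2.
Proof.
move=> t10 t12; have t20 : 0 < t2 by exact: lt_le_trans t12.
by rewrite /flat t10 t20 !expr0 !mul1r ler_expR lerN2 lef_pV2.
Qed.

Lemma flat0_cvg t : (flat 0 (m.+1%:R * t) @[m --> \oo] --> ((0 < t)%R%:R : R)).
Proof.
have [t0|t0] := leP t 0.
  rewrite (_ : (fun m => _) = (fun=> 0)); first exact: cvg_cst.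
  by apply/funext => m; rewrite flat_out// mulr_ge0_le0.
rewrite (_ : (fun m => _) = (fun m => expR (- (t^-1 * harmonic m)))).
  rewrite -[1%:R](@expR0 R); apply: continuous_cvg; first exact: continuous_expR.
  rewrite -[X in _ --> X]oppr0; apply: cvgN.
  by rewrite -[X in _ --> X](mulr0 t^-1); apply: cvgM; [exact: cvg_cst|exact: cvg_harmonic].
apply/funext => m; rewrite /flat mulr_gt0// expr0 mul1r /harmonic/=.
by rewrite invfM mulrC.
Qed.

End flat_bounds.

Section special.
Context {R : realType} {n : nat}.
Notation T := 'rV[R]_n.
Notation mu := (@lebm R n).

Lemma cvg_prod_nat (I : Type) (r : seq I) (u : I -> nat -> R) (l : I -> R) :
  (forall i, u i m @[m --> \oo] --> l i) ->
  (\prod_(i <- r) u i m @[m --> \oo] --> \prod_(i <- r) l i).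
Proof.
move=> ul; elim: r => [|i r ih].
  rewrite big_nil (_ : (fun m => _) = (fun=> 1)); first exact: cvg_cst.
  by apply/funext => m; rewrite big_nil.
rewrite big_cons (_ : (fun m => _) = (fun m => u i m * \prod_(i <- r) u i m)).
  exact: cvgM.
by apply/funext => m; rewrite big_cons.
Qed.

(** Each coordinate contributes exp(-1/t) at (m + 1) times the distance to either face, which tends
    to 1 inside and is 0 outside. The supports stay in the closed box, so that alone has to lie in
    [U]. *)
Lemma box_approx (U : set T) (a b : 'I_n -> R) :
  (forall x : T, (forall i, a i <= x ord0 i <= b i) -> U x) ->
  exists psi : nat -> T -> R, [/\ forall m, test_function U (psi m),
    forall m x, 0 <= psi m x <= 1,
    forall m x, ~ box (fun i => `]a i, b i[%classic) x -> psi m x = 0 &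
    forall x, psi m x @[m --> \oo] --> (\1_(box (fun i => `]a i, b i[%classic)) x : R)].
Proof.
move=> abU.
pose h (m : nat) (i : 'I_n) (x : T) : R :=
  flat 0 (m.+1%:R * (x ord0 i - a i)) * flat 0 (m.+1%:R * (b i - x ord0 i)).
have h0 m (x : T) i : ~ `]a i, b i[%classic (x ord0 i) -> h m i x = 0.
  move=> /negP; rewrite in_itv/= negb_and -!leNgt /h => /orP[xa|xb].
    by rewrite [flat 0 _]flat_out ?mul0r// mulr_ge0_le0// subr_le0.
  by rewrite [X in _ * X]flat_out ?mulr0// mulr_ge0_le0// subr_le0.
pose psi m x := \prod_i h m i x.
have psi0 m (x : T) : ~ box (fun i => `]a i, b i[%classic) x -> psi m x = 0.
  move=> /existsNP[i xi]; rewrite /psi (bigD1 i)//= h0 ?mul0r//.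
have sh m i : smooth (h m i).
  by apply: smoothM; apply: smooth_flat; apply: smoothZ; apply: smoothD;
    [exact: smooth_coord|exact: smooth_cst|exact: smooth_cst|
     under eq_fun do rewrite -mulN1r; apply: smoothZ; exact: smooth_coord].
have fl (t : R) : 0 <= flat 0 t <= 1 by rewrite flat_ge0 (le_trans (flat_le_fact _ _)).
exists psi; split => //.
- move=> m; apply: (test_functionI (K := [set x : T | forall i, `[a i, b i]%classic (x ord0 i)])).
  + exact: smooth_prod.
  + by apply: (@rV_compact R n (fun i => `[a i, b i]%classic)) => i; exact: segment_compact.
  + move=> x xab; apply: abU => i; have := xab i; by rewrite /= in_itv.
  + move=> x xab; apply: psi0 => xab'; apply: xab => i; have := xab' i.
    by rewrite /= !in_itv/= => /andP[/ltW -> /ltW ->].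
- move=> m x; apply/andP; split; first by apply: prodr_ge0 => i _; rewrite mulr_ge0// flat_ge0.
  apply: prodr_ile1 => i _; rewrite mulr_ge0 ?flat_ge0//=.
  by rewrite mulr_ile1 ?flat_ge0//; [have /andP[] := fl (m.+1%:R * (x ord0 i - a i))|
    have /andP[] := fl (m.+1%:R * (b i - x ord0 i))].
- move=> x; have -> : \1_(box (fun i => `]a i, b i[%classic)) x =
      \prod_i ((0 < x ord0 i - a i)%R%:R * (0 < b i - x ord0 i)%R%:R) :> R.
    rewrite indicE; have [/set_mem xab|/negP xab] := boolP (x \in _).
      rewrite big1// => i _; have := xab i; rewrite /= in_itv/= => /andP[xa xb].
      by rewrite !subr_gt0 xa xb mulr1.
    have /existsNP[i xi] : ~ box (fun i => `]a i, b i[%classic) x by move=> ?; apply: xab; exact/mem_set.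
    rewrite (bigD1 i)//= !subr_gt0 -natrM mulnb; move/negP: xi; rewrite in_itv/= => /negbTE ->.
    by rewrite mul0r.
  by apply: cvg_prod_nat => i; apply: cvgM; exact: flat0_cvg.
Qed.

Lemma partial_sqn i : partial i (@sqn R n) = (fun x => 2 * x ord0 i).
Proof.
apply: partialE => x; apply: (@quadratic_is_derive _ _ _ _ _ _ 1) => h _.
rewrite /sqn -sumrB (bigD1 i)//= big1 => [|j ji].
  rewrite !mxE !eqxx/= mulr1 addr0 mul1r.
  by rewrite (_ : _ - _ = h ^+ 2); [rewrite ger0_norm ?sqr_ge0|ring].
by rewrite !mxE (negbTE ji)/= mulr0 add0r subrr.
Qed.

Definition quad (a b : R) (x : T) : R := a + - b * sqn x.

Lemma smooth_quad a b : smooth (quad a b).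
Proof. by apply: smoothD; [exact: smooth_cst|apply: smoothZ; exact: smooth_sqn]. Qed.

Lemma partial_quad a b i : partial i (quad a b) = (fun x => - (2 * b) * x ord0 i).
Proof.
rewrite /quad partialD; [|exact: smooth_cst|apply: smoothZ; exact: smooth_sqn].
rewrite partialZ; last exact: smooth_sqn.
rewrite partial_sqn (_ : partial i (fun=> a) = fun=> 0).
  by apply/funext => x; ring.
by apply: partialE => x; exact: is_derive_cst.
Qed.

(** With q = (5/8)^2 - |x|^2, take Phi = exp(-1/q) and g = exp(-1/(2q)). The radius 5/8 lies
    strictly between 1/2 and 3/4, and q >= 25/64 - 1/4 = 9/64 on B_{1/2} determines [delta]. *)
Lemma cutoff : exists (Phi g : T -> R) (K delta : R),
  [/\ [/\ test_function (eball (3 / 4)) Phi, measurable_fun setT g &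
      forall x, 0 <= g x <= 1], 0 <= K, 0 < delta, forall x, Phi x = g x ^+ 2 &
   [/\ forall i x, `|partial i Phi x| <= K * g x,
       forall i j x, `|partial i (partial j Phi) x| <= K * g x &
       forall x, eball (1 / 2) x -> delta <= g x]].
Proof.
pose q := quad (25 / 64) 1.
pose Phi x := flat 0 (q x); pose g x := flat 0 (2 * q x).
have sq := smooth_quad (25 / 64) 1.
have q0 x : ~ cball (5 / 8) x -> q x <= 0.
  by move=> /negP; rewrite -ltNge /q /quad => h; lra.
have b k (c B : R) x : (cball (5 / 8) x -> `|c| <= B) -> 
  `|flat k (q x) * c| <= (2 ^+ k * k`!%:R * B) * g x.
  move=> cB; have [xb|/q0 xb] := pselect (cball (5 / 8) x); last first.
    by rewrite /g !flat_out ?mul0r ?normr0 ?mulr0// mulr_ge0_le0.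
  rewrite normrM (ger0_norm (flat_ge0 _ _)) -mulrA [B * _]mulrC mulrA.
  apply: ler_pM => //; [exact: flat_ge0|exact: flat_le_flat0|exact: cB].
have xi1 x i : cball (5 / 8) x -> `|x ord0 i| <= 1.
  by move=> /cball_coord => /(_ i) h; apply: (le_trans (h _)); lra.
(* The first summand bounds the first derivatives and the part of the second derivatives where both
   act on q; the other two bound the parts with [flat 4] and [flat 3], whose polynomial factors are
   at most 4 and 8 on the support. *)
pose K : R := 2 ^+ 2 * 2`!%:R * 2 + (2 ^+ 4 * 4`!%:R * 4 + 2 ^+ 3 * 3`!%:R * 8).
have K0 : 0 <= K by rewrite /K !addr_ge0// !mulr_ge0// exprn_ge0.
exists Phi, g, K, (flat 0 (2 * (9 / 64))); split; [|exact: K0| | |].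
- split.
  + apply: (test_functionI (K := cball (5 / 8))).
    * exact: smooth_flat.
    * by apply: cball_compact; lra.
    * by move=> x; rewrite /cball/eball/= => h; apply: (le_lt_trans h); lra.
    * by move=> x /q0 h; rewrite /Phi flat_out.
  + apply: continuous_measurable_rV; apply: smooth_continuous; apply: smooth_flat.
    by apply: smoothZ.
  + by move=> x; rewrite /g flat_ge0/= (le_trans (flat_le_fact _ _)).
- by apply: flat0_gt0; lra.
- by move=> x; rewrite /Phi flat0_sqr.
have dPhi i : partial i Phi = (fun x => flat 2 (q x) * (-2 * x ord0 i)).
  rewrite /Phi partial_flat// partial_quad; apply/funext => x /=.
  by rewrite mul0r subr0 mulr1.
have g0 x : 0 <= g x by exact: flat_ge0.
have n2 (m : nat) (y : R) : `|- m%:R * y| = m%:R * `|y|.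
  by rewrite normrM normrN (ger0_norm (ler0n R m)).
split.
- move=> i x; rewrite dPhi; apply: (le_trans (b _ _ 2 _ _)).
    by move=> xb; rewrite (n2 2) ler_piMr// xi1.
  by rewrite ler_wpM2r// /K lerDl addr_ge0// !mulr_ge0// exprn_ge0.
- move=> i j x; rewrite dPhi partialM; [|exact: smooth_flat|apply: smoothZ; exact: smooth_coord].
  rewrite partial_flat// partial_quad partialZ; last exact: smooth_coord.
  rewrite partial_coord mulr1.
  have -> : (flat 4 (q x) - 2 * flat 3 (q x)) * (-2 * x ord0 i) * (-2 * x ord0 j) +
     flat 2 (q x) * (-2 * (i == j)%:R) =
     flat 2 (q x) * (-2 * (i == j)%:R) + (flat 4 (q x) * (4 * x ord0 i * x ord0 j)
      + flat 3 (q x) * (-8 * x ord0 i * x ord0 j)) by ring.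
  have h x' (c : R) k l : 0 <= c -> cball (5 / 8) x' -> `|c * x' ord0 k * x' ord0 l| <= c.
    move=> c0 xb; rewrite !normrM ger0_norm// -mulrA ler_piMr// mulr_ile1//; exact: xi1.
  have -> : K * g x = 2 ^+ 2 * 2`!%:R * 2 * g x +
      (2 ^+ 4 * 4`!%:R * 4 * g x + 2 ^+ 3 * 3`!%:R * 8 * g x) by rewrite /K !mulrDl.
  apply: (le_trans (ler_normD _ _)); apply: lerD.
    by apply: b => _; rewrite (n2 2) ler_piMr//; case: (i == j); rewrite ?normr0 ?normr1.
  apply: (le_trans (ler_normD _ _)); apply: lerD; apply: b => xb; first exact: h.
  by rewrite !mulNr normrN; exact: h.
- move=> x; rewrite /eball/= => xb; apply: flat0_mono; first lra.
  by rewrite ler_wpM2l// /q /quad /sqn; lra.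
Qed.

(** A bump exp(-1/(1 - |x|^2 / e^2)) divided by its integral. Only the order 1/e of the L^1 norm of
    its gradient matters: the gradient is at most 4/e on a set of volume at most (4e)^n, and the
    normalisation is at least a constant times e^n. *)
Lemma mollifier : exists2 K : R, 0 <= K & forall e : R, 0 < e -> exists rho : T -> R,
  [/\ test_function (cball e) rho, forall x, 0 <= rho x, rint mu rho = 1 &
     forall p, rint mu (fun x => `|partial p rho x|) <= K / e].
Proof.
pose c : R := flat 0 2^-1.
have c0 : 0 < c by exact: flat0_gt0.
pose N1 : R := n.+1%:R.
have N10 : 0 < N1 by rewrite ltr0n.
exists (4 / c * (4 * N1) ^+ n) => [|e e0].
  by rewrite mulr_ge0 ?divr_ge0 ?exprn_ge0 ?mulr_ge0// ltW.
pose q := quad 1 (e ^- 2).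
have sq := smooth_quad 1 (e ^- 2).
have q0 x : ~ cball e x -> q x <= 0.
  move=> /negP; rewrite -ltNge /q /quad => h.
  by rewrite mulNr subr_le0 mulrC ler_pdivlMr ?exprn_gt0// mul1r ltW.
pose b x := flat 0 (q x).
have tb : test_function (cball e) b.
  apply: (test_functionI (K := cball e)).
  - exact: smooth_flat.
  - by apply: cball_compact; exact: ltW.
  - exact: subset_refl.
  - by move=> x /q0 h; rewrite /b flat_out.
(* On the cube of half-side [M] one has |x|^2 <= e^2 / 2, so the bump is at least [c] = exp(-2)
   there. The use of n + 1 avoids a division by zero in dimension zero. *)
pose M := e / (2 * N1).
have M0 : 0 < M by rewrite divr_gt0// mulr_gt0.
have bM x : c * \1_(cube M) x <= b x.
  rewrite indicE; case: (boolP (x \in _)) => [/set_mem xM|_]; last by rewrite mulr0 flat_ge0.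
  rewrite mulr1; apply: flat0_mono => //.
  suff : sqn x <= e ^+ 2 / 2.
    rewrite /q /quad -ler_pdivrMl ?exprn_gt0// => h; move: h; rewrite mulrC; lra.
  apply: (@le_trans _ _ (\sum_(i < n) M ^+ 2)).
    apply: ler_sum => i _; have := xM i; rewrite /= in_itv/= -ltr_norml => h.
    rewrite -[x ord0 i ^+ 2]real_normK ?num_real//.
    by apply: lerXn2r; rewrite ?nnegrE// ltW.
  rewrite sumr_const card_ord -[M ^+ 2 *+ n]mulr_natl.
  have -> : n%:R * M ^+ 2 = e ^+ 2 * (n%:R / (2 * N1) ^+ 2) by rewrite /M; field; rewrite gt_eqF.
  rewrite ler_wpM2l ?sqr_ge0// ler_pdivrMr ?exprn_gt0 ?mulr_gt0//.
  have : n%:R + 1 = N1 by rewrite /N1 -natr1.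
  have : 0 <= n%:R :> R by [].
  nra.
pose N := rint mu b.
have NM : c * (2 * M) ^+ n <= N.
  rewrite -rint_cube// -rintZ; last exact: L1_cube.
  by apply: le_rint bM; [apply: L1Z; exact: L1_cube|exact: test_L1 tb].
have N0 : 0 < N by apply: lt_le_trans NM; rewrite mulr_gt0// exprn_gt0// mulr_gt0.
exists (fun x => N^-1 * b x); split.
- exact: testZ.
- by move=> x; rewrite mulr_ge0 ?flat_ge0// invr_ge0 ltW.
- by rewrite rintZ; [rewrite mulVf// gt_eqF|exact: test_L1 tb].
move=> p; have sb := test_smooth tb; rewrite partialZ//.
have tp := test_partial p tb.
(* [flat 2] is at most 2!, and the derivative of q is at most 2 / e in absolute value, because |x_p|
   <= e on the support. *)
have pb x : `|partial p b x| <= 4 / e.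
  have [xb|/q0 xb] := pselect (cball e x); last first.
    by rewrite /b (partial_flat _ _ sq) !flat_out// mulr0 subr0 mul0r normr0 divr_ge0// ltW.
  rewrite /b (partial_flat _ _ sq) partial_quad mul0r subr0 normrM ger0_norm ?flat_ge0//.
  apply: (@le_trans _ _ (2 * (2 / e))); last by rewrite mulrA -natrM.
  apply: ler_pM; rewrite ?flat_ge0//; first exact: flat_le_fact.
  have -> : `|- (2 * e ^- 2) * x ord0 p| = 2 / e * (`|x ord0 p| / e).
    have h : 0 < 2 * e ^- 2 by rewrite mulr_gt0 ?invr_gt0 ?exprn_gt0.
    by rewrite normrM normrN (gtr0_norm h); field; rewrite gt_eqF.
  rewrite ler_piMr ?divr_ge0 ?(ltW e0)// ler_pdivrMr// mul1r.
  by apply: cball_coord xb; exact: ltW.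
have e2 : 0 < 2 * e by rewrite mulr_gt0.
have [] := bounded_L1 e2 (test_measurable tp) pb.
  move=> x px i; apply: (@le_lt_trans _ _ e); last lra.
  apply: cball_coord; first exact: ltW.
  have [_ _] := tp; apply; apply: subset_closure; exact: px.
move=> _ pbe.
rewrite (@rint_ext _ _ _ _ _ (fun x => N^-1 * `|partial p b x|)); last first.
  by move=> x; rewrite normrM gtr0_norm// invr_gt0.
rewrite rintZ; last exact/L1_norm/test_L1/tp.
rewrite ler_pdivrMl//; apply: (le_trans pbe).
apply: le_trans (ler_wpM2r _ NM); last first.
  by rewrite !mulr_ge0 ?exprn_ge0 ?invr_ge0 ?mulr_ge0 ?ltW.
rewrite le_eqVlt; apply/orP; left; apply/eqP.
have -> : 2 * (2 * e) = (2 * M) * (4 * N1) by rewrite /M; field; rewrite gt_eqF.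
by rewrite exprMn; field; rewrite !gt_eqF.
Qed.

End special.

(** * The du Bois-Reymond lemma *)

Lemma rint_dct d {X : measurableType d} {R : realType} (mu : {measure set X -> \bar R})
    (F : nat -> X -> R) (f g : X -> R) :
  (forall m, measurable_fun setT (F m)) -> measurable_fun setT f ->
  {ae mu, forall x, F m x @[m --> \oo] --> f x} -> L1 mu g ->
  (forall m x, `|F m x| <= g x) ->
  L1 mu f /\ (rint mu (F m) @[m --> \oo] --> rint mu f).
Proof.
move=> mF mf Ff g1 Fg.
have [] := @dominated_convergence _ _ _ mu setT measurableT (fun m x => (F m x)%:E)
  (EFin \o f) (EFin \o g).
- by move=> m; exact/measurable_EFinP.
- exact/measurable_EFinP.
- by apply: filterS Ff => x Fx _; apply: cvg_EFin; [exact: nearW|exact: Fx].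
- exact: g1.
- by apply: aeW => x m _ /=; rewrite lee_fin.
move=> f1 _ cv; split; first exact: f1.
apply: fine_cvg; rewrite -rintE//; exact: cv.
Qed.

Section du_bois_reymond.
Context {R : realType} {n : nat}.
Notation T := 'rV[R]_n.
Notation mu := (@lebm R n).
Implicit Types (a b : 'I_n -> R) (U : set T) (h : T -> R).

Definition obox a b : set T := box (fun i => `]a i, b i[%classic).
Definition kbox a b : set T := [set x | forall i, a i <= x ord0 i <= b i].

Lemma measurable_obox a b : measurable (obox a b).
Proof. exact: measurable_box. Qed.

Lemma kbox_compact a b : compact (kbox a b).
Proof.
rewrite (_ : kbox a b = [set x | forall i, `[a i, b i]%classic (x ord0 i)]).
  by apply: (@rV_compact R n (fun i => `[a i, b i]%classic)) => i; exact: segment_compact.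
by apply/seteqP; split => x /= h i; have := h i; rewrite in_itv.
Qed.

Lemma compact_measurable_rV (K : set T) : compact K -> measurable K.
Proof.
move=> cK; rewrite -[K]setCK; apply: measurableC; apply: open_measurable_rV.
by apply: closed_openC; apply: compact_closed cK; exact: norm_hausdorff.
Qed.

Lemma measurable_kbox a b : measurable (kbox a b).
Proof. apply compact_measurable_rV; apply kbox_compact. Qed.

Lemma obox_kbox a b : obox a b `<=` kbox a b.
Proof. by move=> x xab i; have := xab i; rewrite /= in_itv/= => /andP[/ltW -> /ltW ->]. Qed.

(** Dominated convergence along the test functions of [box_approx]; the indicator of the closed box
    dominates them all. *)
Lemma rint_obox_eq0 U h a b : measurable_fun setT h -> kbox a b `<=` U ->
  L1 mu (fun x => h x * \1_(kbox a b) x) ->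
  (forall eta, test_function U eta -> rint mu (fun x => h x * eta x) = 0) ->
  L1 mu (fun x => h x * \1_(obox a b) x) /\ rint mu (fun x => h x * \1_(obox a b) x) = 0.
Proof.
move=> mh abU h1 h0.
have [psi [tpsi psi01 psi0 cpsi]] := box_approx abU.
have [| | | | |] := @rint_dct _ _ _ mu (fun m x => h x * psi m x)
    (fun x => h x * \1_(obox a b) x) (fun x => `|h x * \1_(kbox a b) x|).
- by move=> m; apply: measurable_funM => //; exact: test_measurable (tpsi m).
- by apply: measurable_funM => //; apply: measurable_indic; exact: measurable_obox.
- by apply: aeW => x; apply: cvgM; [exact: cvg_cst|exact: cpsi].
- exact: L1_norm.
- move=> m x; rewrite !normrM ler_wpM2l//.
  have /andP[p0 p1] := psi01 m x; rewrite ger0_norm//.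
  have [xab|xab] := pselect (kbox a b x); first by rewrite indicE mem_set// normr1.
  by rewrite psi0// => /obox_kbox.
move=> L cv; split=> //; rewrite (_ : (fun m => _) = (fun=> 0)) in cv.
  by apply: (cvg_unique _ cv (cvg_cst _)); exact: norm_hausdorff.
by apply/funext => m; exact: h0.
Qed.

Lemma du_bois_reymond_obox U h a b : measurable_fun setT h -> kbox a b `<=` U ->
  L1 mu (fun x => h x * \1_(kbox a b) x) ->
  (forall eta, test_function U eta -> rint mu (fun x => h x * eta x) = 0) ->
  {ae mu, forall x, obox a b x -> h x = 0}.
Proof.
move=> mh abU h1 h0.
pose hQ x := h x * \1_(obox a b) x.
have [hQ1 hQ0] := rint_obox_eq0 mh abU h1 h0.
have mhQ := L1_measurable hQ1.
pose P A := (\int[mu]_(x in A) (hQ x)%:E = 0)%E.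
pose G : set (set R) := [set A | A = setT \/ RGenOInfty.G A].
have mG : @measurable _ (measurableTypeR R) = <<s G >>.
  apply/seteqP; split.
    rewrite [X in X `<=` _](_ : _ = <<s @RGenOInfty.G R >>).
      apply: smallest_sub; first exact: smallest_sigma_algebra.
      by move=> A GA; apply: sub_sigma_algebra; right.
    exact: RGenOInfty.measurableE.
  apply: smallest_sub; first exact: sigma_algebra_measurable.
  by move=> A [->|[x ->]]; [exact: measurableT|exact: measurable_itv].
have PA : forall A, measurable A -> P A.
  rewrite (measurable_rV_boxE (G := G) (or_introl erefl) mG).
  apply: dynkin_induction.
  - exact: (measurable_rV_boxE (G := G) (or_introl erefl) mG).
  - move=> _ _ [A GA <-] [B GB <-]; rewrite boxI; eexists; last by [].
    move=> i /=; case: (GA i) => [->|[x ->]]; case: (GB i) => [->|[y ->]].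
    + by rewrite setTI; left.
    + by rewrite setTI; right; exists y.
    + by rewrite setIT; right; exists x.
    + right; exists (Num.max x y); apply/seteqP; split => z /=; rewrite !in_itv/= !andbT gt_max.
        by move=> [-> ->].
      by move=> /andP[].
  - by rewrite /P (rintE hQ1) hQ0.
  - move=> _ [A GA <-].
    (* Intersection with upward rays only raises the lower corner of the open box, to [a']; the
       result is again an open box inside the given one, to which [rint_obox_eq0] applies. *)
    have /all_sig[a' Ha'] : forall i, {y : R | a i <= y /\
        `]a i, b i[%classic `&` A i = `]y, b i[%classic}.
      move=> i; apply: cid; case: (GA i) => [->|[x ->]].
        by exists (a i); rewrite setIT.
      exists (Num.max (a i) x); split; first by rewrite le_max lexx.
      apply/seteqP; split => z /=; rewrite !in_itv/= ?andbT gt_max.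
        by move=> [/andP[-> ->] ->].
      by move=> /andP[/andP[-> ->] ->].
    have k'k : kbox a' b `<=` kbox a b.
      move=> x xk i; have /andP[h1' ->] := xk i; rewrite andbT.
      by apply: le_trans h1'; have [] := Ha' i.
    have mA : measurable (box A).
      by apply: measurable_box => i; rewrite mG; apply: sub_sigma_algebra; exact: GA.
    have [L E] : L1 mu (fun x => h x * \1_(obox a' b) x) /\ rint mu (fun x => h x * \1_(obox a' b) x) = 0.
      apply: rint_obox_eq0 h0 => //; first exact: subset_trans abU.
      apply: L1_le (L1_norm h1) _ => [|x].
        apply: measurable_funM => //; apply: measurable_indic.
        exact: measurable_kbox.
      rewrite !normrM ler_wpM2l// !indicE.
      case: (boolP (x \in kbox a' b)) => [/set_mem/k'k xk|_]; last by rewrite normr0.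
      by rewrite mem_set.
    rewrite /P integral_mkcond -[RHS]/((0 : R)%:E) -E -rintE//; apply: eq_integral => x _.
    rewrite patchE /hQ.
    have -> : obox a' b = obox a b `&` box A.
      by rewrite boxI; congr box; apply/funext => i; have [_ ->] := Ha' i.
    by rewrite !indicE in_setI; case: (x \in box A); rewrite ?andbT ?andbF ?mulr0.
  - move=> S mS PS; have := @integral_setU _ _ _ mu S (~` S) (EFin \o hQ) mS (measurableC mS).
    rewrite setUv (rintE hQ1) hQ0 => /(_ _ _)/esym; rewrite PS add0e; apply.
      exact/measurable_EFinP.
    by apply/disj_setPS; rewrite setICr.
  - move=> F mF tF PF; rewrite /P (integral_bigcup tF mF).
      by rewrite eseries0// => i _ _; exact: PF.
    by apply: integrableS hQ1 => //; exact: bigcupT_measurable.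
have : ae_eq mu setT (EFin \o hQ) (EFin \o cst 0).
  apply: integral_ae_eq => //; first exact/measurable_EFinP/measurable_cst.
  by move=> E _ mE; rewrite [RHS]integral0; exact: PA.
by apply: filterS => x /(_ I) [] + xab; rewrite /hQ indicE mem_set// mulr1.
Qed.

Lemma du_bois_reymond U h : open U -> measurable_fun setT h ->
  (forall a b, kbox a b `<=` U -> L1 mu (fun x => h x * \1_(kbox a b) x)) ->
  (forall eta, test_function U eta -> rint mu (fun x => h x * eta x) = 0) ->
  {ae mu, forall x, U x -> h x = 0}.
Proof.
move=> oU mh h1 h0.
pose r2 (q : 'rV[rat]_n) : 'I_n -> R := fun i => ratr (q ord0 i).
(* Enumerating the rational boxes through [unpickle] collects their exceptional sets into one null
   set. *)
have H : {ae mu, forall x, forall k : nat, forall q : 'rV[rat]_n * 'rV[rat]_n,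
    unpickle k = Some q -> kbox (r2 q.1) (r2 q.2) `<=` U -> obox (r2 q.1) (r2 q.2) x -> h x = 0}.
  apply/ae_foralln => k; case: (unpickle k) => [q|]; last by apply: aeW.
  have [qU|qU] := pselect (kbox (r2 q.1) (r2 q.2) `<=` U); last first.
    by apply: aeW => x _ [<-] /qU.
  by apply: filterS (du_bois_reymond_obox mh qU (h1 _ _ qU) h0) => x xq _ [<-] _; exact: xq.
apply: filterS H => x H Ux; have : nbhs x U by apply: open_nbhs_nbhs.
move=> /nbhs_ballP [e /= e0 xeU].
have hq (i : 'I_n) : {q : rat * rat | x ord0 i - e < ratr q.1 /\ ratr q.1 < x ord0 i /\
    x ord0 i < ratr q.2 /\ ratr q.2 < x ord0 i + e}.
  apply: cid.
  have /rat_in_itvoo[q1] : x ord0 i - e < x ord0 i by rewrite ltrBlDr ltrDl.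
  rewrite in_itv/= => /andP[? ?].
  have /rat_in_itvoo[q2] : x ord0 i < x ord0 i + e by rewrite ltrDl.
  by rewrite in_itv/= => /andP[? ?]; exists (q1, q2).
pose q : 'rV[rat]_n * 'rV[rat]_n := (\row_i (sval (hq i)).1, \row_i (sval (hq i)).2).
apply: (H (pickle q) q (pickleK q)).
  move=> y By; apply: xeU; split => // i j; rewrite (ord1 i) /ball/=.
  have := By j; rewrite /r2 /= !mxE; have [] := svalP (hq j).
  by move=> h1' [h2 [h3 h4]] /andP[h5 h6]; rewrite /ball/= ltr_distlC; apply/andP; split; lra.
move=> i /=; rewrite /r2 !mxE in_itv/=; have [] := svalP (hq i).
by move=> h1' [h2 [h3 h4]]; apply/andP.
Qed.

End du_bois_reymond.

(** * Completeness of L^2 and Riesz representation *)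

Section L2_complete.
Context d {X : measurableType d} {R : realType} (mu : {measure set X -> \bar R}).
Implicit Types f g h : X -> R.

Lemma is_cvg_of_geometric (u : nat -> R) (M : R) :
  (forall k, `|u k.+1 - u k| <= M * 2^-1 ^+ k) -> cvgn u.
Proof.
move=> uM.
have cs : cvgn (series (fun k => u k.+1 - u k)).
  apply: normed_cvg; apply: (series_le_cvg _ _ uM).
  - by move=> k; exact: normr_ge0.
  - by move=> k; exact: le_trans (uM k).
  - by apply: is_cvg_geometric_series; rewrite ger0_norm// invf_lt1// ltr1n.
rewrite (_ : u = (fun k => series (fun k => u k.+1 - u k) k + u 0%N)).
  by apply: is_cvgD cs _; exact: is_cvg_cst.
by apply/funext => k; rewrite /series/= telescope_sumr// subrK.
Qed.

Lemma integral_sqr h : L2 mu h -> (\int[mu]_x (h x ^+ 2)%:E = (nrm2 mu h ^+ 2)%:E)%E.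
Proof. by move=> [mh hh]; rewrite nrm2_sqr -rintE. Qed.

(** The function sum_k 4^k v_k^2 has a finite integral, since its k-th term contributes at most
    4^-(k+2). It is therefore finite almost everywhere, and the square root of its value serves as
    [M]. *)
Lemma ae_geometric_bound (v : nat -> X -> R) : (forall k, L2 mu (v k)) ->
  (forall k, nrm2 mu (v k) <= 4^-1 ^+ k.+1) ->
  {ae mu, forall x, exists M : R, forall k, `|v k x| <= M * 2^-1 ^+ k}.
Proof.
move=> v2 vk.
pose f k x : \bar R := (4 ^+ k * v k x ^+ 2)%:E.
have mf k : measurable_fun setT (f k).
  by apply/measurable_EFinP/measurable_funM => //; apply: measurable_funX; case: (v2 k).
have f0 k x : (0 <= f k x)%E by rewrite lee_fin; apply: mulr_ge0; [exact: exprn_ge0|exact: sqr_ge0].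
have If : (\int[mu]_x (\sum_(k <oo) f k x) < +oo)%E.
  rewrite integral_nneseries//.
  apply: (@le_lt_trans _ _ (\sum_(k <oo) (1 / (2 ^ k.+1)%:R)%:E)%E).
    apply: lee_nneseries => [k _ _|k _]; first by apply: integral_ge0.
    have [mv vv] := v2 k.
    rewrite (rintE (L1Z (4 ^+ k) vv)) rintZ// -nrm2_sqr lee_fin.
    apply: (@le_trans _ _ (4 ^+ k * (4^-1 ^+ k.+1) ^+ 2)).
      by rewrite ler_wpM2l ?exprn_ge0// lerXn2r ?nnegrE ?nrm2_ge0// exprn_ge0.
    have -> : (4 ^+ k * (4^-1 ^+ k.+1) ^+ 2 : R) = 4^-1 ^+ k.+2.
      rewrite expr2 [4^-1 ^+ k.+1]exprS [RHS]exprS [4^-1 ^+ k.+1]exprS.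
      have : 4 ^+ k * 4^-1 ^+ k = 1 :> R by rewrite -exprMn divff ?expr1n.
      by move=> E; rewrite (_ : 4 ^+ k * _ = (4 ^+ k * 4^-1 ^+ k) * (4^-1 * (4^-1 * 4^-1 ^+ k))); [rewrite E mul1r|ring].
    rewrite natrX div1r -exprVn exprS (@le_trans _ _ (4^-1 ^+ k.+1))//.
      by rewrite ler_piMl ?exprn_ge0//; lra.
    by rewrite lerXn2r ?nnegrE//; lra.
  by apply: (le_lt_trans (epsilon_trick0 xpredT _)); rewrite ?ltry.
have Ii : mu.-integrable setT (fun x => \sum_(k <oo) f k x)%E.
  apply/integrableP; split; first by apply: ge0_emeasurable_sum.
  by under eq_integral do rewrite gee0_abs ?nneseries_ge0//.
apply: filterS (integrable_ae measurableT Ii) => x /(_ I) fx.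
exists (Num.sqrt (fine (\sum_(k <oo) f k x)%E)) => k.
have : (f k x <= \sum_(k <oo) f k x)%E.
  apply: le_trans (nneseries_lim_ge k.+1 _); last by move=> i _ _; exact: f0.
  by rewrite big_nat_recr//= leeDr// sume_ge0.
have e4 : (4 : R) ^+ k = (2 ^+ k) ^+ 2.
  by rewrite -exprM mulnC exprM; congr (_ ^+ k); rewrite -natrX.
rewrite -(fineK fx) lee_fin e4 -exprMn => h.
rewrite exprVn ler_pdivlMr ?exprn_gt0// -(ger0_norm (_ : 0 <= 2 ^+ k)) ?exprn_ge0//.
by rewrite -normrM mulrC -sqrtr_sqr ler_sqrt// (le_trans _ h)// sqr_ge0.
Qed.

(** The prescribed rate makes the sequence itself converge almost everywhere, without passing to a
    subsequence, and Fatou's lemma carries the rate over to the limit. *)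
Lemma L2_complete (u : nat -> X -> R) : (forall k, L2 mu (u k)) ->
  (forall k j, (k <= j)%N -> nrm2 mu (fun x => u j x - u k x) <= 4^-1 ^+ k.+1) ->
  exists2 g, L2 mu g & forall k, nrm2 mu (fun x => g x - u k x) <= 4^-1 ^+ k.+1.
Proof.
move=> u2 uk.
have [N [mN muN Nu]] := @ae_geometric_bound (fun k x => u k.+1 x - u k x)
  (fun k => L2B (u2 k.+1) (u2 k)) (fun k => uk k k.+1 (leqnSn k)).
(* Set to zero on the exceptional null set, the sequence converges at every point, which makes the
   pointwise limit measurable. *)
pose v k x := u k x * \1_(~` N) x.
have mv k : measurable_fun setT (v k).
  apply: measurable_funM; first by case: (u2 k).
  by apply: measurable_indic; exact: measurableC.
have cv x : cvgn (v ^~ x).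
  have [xN|xN] := pselect (N x).
    rewrite (_ : v ^~ x = fun=> 0); first exact: is_cvg_cst.
    by apply/funext => k; rewrite /v indicE memNset ?mulr0//; exact.
  have [M xM] : exists M : R, forall k, `|u k.+1 x - u k x| <= M * 2^-1 ^+ k.
    by apply: contrapT => h; apply: xN; exact: Nu.
  rewrite (_ : v ^~ x = u ^~ x); first exact: is_cvg_of_geometric xM.
  by apply/funext => k; rewrite /v indicE mem_set ?mulr1.
pose g x := limn (v ^~ x).
have mg : measurable_fun setT g.
  by apply: (measurable_fun_cvg mv) => x _; exact: cv.
have vae k : {ae mu, forall x, u k x = v k x}.
  exists N; split=> // x /= h; apply: contrapT => xN; apply: h.
  by rewrite /v indicE mem_set ?mulr1.
(* The integrand is the lower limit in j of (v_{k+j} - v_k)^2, whose integrals are bounded by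
   hypothesis. *)
have B k : (\int[mu]_x ((g x - v k x) ^+ 2)%:E <= ((4^-1 ^+ k.+1) ^+ 2)%:E)%E.
  have E : (fun x => ((g x - v k x) ^+ 2)%:E) =
      (fun x => limn_einf (fun j => ((v (k + j)%N x - v k x) ^+ 2)%:E)).
    apply/funext => x; apply/esym.
    have cvx : ((v (k + j)%N x - v k x) ^+ 2)%:E @[j --> \oo] --> ((g x - v k x) ^+ 2)%:E.
      apply: cvg_EFin; first exact: nearW.
      have c1 : v (k + j)%N x @[j --> \oo] --> g x.
        have h : v j x @[j --> \oo] --> g x by exact: cv.
        by rewrite -(cvg_shiftn k) in h; under eq_fun do rewrite addnC; exact: h.
      rewrite expr2; under eq_fun do rewrite /= expr2.
      by apply: cvgM; apply: cvgB => //; exact: cvg_cst.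
    by rewrite is_cvg_limn_einfE; [exact/cvg_lim/cvx|apply/cvg_ex; eexists; exact: cvx].
  rewrite E; apply: le_trans (fatou mu measurableT _ _) _.
  - by move=> j; apply/measurable_EFinP; apply: measurable_funX; exact: measurable_funB.
  - by move=> j x _; rewrite lee_fin sqr_ge0.
  rewrite limn_einf_lim; apply: lime_le; first exact: is_cvg_einfs.
  apply: nearW => j; apply: ge_ereal_inf; eexists; first by exists j => /=.
  have h2 := L2B (u2 (k + j)%N) (u2 k).
  rewrite (ae_eq_integral (fun x => ((u (k + j)%N x - u k x) ^+ 2)%:E))//.
  - rewrite (integral_sqr h2) lee_fin lerXn2r ?nnegrE ?nrm2_ge0 ?exprn_ge0//.
    by apply: uk; rewrite leq_addr.
  - by apply/measurable_EFinP; apply: measurable_funX; exact: measurable_funB.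
  - by apply/measurable_EFinP; apply: measurable_funX; case: h2.
  - by apply: filterS2 (vae k) (vae (k + j)%N) => x -> -> _.
have v2 k : L2 mu (v k).
  split => //; have [mu2 uu] := u2 k.
  have [] := rint_ae_ext uu (measurable_funX 2 (mv k)) => //.
  by apply: filterS (vae k) => x ->.
have d2 k : L2 mu (fun x => g x - v k x).
  split; first exact: measurable_funB.
  apply/integrableP; split; first by apply/measurable_EFinP/measurable_funX; exact: measurable_funB.
  under eq_integral do rewrite /= ger0_norm ?sqr_ge0//.
  by apply: le_lt_trans (B k) _; rewrite ltry.
have g2 : L2 mu g.
  by apply: L2_ext (L2D (d2 0%N) (v2 0%N)) => x; rewrite subrK.
exists g => // k.
have [_ e2] : L1 mu (fun x => (g x - u k x) ^+ 2) /\
    rint mu (fun x => (g x - v k x) ^+ 2) = rint mu (fun x => (g x - u k x) ^+ 2).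
  apply: rint_ae_ext; first by case: (d2 k).
    by apply: measurable_funX; apply: measurable_funB => //; case: (u2 k).
  by apply: filterS (vae k) => x ->.
rewrite -(@ler_pXn2r _ 2)// ?nnegrE ?nrm2_ge0 ?exprn_ge0//.
by rewrite nrm2_sqr -e2 -lee_fin -rintE//; case: (d2 k).
Qed.

End L2_complete.

Section riesz.
Context d {X : measurableType d} {R : realType} (mu : {measure set X -> \bar R}).
Implicit Types f g h : X -> R.

Lemma quadratic_nonneg (A B D : R) : 0 <= B -> 0 <= D ->
  (forall t, - D <= A * t + B * t ^+ 2) -> A ^+ 2 <= 4 * B * D.
Proof.
move=> B0 D0 H; have [B00|Bn0] := eqVneq B 0.
  have [->|An0] := eqVneq A 0; first by rewrite expr0n B00 mulr0 mul0r.
  have := H (- (D + 1) / A); rewrite B00 mul0r addr0 (_ : A * _ = - (D + 1)); first by lra.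
  by field.
have Bp : 0 < B by rewrite lt_neqAle eq_sym Bn0.
have := H (- A / (2 * B)).
have -> : A * (- A / (2 * B)) + B * (- A / (2 * B)) ^+ 2 = - (A ^+ 2 / (4 * B)) by field.
by rewrite lerN2 ler_pdivrMr ?mulr_gt0// [D * _]mulrC.
Qed.

Lemma eq0_of_geometric (a K : R) : 0 <= a -> (forall k, a <= K * 4^-1 ^+ k.+1) -> a = 0.
Proof.
move=> a0 H; apply/eqP; rewrite eq_le a0 andbT.
have c : K * 4^-1 ^+ k.+1 @[k --> \oo] --> 0.
  rewrite -[X in _ --> X](mulr0 K); apply: cvgM; first exact: cvg_cst.
  rewrite (cvg_shiftS (fun k => 4^-1 ^+ k : R)).
  by apply: cvg_expr; rewrite ger0_norm// invf_lt1// ltr1n.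
rewrite -(cvg_lim (@norm_hausdorff _ _) c); apply: limr_ge.
  by apply/cvg_ex; eexists; exact: c.
exact: nearW.
Qed.

(* [g] is the limit of a sequence minimising [|eta|^2 / 2 - L eta]. *)
Lemma riesz (V : (X -> R) -> Prop) (L : (X -> R) -> R) (C : R) : 0 <= C ->
  V (fun=> 0) -> (forall a f g, V f -> V g -> V (fun x => a * f x + g x)) ->
  (forall f, V f -> L2 mu f) ->
  (forall a f g, V f -> V g -> L (fun x => a * f x + g x) = a * L f + L g) ->
  (forall f, V f -> `|L f| <= C * nrm2 mu f) ->
  exists g, [/\ L2 mu g, nrm2 mu g <= C & forall f, V f -> L f = rint mu (fun x => g x * f x)].
Proof.
move=> C0 V0 VD V2 LD LC.
pose J f := nrm2 mu f ^+ 2 / 2 - L f.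
have Jexp a f g : V f -> V g ->
    J (fun x => a * f x + g x) = J g + a * (rint mu (fun x => g x * f x) - L f) + a ^+ 2 * nrm2 mu f ^+ 2 / 2.
  move=> Vf Vg; have f2 := V2 _ Vf; have g2 := V2 _ Vg; have [_ ff] := f2; have [_ gg] := g2.
  rewrite /J LD// !nrm2_sqr.
  rewrite (@rint_ext _ _ _ _ _ (fun x => g x ^+ 2 + ((2 * a) * (g x * f x) + a ^+ 2 * f x ^+ 2))); last first.
    by move=> x; ring.
  rewrite rintD//; last by apply: L1D; apply: L1Z => //; exact: L2M.
  rewrite rintD; [|by apply: L1Z; exact: L2M|exact: L1Z].
  rewrite !rintZ//; last exact: L2M.
  by field.
have Jlb f : V f -> - (C ^+ 2 / 2) <= J f.
  move=> Vf; have := LC _ Vf; rewrite ler_norml => /andP[_ h]; rewrite /J.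
  by have := sqr_ge0 (nrm2 mu f - C); nra.
pose S := [set J f | f in V].
have hS : has_inf S.
  split; first by exists (J (fun=> 0)), (fun=> 0).
  by exists (- (C ^+ 2 / 2)) => _ [f Vf <-]; exact: Jlb.
have Sinf f : V f -> inf S <= J f.
  by move=> Vf; apply: ge_inf; [case: hS|exists f].
(* Comparing J at u_j, at u_k and at their midpoint gives |u_j - u_k|^2 / 4 <= dl j + dl k <= 2 dl k
   for k <= j. The factor 1/8 thus yields exactly the rate that [L2_complete] asks for. *)
pose dl k : R := (4^-1 ^+ k.+1) ^+ 2 / 8.
have dl0 k : 0 < dl k by rewrite divr_gt0// !exprn_gt0// invr_gt0.
have /all_sig[u uP] k : {f | V f /\ J f < inf S + dl k}.
  by apply: cid; have [_ [f Vf <-] h] := inf_adherent (dl0 k) hS; exists f.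
have Vu k : V (u k) by case: (uP k).
have uk k j : (k <= j)%N -> nrm2 mu (fun x => u j x - u k x) <= 4^-1 ^+ k.+1.
  move=> kj; have dj : dl j <= dl k.
    rewrite ler_wpM2r// lerXn2r ?nnegrE ?exprn_ge0//.
    by rewrite ler_wiXn2l//; lra.
  pose w x := -1 * u k x + u j x.
  have Vw : V w by exact: VD.
  have wE : nrm2 mu (fun x => u j x - u k x) = nrm2 mu w.
    by apply: nrm2_ext => x; rewrite /w mulN1r addrC.
  rewrite wE -(@ler_pXn2r _ 2)// ?nnegrE ?nrm2_ge0 ?exprn_ge0//.
  have h1 := Jexp 1 w (u k) Vw (Vu k); have h2 := Jexp 2^-1 w (u k) Vw (Vu k).
  have e1 : J (fun x => 1 * w x + u k x) = J (u j).
    by congr J; apply/funext => x; rewrite /w; ring.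
  have h3 := Sinf _ (VD 2^-1 _ _ Vw (Vu k)).
  have [_ h4] := uP k; have [_ h5] := uP j.
  rewrite e1 in h1; rewrite h2 in h3.
  move: h1 h3 h4 h5 dj; rewrite /dl; set a := rint _ _ - _.
  set b := nrm2 mu w ^+ 2; set b4 := (4^-1 ^+ k.+1) ^+ 2; set bj := (4^-1 ^+ j.+1) ^+ 2.
  rewrite expr1n mul1r mul1r => h1 h3 h4 h5 dj; have e4 : (2^-1 ^+ 2 : R) = 4^-1 by rewrite exprVn -natrX.
  rewrite e4 in h3; lra.
have [g g2 gu] := L2_complete (fun k => V2 _ (Vu k)) uk.
have gk k f : L2 mu f -> `|rint mu (fun x => g x * f x) - rint mu (fun x => u k x * f x)| <= 4^-1 ^+ k.+1 * nrm2 mu f.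
  move=> f2; have u2 := V2 _ (Vu k).
  rewrite -rintB; [|exact: L2M|exact: L2M].
  rewrite (@rint_ext _ _ _ _ _ (fun x => (g x - u k x) * f x)); last by move=> x; ring.
  by apply: (le_trans (cauchy_schwarz (L2B g2 u2) f2)); rewrite ler_wpM2r ?nrm2_ge0.
have gL f : V f -> L f = rint mu (fun x => g x * f x).
  move=> Vf; have f2 := V2 _ Vf; apply/esym/eqP; rewrite -subr_eq0 -normr_eq0; apply/eqP.
  apply: (@eq0_of_geometric _ (2 * nrm2 mu f)) => // k.
  (* The Euler equation up to an error: as u_k is within dl k of the infimum, the quadratic
     polynomial t -> J (u_k + t f) - J (u_k) stays above - dl k, which bounds its linear
     coefficient. *)
  have h : (rint mu (fun x => u k x * f x) - L f) ^+ 2 <= (4^-1 ^+ k.+1 * nrm2 mu f) ^+ 2.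
    apply: (@le_trans _ _ (4 * (nrm2 mu f ^+ 2 / 2) * dl k)).
      apply: quadratic_nonneg; [by rewrite divr_ge0 ?sqr_ge0|exact/ltW/dl0|move=> t].
      have := Sinf _ (VD t _ _ Vf (Vu k)); rewrite Jexp//; have [_] := uP k.
      set A := rint _ _ - _; set Bf := nrm2 mu f ^+ 2; lra.
    rewrite exprMn /dl; have := sqr_ge0 (nrm2 mu f); have := sqr_ge0 (4^-1 ^+ k.+1 : R); nra.
  have h' : `|rint mu (fun x => u k x * f x) - L f| <= 4^-1 ^+ k.+1 * nrm2 mu f.
    rewrite -(@ler_pXn2r _ 2)// ?nnegrE ?mulr_ge0 ?nrm2_ge0 ?exprn_ge0//.
    by rewrite real_normK ?num_real.
  have := gk k _ f2; set a := rint _ _; set b := rint _ _ => h2.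
  rewrite (_ : a - L f = (a - b) + (b - L f)); last by ring.
  by apply: (le_trans (ler_normD _ _)); apply: (le_trans (lerD h2 h')); lra.
exists g; split => //.
set G := nrm2 mu g.
have G0 : 0 <= G by exact: nrm2_ge0.
(* [g] is only a limit of elements of [V], so [L] cannot be evaluated at it; the inequality |g|^2 =
   L g <= C |g| is replaced by its version at u_k. *)
have H k : G ^+ 2 - C * G <= (2 * G + C) * 4^-1 ^+ k.+1.
  have u2 := V2 _ (Vu k).
  have h1 := gk k _ g2; have h2 := gL _ (Vu k); have h3 := LC _ (Vu k).
  have h4 : nrm2 mu (u k) <= G + 4^-1 ^+ k.+1.
    apply: (le_trans _ (lerD (lexx G) (gu k))).
    rewrite -[nrm2 mu (fun x => g x - u k x)](_ : nrm2 mu (fun x => -1 * (g x - u k x)) = _).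
      apply: le_trans (nrm2D g2 (L2Z _ (L2B g2 u2))).
      by rewrite le_eqVlt; apply/orP; left; apply/eqP/nrm2_ext => x; ring.
    by rewrite nrm2Z ?normrN1 ?mul1r//; exact: L2B.
  have e1 : G ^+ 2 = rint mu (fun x => g x * g x).
    by rewrite nrm2_sqr; apply: rint_ext => x; rewrite expr2.
  have e2 : L (u k) = rint mu (fun x => u k x * g x).
    by rewrite h2; apply: rint_ext => x; rewrite mulrC.
  rewrite -e1 -e2 -/G in h1.
  move: h1 h3; rewrite !ler_norml => /andP[_ +] /andP[_ +].
  set q : R := 4^-1 ^+ k.+1; move: h4; rewrite -/q => h4 h1 h3.
  have q0 : 0 <= q by exact: exprn_ge0.
  by have := ler_wpM2l C0 h4; have := mulr_ge0 q0 G0; lra.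
have [|GC] := leP (G ^+ 2 - C * G) 0.
  have [->//|Gn0] := eqVneq G 0.
  have Gp : 0 < G by rewrite lt_neqAle eq_sym Gn0.
  by rewrite expr2 -mulrBl pmulr_lle0// subr_le0.
by have := eq0_of_geometric (ltW GC) H; move: GC => /[swap] ->; rewrite ltxx.
Qed.

End riesz.

(** * Mollification and weak derivatives *)

Section translation.
Context {R : realType} {n : nat}.
Notation T := 'rV[R]_n.
Notation mu := (@lebm R n).
Implicit Types (f g k : T -> R) (x y z : T) (i j : 'I_n) (s : seq 'I_n) (U : set T).

Definition trunc (m : nat) z : T := \row_i (if (i < m)%N then z ord0 i else 0).

Lemma truncS z i : trunc i.+1 z = z ord0 i *: vec i + trunc i z.
Proof.
apply/rowP => j; rewrite !mxE eqxx /= ltnS leq_eqVlt.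
have [->|ij] := eqVneq j i; first by rewrite eqxx/= mulr1 ltnn addr0.
by rewrite (_ : (j : nat) == i = false) ?mulr0 ?add0r//; apply/negbTE.
Qed.

(** [z] is reached from 0 by n steps parallel to the axes, so increments are controlled by partial
    derivatives alone. *)
Lemma coord_telescope (F : T -> R) (B : 'I_n -> R) z :
  (forall i, `|F (z ord0 i *: vec i + trunc i z) - F (trunc i z)| <= B i) ->
  `|F z - F 0| <= \sum_i B i.
Proof.
move=> H.
have tn : trunc n z = z by apply/rowP => j; rewrite !mxE ltn_ord.
have t0 : trunc 0 z = 0 by apply/rowP => j; rewrite !mxE.
rewrite -{1}tn -t0 -(telescope_sumr (fun m => F (trunc m z)))// big_mkord.
apply: (le_trans (ler_norm_sum _ _ _)); apply: ler_sum => i _.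
by rewrite truncS.
Qed.

(** Unlike in [smooth_taylor1], the bound is asked on the segment only: the weak derivatives of the
    coefficients are available only for shifts that stay inside B_1. *)
Lemma smooth_segment f i x (t K : R) : smooth f ->
  (forall s : R, `|s| <= `|t| -> `|partial i f (s *: vec i + x)| <= K) ->
  `|f (t *: vec i + x) - f x| <= K * `|t|.
Proof.
move=> sf fK.
have D (s : R) : is_derive s 1 (fun s : R => f (s *: vec i + x)) (partial i f (s *: vec i + x)).
  exact: is_derive_smooth_line.
have C (a b : R) : {within `[a, b], continuous (fun s : R => f (s *: vec i + x))}.
  apply/continuous_subspaceT => s; apply: differentiable_continuous.
  by apply/derivable1_diffP; case: (D s).
have f0 : f x = f (0 *: vec i + x) by rewrite scale0r add0r.
have [t0|t0] := leP 0 t.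
  have [c ct E] := MVT_segment t0 (fun (s : R) _ => D s) (C 0 t).
  rewrite f0 E subr0 normrM ler_wpM2r// fK// ger0_norm ?(itvP ct)// ger0_norm//.
  by rewrite (itvP ct).
have [c ct E] := MVT_segment (ltW t0) (fun (s : R) _ => D s) (C t 0).
rewrite f0 distrC E sub0r normrM normrN ler_wpM2r// fK// (ler0_norm (ltW t0)) ler0_norm ?(itvP ct)//.
by rewrite lerN2 (itvP ct).
Qed.

Lemma test_bounded_partial U k : test_function U k ->
  exists2 K : R, 0 <= K & forall i x, `|partial i k x| <= K.
Proof.
move=> tk; have /all_sig2[K K0 HK] i : {K : R | 0 <= K & forall x, `|partial i k x| <= K}.
  by apply: cid2; exact: test_bounded (test_partial i tk).
exists (\sum_i K i) => [|i x]; first exact: sumr_ge0.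
by apply: (le_trans (HK i x)); rewrite (bigD1 i)//= lerDl sumr_ge0.
Qed.

Lemma test_lipschitz U k : test_function U k ->
  exists2 K : R, 0 <= K & forall x z, `|k (z + x) - k x| <= K * \sum_i `|z ord0 i|.
Proof.
move=> tk; have [K K0 HK] := test_bounded_partial tk; exists K => // x z.
rewrite -[X in _ - k X]add0r mulr_sumr.
apply: (@coord_telescope (fun z => k (z + x))) => i.
by rewrite -addrA; apply: smooth_segment => [|s _]; [exact: test_smooth tk|exact: HK].
Qed.

(** The convolution of [f] with the reflected kernel y -> k (- y). The kernel is then literally a
    translated test function, at the price of a sign for each derivative moved onto it. *)
Definition corr f k x : R := rint mu (fun y => f y * k (y - x)).

Lemma corr_L1 U f k x : L1 mu f -> test_function U k -> L1 mu (fun y => f y * k (y - x)).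
Proof.
move=> f1 tk; have [K K0 kK] := test_bounded tk.
apply: L1_le (L1Z K (L1_norm f1)) _ => [|y].
  apply: measurable_funM; first exact: L1_measurable f1.
  exact: measurable_comp_shift (test_measurable tk).
by rewrite normrM mulrC ler_wpM2r.
Qed.

Lemma corrN U f k x : L1 mu f -> test_function U k ->
  corr f (fun y => -1 * k y) x = - corr f k x.
Proof.
move=> f1 tk; rewrite /corr -rintN; last exact: corr_L1 tk.
by apply: rint_ext => y; ring.
Qed.

(** The second-order Taylor bound of the kernel is uniform in y, so it can be integrated against
    |f|. *)
Lemma is_derive_corr U f k i x : L1 mu f -> test_function U k ->
  is_derive x (vec i) (corr f k) (- corr f (partial i k) x).
Proof.
move=> f1 tk; have [K K0 kK] := test_bounded (test_partial i (test_partial i tk)).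
apply: (@quadratic_is_derive _ _ _ _ _ _ (K * rint mu (fun y => `|f y|))) => h _.
have E : corr f k (h *: vec i + x) - corr f k x - h * - corr f (partial i k) x =
    rint mu (fun y => f y * (k (- h *: vec i + (y - x)) - k (y - x) - - h * partial i k (y - x))).
  rewrite mulrN opprK /corr -rintB; [|exact: corr_L1 tk|exact: corr_L1 tk].
  rewrite -rintZ; last exact: (corr_L1 _ f1 (test_partial i tk)).
  rewrite -rintD; [|apply: L1B; exact: corr_L1 tk|apply: L1Z; exact: (corr_L1 _ f1 (test_partial i tk))].
  apply: rint_ext => y; have -> : y - (h *: vec i + x) = - h *: vec i + (y - x).
    by rewrite opprD scaleNr addrCA.
  by ring.
have -> : K * rint mu (fun y => `|f y|) * h ^+ 2 = rint mu (fun y => K * h ^+ 2 * `|f y|).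
  by rewrite rintZ; [ring|exact: L1_norm].
have b y : `|f y * (k (- h *: vec i + (y - x)) - k (y - x) - - h * partial i k (y - x))| <=
    K * h ^+ 2 * `|f y|.
  rewrite normrM mulrC ler_wpM2r// -[h ^+ 2]sqrrN.
  by apply: smooth_taylor2 => //; exact: test_smooth tk.
rewrite E; apply: (le_norm_rint _ _ b); last exact/L1Z/L1_norm.
apply: L1_le (L1Z (K * h ^+ 2) (L1_norm f1)) b.
apply: measurable_funM; first exact: L1_measurable f1.
have mk := test_measurable tk; have mp := test_measurable (test_partial i tk).
apply: measurable_funB; last by apply: measurable_funM => //; exact: measurable_comp_shift.
apply: measurable_funB; last exact: measurable_comp_shift.
rewrite (_ : (fun y : T => _) = (fun y : T => k (y + (- h *: vec i - x)))); first exact: measurable_comp_shift.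
by apply/funext => y; rewrite addrCA.
Qed.

Lemma partial_corr U f k i : L1 mu f -> test_function U k ->
  partial i (corr f k) = corr f (fun y => -1 * partial i k y).
Proof.
move=> f1 tk; apply: partialE => x; rewrite (corrN _ f1 (test_partial i tk)).
exact: is_derive_corr tk.
Qed.

Lemma corr_continuous U f k : L1 mu f -> test_function U k -> continuous (corr f k).
Proof.
move=> f1 tk; have [K K0 kK] := test_lipschitz tk => x.
pose C : R := K * n%:R * rint mu (fun y => `|f y|).
have H x' : `|corr f k x' - corr f k x| <= C * `|x' - x|.
  rewrite /corr -rintB; [|exact: corr_L1 tk|exact: corr_L1 tk].
  have -> : C * `|x' - x| = rint mu (fun y => K * (n%:R * `|x' - x|) * `|f y|).
    by rewrite rintZ; [rewrite /C; ring|exact: L1_norm].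
  apply: le_norm_rint; [by apply: L1B; exact: corr_L1 tk|exact/L1Z/L1_norm|].
  move=> y; rewrite -mulrBr normrM mulrC ler_wpM2r//.
  have -> : y - x' = (x - x') + (y - x) by rewrite [RHS]addrC addrA subrK.
  apply: (le_trans (kK _ _)); rewrite ler_wpM2l//.
  apply: (@le_trans _ _ (\sum_(i < n) `|x' - x|)); last by rewrite sumr_const card_ord mulr_natl.
  apply: ler_sum => i _; rewrite distrC [`|x - x'|]mx_normrE.
  exact: (le_bigmax _ (fun k : 'I_1 * 'I_n => `|(x - x') k.1 k.2|) (ord0, i)).
have C0 : 0 <= C by rewrite !mulr_ge0//; apply: rint_ge0.
have Fx := @nbhs_filter T x.
apply/(@cvgrPdist_le _ _ _ _ Fx) => e e0; apply: (proj2 (nbhs_ballP _ _)).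
exists (e / (C + 1)) => [|x']; last rewrite mx_norm_ball => xx'.
  by rewrite /= divr_gt0// ltr_wpDl.
rewrite distrC (le_trans (H x'))//.
apply: (@le_trans _ _ ((C + 1) * `|x' - x|)); first by rewrite ler_wpM2r// lerDl.
by rewrite mulrC -ler_pdivlMr ?ltr_wpDl// distrC ltW; [|exact: xx'].
Qed.

Lemma smooth_corr U f k : L1 mu f -> test_function U k -> smooth (corr f k).
Proof.
move=> f1 tk; apply/smooth_Ck => m; elim: m k tk => [|m ih] k tk.
  by split => //; exact: corr_continuous tk.
split; first exact: corr_continuous tk.
move=> i; split; first by move=> x; case: (is_derive_corr i x f1 tk).
by rewrite (partial_corr _ f1 tk); apply: ih; apply: testZ; exact: test_partial.
Qed.

Lemma pderiv_corr U f k s x : L1 mu f -> test_function U k ->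
  pderiv s (corr f k) x = (-1) ^+ size s * corr f (pderiv s k) x.
Proof.
move=> f1 tk; elim: s x => [|i s ih] x; first by rewrite mul1r.
rewrite pderiv_cons; have -> : pderiv s (corr f k) = (fun x => (-1) ^+ size s * corr f (pderiv s k) x).
  by apply/funext.
have ts := test_pderiv s tk.
rewrite partialZ; last exact: smooth_corr ts.
rewrite (partial_corr _ f1 ts) (corrN _ f1 (test_partial i ts)) /=.
by rewrite exprS -pderiv_cons; ring.
Qed.

Lemma corr_bound f k (M : R) x : measurable_fun setT f -> (forall y, `|f y| <= M) -> L1 mu k ->
  `|corr f k x| <= M * rint mu (fun y => `|k y|).
Proof.
move=> mf fM k1; rewrite -(rint_shift (- x) (L1_norm k1)) -rintZ; last exact: (L1_shift (- x) (L1_norm k1)).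
have b y : `|f y * k (y - x)| <= M * `|k (y - x)| by rewrite normrM ler_wpM2r.
apply: le_norm_rint => //; last by apply: L1Z; exact: (L1_shift (- x) (L1_norm k1)).
apply: L1_le (L1Z M (L1_shift (- x) (L1_norm k1))) b.
apply: measurable_funM => //; apply: measurable_comp_shift; exact: L1_measurable k1.
Qed.

Lemma corr_L2_bound f k x : L2 mu f -> L2 mu k -> `|corr f k x| <= nrm2 mu f * nrm2 mu k.
Proof.
by move=> f2 k2; rewrite -(nrm2_shift (- x) k2); apply: cauchy_schwarz => //; exact: L2_shift.
Qed.

Lemma corr_shift f k x : L2 mu f -> L2 mu k -> corr f k x = rint mu (fun y : T => f (y + x) * k y).
Proof.
move=> f2 k2; rewrite /corr -(rint_shift x); last by apply: L2M => //; exact: L2_shift.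
by apply: rint_ext => y; rewrite addrK.
Qed.

(** By translation invariance k (x + t e_i) - k x has integral zero, and it differs from t d_i k by
    O(t^2) on a fixed cube. Hence |int d_i k| <= V t for all t in ]0, 1[. *)
Lemma rint_partial0 U k i : test_function U k -> rint mu (partial i k) = 0.
Proof.
move=> tk; have tp := test_partial i tk.
have [K K0 kK] := test_bounded (test_partial i tp).
have [M M0 kM] := tsupp_box tk.
apply/eqP; rewrite -normr_eq0; apply/eqP.
pose V : R := K * (2 * (M + 1)) ^+ n.
have V0 : 0 <= V by rewrite mulr_ge0// exprn_ge0// mulr_ge0// addr_ge0// ltW.
have H t : 0 < t -> t < 1 -> `|rint mu (partial i k)| <= V * t.
  move=> t0 t1; pose r (x : T) := k (x + t *: vec i) - k x - t * partial i k x.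
  have M10 : 0 < M + 1 by rewrite addr_gt0.
  have mr : measurable_fun setT r.
    apply: measurable_funB; last by apply: measurable_funM => //; exact: test_measurable tp.
    apply: measurable_funB; last exact: test_measurable tk.
    exact: measurable_comp_shift (test_measurable tk).
  have rb x : `|r x| <= K * t ^+ 2.
    by rewrite /r [x + _]addrC; apply: smooth_taylor2 => //; exact: test_smooth tk.
  have rs x : r x != 0 -> forall j, `|x ord0 j| < M + 1.
    move=> rx j; apply: contrapT => /negP; rewrite -leNgt => xj.
    have o1 : ~ tsupp k x by move=> /kM /(_ j); rewrite ltNge (le_trans _ xj)// lerDl.
    have o2 : ~ tsupp k (x + t *: vec i).
      move=> /kM /(_ j); rewrite !mxE eqxx /= ltNge => /negP; apply.
      have tb : `|t * (j == i)%:R| <= 1.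
        by case: (j == i); rewrite ?mulr1 ?mulr0 ?normr0// ger0_norm ltW.
      have := ler_normB (x ord0 j + t * (j == i)%:R) (t * (j == i)%:R).
      rewrite addrK; lra.
    move/eqP: rx; apply; rewrite /r (tsupp_out o1) (tsupp_out o2).
    by rewrite -[partial i k x]/(pderiv [:: i] k x) (pderiv_out _ o1) mulr0 !subr0.
  have [r1 rr] := bounded_L1 M10 mr rb rs.
  have E : rint mu r = - (t * rint mu (partial i k)).
    have k1 := test_L1 tk; have p1 := test_L1 tp.
    rewrite /r rintB; [|by apply: L1B => //; exact: L1_shift|exact: L1Z].
    by rewrite rintB//; [rewrite rint_shift// subrr sub0r rintZ|exact: L1_shift].
  have := le_norm_rint r1 (L1_norm r1) (fun x => lexx _); rewrite E normrN normrM gtr0_norm// => h.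
  rewrite -(ler_pM2l t0); apply: (le_trans h); apply: (le_trans rr).
  by rewrite le_eqVlt; apply/orP; left; apply/eqP; rewrite /V; ring.
apply: (@eq0_of_geometric R _ V) => // m; apply: H; first by rewrite exprn_gt0// invr_gt0.
by rewrite exprn_ilt1// invf_lt1// ltr1n.
Qed.

(** Integrals run over the whole space, which is harmless because test functions vanish off [U];
    integrability is supplied separately where it is used. *)
Definition weak U s f g : Prop := forall eta, test_function U eta ->
  rint mu (fun x => f x * pderiv s eta x) = (-1) ^+ size s * rint mu (fun x => g x * eta x).

(** If its support stays in [U], the translated kernel is itself an admissible test function. *)
Lemma weak_corr U V s f g k x : weak U s f g -> test_function V k ->
  (forall y, V (y - x) -> U y) -> corr f (pderiv s k) x = (-1) ^+ size s * corr g k x.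
Proof.
move=> wfg tk VU; have tkx := test_shift (z := - x) tk VU.
by have := wfg _ tkx; rewrite pderiv_shift.
Qed.

Lemma weak_pderiv_corr U V s f g k x : weak U s f g -> L1 mu f -> test_function V k ->
  (forall y, V (y - x) -> U y) -> pderiv s (corr f k) x = corr g k x.
Proof.
move=> wfg f1 tk VU; rewrite (pderiv_corr _ _ f1 tk) (weak_corr wfg tk VU).
by rewrite mulrA -expr2 sqrr_sign mul1r.
Qed.

Lemma sqn_shift x z (r d : R) : 0 <= r -> 0 <= d -> sqn x <= r ^+ 2 ->
  (forall i, `|z ord0 i| <= d) -> sqn (x + z) <= r ^+ 2 + n%:R * (d * (2 * r + d)).
Proof.
move=> r0 d0 xr zd; rewrite /sqn.
have -> : \sum_i (x + z) ord0 i ^+ 2 = sqn x + \sum_i (2 * x ord0 i * z ord0 i + z ord0 i ^+ 2).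
  by rewrite /sqn -big_split/=; apply: eq_bigr => i _; rewrite mxE; ring.
apply: lerD => //.
apply: (@le_trans _ _ (\sum_(i < n) d * (2 * r + d))); last by rewrite sumr_const card_ord -[_ *+ n]mulr_natl.
apply: ler_sum => i _; have zi := zd i; have xi := cball_coord i r0 xr.
apply: (@le_trans _ _ (2 * `|x ord0 i| * `|z ord0 i| + `|z ord0 i| ^+ 2)).
  apply: lerD; last by rewrite real_normK ?num_real.
  by apply: (le_trans (ler_norm _)); rewrite !normrM ger0_norm.
have := normr_ge0 (z ord0 i); have := normr_ge0 (x ord0 i); nra.
Qed.

(** A shift by at most d in each coordinate increases |x|^2 on B_{3/4} by at most n d (3/2 + d),
    which is at most 13/64 for this d; this is below the available 7/16. *)
Definition shift_size : R := (8 * n.+1%:R)^-1.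

Lemma shift_size_gt0 : 0 < shift_size.
Proof. by rewrite invr_gt0 mulr_gt0. Qed.

Lemma eball_shift x z : eball (3 / 4) x -> (forall i, `|z ord0 i| <= shift_size) -> eball 1 (x + z).
Proof.
rewrite /eball/= => xr zd.
have d0 : 0 <= shift_size := ltW shift_size_gt0.
apply: (@le_lt_trans _ _ ((3 / 4) ^+ 2 + n%:R * (shift_size * (2 * (3 / 4) + shift_size)))).
  by apply: sqn_shift; [lra|exact: d0|exact: ltW|exact: zd].
have h1 : n%:R * shift_size <= 8^-1.
  rewrite /shift_size invfM mulrCA ler_piMr ?invr_ge0// ler_pdivrMr// mul1r.
  by rewrite ler_nat.
have h2 : shift_size <= 8^-1.
  by rewrite /shift_size lef_pV2 ?posrE ?mulr_gt0// ler_peMr// ler1n.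
have n0 : 0 <= n%:R :> R by [].
nra.
Qed.

End translation.

Section duality.
Context {R : realType} {n : nat}.
Notation T := 'rV[R]_n.
Notation mu := (@lebm R n).
Implicit Types (f g h : T -> R) (x y z : T) (i j : 'I_n) (U A : set T).

Lemma eball_open (r : R) : open (eball r : set T).
Proof.
apply: (@open_comp _ _ (@sqn R n) [set y : R | y < r ^+ 2]); last exact: open_lt.
by move=> x _; exact/smooth_continuous/smooth_sqn.
Qed.

Lemma measurable_eball (r : R) : measurable (eball r : set T).
Proof. apply: open_measurable_rV; exact: eball_open. Qed.

Lemma eball_cube (r : R) : 0 < r -> eball r `<=` @cube R n (2 * r).
Proof.
move=> r0 x xr i; rewrite /= in_itv/= -ltr_norml.
apply: (@le_lt_trans _ _ r); last lra.
by apply: cball_coord; [exact: ltW|exact: ltW xr].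
Qed.

Lemma L2_indic A (M : R) : 0 < M -> measurable A -> A `<=` cube M -> L2 mu (\1_A).
Proof.
move=> M0 mA AM.
have mi : measurable_fun setT (\1_A : T -> R) by exact: measurable_indic.
split=> //; apply: L1_le (L1_cube M0) _ => [|x]; first exact: measurable_funX.
rewrite !indicE; case: (boolP (x \in A)) => [/set_mem/AM xM|_].
  by rewrite mem_set// expr1n normr1.
by rewrite expr0n normr0.
Qed.

Lemma L2_restrict f A : L2 mu f -> measurable A ->
  L2 mu (fun x => f x * \1_A x) /\ nrm2 mu (fun x => f x * \1_A x) <= nrm2 mu f.
Proof.
move=> f2 mA.
have mi : measurable_fun setT (\1_A : T -> R) by exact: measurable_indic.
have b x : `|\1_A x : R| <= 1 by rewrite indicE; case: (_ \in _); rewrite ?normr1 ?normr0.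
have [h1 h2] := L2_bound mi b f2; split.
  by apply: L2_ext h1 => x; rewrite mulrC.
by rewrite mul1r in h2; apply: le_trans h2; rewrite (@nrm2_ext _ _ _ _ _ (fun x => \1_A x * f x))// => x; rewrite mulrC.
Qed.

Lemma le_nrm2_ae f g : L2 mu f -> L2 mu g -> {ae mu, forall x, `|f x| <= `|g x|} ->
  nrm2 mu f <= nrm2 mu g.
Proof.
move=> [mf ff] [mg gg] fg; rewrite ler_sqrt; last by apply: rint_ge0 => x; exact: sqr_ge0.
apply: le_rint_ae => //; apply: filterS fg => x fg.
rewrite -(ger0_norm (sqr_ge0 (f x))) -(ger0_norm (sqr_ge0 (g x))).
by rewrite !normrX lerXn2r ?nnegrE.
Qed.

Lemma riesz_test U (L : (T -> R) -> R) (C : R) : 0 <= C ->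
  (forall a f g, test_function U f -> test_function U g ->
    L (fun x => a * f x + g x) = a * L f + L g) ->
  (forall f, test_function U f -> `|L f| <= C * nrm2 mu f) ->
  exists g, [/\ L2 mu g, nrm2 mu g <= C &
    forall f, test_function U f -> L f = rint mu (fun x => g x * f x)].
Proof.
move=> C0 LD LC; apply: (@riesz _ _ _ mu (test_function U)) => //.
- exact: test0.
- by move=> a f g tf tg; apply: testD => //; exact: testZ.
- by move=> f tf; exact: test_L2 tf.
Qed.

(** The functional is represented by some [g] of norm at most [C], and the du Bois-Reymond lemma
    identifies [g] with [h] on [U]. *)
Lemma L2_dual U h (M C : R) : open U -> 0 < M -> U `<=` cube M -> L2 mu h -> 0 <= C ->
  (forall eta, test_function U eta -> `|rint mu (fun x => h x * eta x)| <= C * nrm2 mu eta) ->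
  nrm2 mu (fun x => h x * \1_U x) <= C.
Proof.
move=> oU M0 UM h2 C0 hC; have mU := open_measurable_rV oU.
have [|g [g2 gC gh]] := riesz_test C0 _ hC.
  move=> a f g tf tg; have f2 := test_L2 tf; have g2 := test_L2 tg.
  rewrite -rintZ; last exact: L2M.
  rewrite -rintD; [|by apply: L1Z; exact: L2M|exact: L2M].
  by apply: rint_ext => x; ring.
apply: le_trans gC; apply: le_nrm2_ae => //; first by case: (L2_restrict h2 mU).
have hg2 := L2B h2 g2.
have : {ae mu, forall x, U x -> h x - g x = 0}.
  apply: du_bois_reymond => //; first by case: hg2.
    move=> a b abU; apply: L2M => //; apply: (L2_indic M0); first exact: measurable_kbox.
    exact: subset_trans UM.
  move=> eta te; have e2 := test_L2 te.
  rewrite (@rint_ext _ _ _ _ _ (fun x => h x * eta x - g x * eta x)); last by move=> x; ring.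
  by rewrite rintB ?gh// ?subrr//; exact: L2M.
apply: filterS => x; rewrite indicE; case: (boolP (x \in U)) => [/set_mem xU /(_ xU)/eqP|_ _].
  by rewrite subr_eq0 => /eqP ->; rewrite mulr1.
by rewrite mulr0 normr0.
Qed.

(** Argued by duality: tested against eta, the difference becomes the increment from 0 to z of the
    smooth function [corr c eta], whose partial derivatives are correlations of [dc] with eta and
    obey Cauchy-Schwarz. *)
Lemma translation_bound (c : T -> R) (dc : 'I_n -> T -> R) z :
  L1 mu c -> L2 mu c -> (forall i, L2 mu (dc i)) ->
  (forall i, weak (eball 1) [:: i] c (dc i)) -> (forall i, `|z ord0 i| <= @shift_size R n) ->
  nrm2 mu (fun x => (c (x + z) - c x) * \1_(eball (3 / 4)) x) <=
    \sum_i `|z ord0 i| * nrm2 mu (dc i).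
Proof.
move=> c1 c2 dc2 wc zd; pose r : R := 3 / 4; have r0 : 0 < r by rewrite /r; lra.
apply: (@L2_dual _ (fun x => c (x + z) - c x) (2 * r)).
- exact: eball_open.
- lra.
- exact: eball_cube.
- by apply: L2B => //; exact: L2_shift.
- by apply: sumr_ge0 => i _; rewrite mulr_ge0// nrm2_ge0.
move=> eta te; have e2 := test_L2 te.
have -> : rint mu (fun x => (c (x + z) - c x) * eta x) = corr c eta z - corr c eta 0.
  rewrite !corr_shift// -rintB; [|by apply: L2M => //; exact: L2_shift|by apply: L2M => //; exact: L2_shift].
  by apply: rint_ext => x; rewrite addr0 mulrBl.
rewrite mulr_suml; apply: (@coord_telescope _ _ (corr c eta)) => i.
rewrite -mulrA mulrC; apply: smooth_segment; first exact: smooth_corr c1 te.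
move=> s sz; rewrite -[partial i _]/(pderiv [:: i] _).
rewrite (weak_pderiv_corr (wc i) c1 te); first exact: corr_L2_bound.
move=> y yV; rewrite -[y](subrK (s *: vec i + trunc i z)).
apply: eball_shift => // j; rewrite !mxE eqxx /=.
have [->|ji] := eqVneq j i; first by rewrite ltnn mulr1 addr0 (le_trans sz).
by rewrite mulr0 add0r; case: ifP => // _; rewrite normr0 ltW// shift_size_gt0.
Qed.

End duality.

(** * The third-order estimate *)

Section commutator.
Context {R : realType} {n : nat}.
Notation T := 'rV[R]_n.
Notation mu := (@lebm R n).
Notation U := (eball 1 : set T).
Notation V := (eball (3 / 4) : set T).
Implicit Types (f g h : T -> R) (x y z : T) (i j k l : 'I_n).

Lemma normr_sum_le (a : 'I_n -> R) (B : R) : (forall i, `|a i| <= B) ->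
  `|\sum_i a i| <= n%:R * B.
Proof.
move=> aB; apply: (le_trans (ler_norm_sum _ _ _)).
apply: (@le_trans _ _ (\sum_(i < n) B)); first by apply: ler_sum.
by rewrite sumr_const card_ord -[_ *+ n]mulr_natl.
Qed.

Lemma le_sqrt_sum2 (a : 'I_n -> 'I_n -> R) i j :
  0 <= a i j -> a i j <= Num.sqrt (\sum_i \sum_j a i j ^+ 2).
Proof.
move=> a0; rewrite -{1}(ger0_norm a0) -sqrtr_sqr ler_sqrt; last first.
  by apply: sumr_ge0 => k _; apply: sumr_ge0 => l _; exact: sqr_ge0.
rewrite (bigD1 i)//= (bigD1 j)//= -addrA lerDl addr_ge0//.
  by apply: sumr_ge0 => k _; exact: sqr_ge0.
by apply: sumr_ge0 => k _; apply: sumr_ge0 => l _; exact: sqr_ge0.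
Qed.

Lemma continuous_coord (G : T -> R) (r : R) : continuous G -> 0 < r ->
  exists2 s : R, 0 < s & forall z, (forall i, `|z ord0 i| <= s) -> `|G z - G 0| <= r.
Proof.
move=> cG r0; have := cG 0.
move=> /(@cvgrPdist_le _ _ _ _ (@nbhs_filter T 0)) /(_ r r0) /nbhs_ballP[s /= s0 sG].
exists (s / 2) => [|z zs]; first by rewrite divr_gt0.
rewrite distrC; apply: sG; rewrite mx_norm_ball /ball_ /= sub0r normrN.
have s20 : 0 <= s / 2 by rewrite divr_ge0 ?ltW.
apply: (@le_lt_trans _ _ (s / 2)); last by lra.
rewrite [`|z|]mx_normrE; apply: bigmax_le => //= -[a b] _ /=.
by rewrite (ord1 a).
Qed.

(** Fubini turns the left side into int d_p rho * corr v eta; the product rho * corr v eta is a test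
    function, so its p-th derivative integrates to zero and d_p passes to eta. *)
Lemma corr_by_parts p U1 U2 v eta rho : L1 mu v -> L2 mu v ->
  test_function U1 eta -> test_function U2 rho ->
  rint mu (fun x => eta x * corr v (partial p rho) x) =
  rint mu (fun z => rho z * corr v (partial p eta) z).
Proof.
move=> v1 v2 te tr; have tp := test_partial p te; have e2 := test_L2 te.
have tw := test_partial p tr; have w1 := test_L1 tw; have w2 := test_L2 tw.
have [_ F] := fubini_corr w1 w2 v2 e2.
have sH := smooth_corr v1 te.
have E1 : rint mu (fun x => eta x * corr v (partial p rho) x) =
    rint mu (fun z => partial p rho z * corr v eta z).
  rewrite (@rint_ext _ _ _ _ _ (fun x : T => eta x * rint mu (fun z : T => partial p rho z * v (x + z)))).
    by rewrite -F; apply: rint_ext => z; congr (_ * _); rewrite (corr_shift _ v2 e2).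
  move=> x; congr (_ * _); rewrite (corr_shift _ v2 w2).
  by apply: rint_ext => z; rewrite mulrC addrC.
have dH z : partial p (corr v eta) z = - corr v (partial p eta) z.
  by rewrite (partial_corr p v1 te) (corrN _ v1 tp).
have trH := test_L1 (testMl tr (smooth_partial p sH)).
apply: (etrans E1).
have t : test_function U2 (fun x => rho x * corr v eta x) := testMl tr sH.
have Z := rint_partial0 p t.
have L := test_L1 (testMl tw sH).
rewrite (partialM p (test_smooth tr) sH) (rintD L trH) in Z.
rewrite addrC in Z; apply: (etrans (esym (addr0_eq Z))); rewrite -(rintN trH).
by apply: rint_ext => z; rewrite dH mulrN opprK.
Qed.

Lemma mollifier_average (G rho : T -> R) (e s r : R) : test_function (cball e) rho ->
  (forall x, 0 <= rho x) -> rint mu rho = 1 -> 0 <= e -> e <= s -> smooth G ->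
  (forall z, (forall i, `|z ord0 i| <= s) -> `|G z - G 0| <= r) ->
  `|rint mu (fun z => rho z * G z) - G 0| <= r.
Proof.
move=> tr rho0 rho1 e0 es sG Gr.
have r1 := test_L1 tr; have tG := test_L1 (testMl tr sG).
have -> : G 0 = rint mu (fun z => G 0 * rho z) by rewrite rintZ// rho1 mulr1.
have r1' := L1Z (G 0) r1.
rewrite -rintB//; apply: (@le_trans _ _ (rint mu (fun z => r * rho z))); last by rewrite rintZ// rho1 mulr1.
apply: le_norm_rint; [exact: L1B|exact: L1Z|move=> z].
rewrite [G 0 * _]mulrC -mulrBr normrM mulrC (ger0_norm (rho0 z)).
have [->|rz] := eqVneq (rho z) 0; first by rewrite !mulr0.
rewrite ler_wpM2r//; apply: Gr => k; apply: le_trans es.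
by apply: cball_coord => //; have [_ _] := tr; apply; apply: subset_closure.
Qed.

Lemma ler_scale (d a b t : R) : 0 < d -> d <= a -> `|b| * `|t| <= d^-1 * (`|b| * `|a * t|).
Proof.
move=> d0 da; rewrite ler_pdivlMl// normrM mulrCA ler_wpM2l// ler_wpM2r//.
by apply: (le_trans da); exact: ler_norm.
Qed.

Lemma le_cauchy_schwarz (F a b : T -> R) (C : R) : L1 mu F -> L2 mu a -> L2 mu b -> 0 <= C ->
  (forall x, `|F x| <= C * (`|a x| * `|b x|)) -> `|rint mu F| <= C * (nrm2 mu a * nrm2 mu b).
Proof.
have L2_norm h : L2 mu h -> L2 mu (fun x => `|h x|) /\ nrm2 mu (fun x => `|h x|) <= nrm2 mu h.
  move=> h2; have [mh _] := h2.
  have nh : L2 mu (fun x => `|h x|).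
    by apply: L2_le h2 _ => [|x]; [exact: measurableT_comp|rewrite normr_id].
  by split=> //; apply: le_nrm2 => // x; rewrite normr_id.
move=> F1 /L2_norm[a2 an] /L2_norm[b2 bn] C0 Fb; have ab1 := L2M a2 b2.
apply: (le_trans (le_norm_rint F1 (L1Z C ab1) Fb)); rewrite (rintZ C ab1) ler_wpM2l//.
apply: (le_trans (ler_norm _)); apply: (le_trans (cauchy_schwarz a2 b2)).
by apply: ler_pM; rewrite ?nrm2_ge0.
Qed.

Lemma ler_norm_near (a b B r : R) : `|a| <= B -> `|a - b| <= r -> `|b| <= B + r.
Proof. rewrite !ler_norml => /andP[h1 h2] /andP[h3 h4]; lra. Qed.

(** Ellipticity sums over i, j first and the equation over k, l first; the exchange of the two
    orders happens here. *)
Lemma sum4_le (Q E : 'I_n -> 'I_n -> 'I_n -> 'I_n -> R) (B : R) :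
  (forall i j k l, Q i j k l <= B - E i j k l) ->
  \sum_i \sum_j \sum_k \sum_l Q i j k l <=
  n%:R ^+ 4 * B - \sum_k \sum_l \sum_i \sum_j E i j k l.
Proof.
move=> QE; have sB (C : R) (G : 'I_n -> R) : \sum_i (C - G i) = n%:R * C - \sum_i G i.
  by rewrite sumrB sumr_const card_ord -[_ *+ n]mulr_natl.
have -> : n%:R ^+ 4 * B - \sum_k \sum_l \sum_i \sum_j E i j k l =
    \sum_i \sum_j \sum_k \sum_l (B - E i j k l).
  under [RHS]eq_bigr => i _.
    under eq_bigr => j _.
      under eq_bigr => k _ do rewrite sB.
      rewrite sB; over.
    rewrite sB; over.
  rewrite sB; congr (_ - _); first by rewrite !exprS; ring.
  under eq_bigr => k _ do under eq_bigr => l _ do rewrite pair_big/=.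
  rewrite pair_big/= [RHS]pair_big/=.
  by under [RHS]eq_bigr => i _ do rewrite pair_big/=; rewrite exchange_big.
by apply: ler_sum => i _; apply: ler_sum => j _; apply: ler_sum => k _; apply: ler_sum => l _.
Qed.

Lemma le_of_dist (E a b B1 B2 : R) : `|E - (a - b)| <= B2 -> `|a| <= B1 -> b <= B1 + B2 - E.
Proof. rewrite !ler_norml => /andP[h1 h2] /andP[h3 h4]; lra. Qed.

(** After division by L, the linear term is absorbed by 2 a' y <= y^2 + a'^2. *)
Lemma quadratic_bound (L a b y : R) : 0 < L -> L * y ^+ 2 <= a * y + b ->
  y ^+ 2 <= (a / L) ^+ 2 + 2 * (b / L).
Proof.
move=> L0 h; have h' : y ^+ 2 <= a / L * y + b / L.
  by rewrite -(ler_pM2l L0) (_ : L * (_ + _) = a * y + b)//; field; exact: lt0r_neq0.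
move: h'; move: (a / L) (b / L) => a' b'; have := sqr_ge0 (y - a'); nra.
Qed.

Lemma ler_norm_add3 (a b d B : R) : `|a| <= B -> `|b| <= B -> `|d| <= B ->
  `|a + b + d| <= 3 * B.
Proof.
move=> ha hb hd; apply: (le_trans (ler_normD _ _)).
by apply: (le_trans (lerD (ler_normD _ _) (lexx _))); lra.
Qed.

Lemma L2_bound_test f g W : test_function W g -> L2 mu f -> L2 mu (fun x => f x * g x).
Proof.
move=> tg f2; have [K K0 gK] := test_bounded tg.
have [h _] := L2_bound (test_measurable tg) gK f2.
by apply: L2_ext h => x; rewrite mulrC.
Qed.

(** For z in the support of [w] the function psi (x - z) is a test function of B_1; a change of
    variables moves the shift from psi to [F], and the identity is then averaged against [w]. *)
Lemma equation_corr (F : 'I_n -> 'I_n -> T -> R) psi (w : T -> R) (e : R) :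
  (forall k l, L2 mu (F k l)) ->
  (forall eta, test_function U eta ->
    rint mu (fun x => \sum_k \sum_l F k l x * pderiv [:: k; l] eta x) = 0) ->
  test_function V psi -> test_function (cball e) w -> 0 <= e -> e <= @shift_size R n ->
  \sum_k \sum_l rint mu (fun z : T => w z * rint mu (fun x : T => F k l (x + z) * pderiv [:: k; l] psi x)) = 0.
Proof.
move=> F2 FE tpsi tw e0 es.
have p2 k l := test_L2 (test_pderiv [:: k; l] tpsi).
have w1 := test_L1 tw; have w2 := test_L2 tw.
have L1in k l z : L1 mu (fun x : T => F k l (x + z) * pderiv [:: k; l] psi x).
  by apply: L2M => //; exact: L2_shift.
have L1out k l := (fubini_corr w1 w2 (F2 k l) (p2 k l)).1.
under eq_bigr => k _ do rewrite -rint_sum//.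
rewrite -rint_sum; last by move=> k; apply: L1_sum.
rewrite -[RHS](@rint0 _ _ _ mu); apply: rint_ext => z.
under eq_bigr => k _ do rewrite -mulr_sumr.
rewrite -mulr_sumr.
have [->|wz] := eqVneq (w z) 0; first by rewrite mul0r.
have zs i : `|z ord0 i| <= @shift_size R n.
  apply: le_trans es; apply: cball_coord => //.
  by have [_ _] := tw; apply; apply: subset_closure.
have tz : test_function U (fun x => psi (x - z)).
  apply: test_shift tpsi _ => x xV; rewrite -[x](subrK z); exact: eball_shift.
have := FE _ tz; rewrite -(rint_shift z); last first.
  apply: L1_sum => k; apply: L1_sum => l; rewrite pderiv_shift; apply: L2M => //.
  exact: (L2_shift (- z) (p2 k l)).
move=> E; rewrite (_ : \sum_k _ = 0) ?mulr0// -[RHS]E.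
under eq_bigr => k _ do rewrite -rint_sum//.
rewrite -rint_sum; last by move=> k; apply: L1_sum.
apply: rint_ext => x; apply: eq_bigr => k _; apply: eq_bigr => l _.
by rewrite pderiv_shift addrK.
Qed.

(* Friedrichs' commutator: replacing [c (x + z)] by [c x] costs [|z| <= e],
   which compensates the [L^1] norm of a derivative of the mollifier. *)
Lemma commutator_bound (c v : T -> R) (dc : 'I_n -> T -> R) g (w : T -> R) (e M N : R) :
  L1 mu c -> L2 mu c -> (forall i, L2 mu (dc i)) -> (forall i, nrm2 mu (dc i) <= N) ->
  (forall i, weak U [:: i] c (dc i)) -> L2 mu v -> (forall x, `|v x| <= M) ->
  test_function V g -> test_function (cball e) w -> 0 <= e -> e <= @shift_size R n ->
  `|rint mu (fun z : T => w z * rint mu (fun x : T => (c (x + z) * v (x + z)) * g x)) -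
    rint mu (fun x => c x * g x * corr v w x)| <=
  rint mu (fun z => `|w z|) * (e * (n%:R * N) * (M * nrm2 mu g)).
Proof.
move=> c1 c2 dc2 dcN wc v2 vM tg tw e0 es.
have w1 := test_L1 tw; have w2 := test_L2 tw; have g2 := test_L2 tg.
have [mv _] := v2; have mV : measurable V by exact: measurable_eball.
have cv2 : L2 mu (fun x => c x * v x).
  have [h _] := L2_bound mv vM c2; by apply: L2_ext h => x; rewrite mulrC.
have cg2 := L2_bound_test tg c2.
have [La _] := fubini_corr w1 w2 cv2 g2.
have [Lb Eb] := fubini_corr w1 w2 v2 cg2.
have -> : rint mu (fun x => c x * g x * corr v w x) =
    rint mu (fun z : T => w z * rint mu (fun x : T => v (x + z) * (c x * g x))).
  rewrite Eb; apply: rint_ext => x; congr (_ * _); rewrite corr_shift//.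
  by apply: rint_ext => z; rewrite mulrC addrC.
rewrite -rintB//; apply: (@le_trans _ _ (rint mu (fun z => (e * (n%:R * N) * (M * nrm2 mu g)) * `|w z|))); last first.
  by rewrite rintZ; [rewrite mulrC|exact: L1_norm].
apply: le_norm_rint; [exact: L1B|exact/L1Z/L1_norm|].
move=> z; rewrite -mulrBr normrM mulrC.
have [->|wz] := eqVneq (w z) 0; first by rewrite normr0 !mulr0.
have ze i : `|z ord0 i| <= e.
  by apply: cball_coord => //; have [_ _] := tw; apply; apply: subset_closure.
have zs i : `|z ord0 i| <= @shift_size R n by exact: le_trans (ze i) es.
rewrite ler_wpM2r// -rintB; last 2 first.
- exact: (L2M (L2_shift z cv2) g2).
- exact: (L2M (L2_shift z v2) cg2).
have dc2' : L2 mu (fun x : T => c (x + z) - c x) := L2B (L2_shift z c2) c2.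
have [dV2 _] := L2_restrict dc2' mV.
have mvz := measurable_comp_shift z mv.
have [vg2 vgM] := L2_bound mvz (fun x => vM (x + z)) g2.
(* As [g] vanishes off [V], the indicator can be inserted; [translation_bound] controls the
   difference only on [V]. *)
rewrite (@rint_ext _ _ _ _ _ (fun x : T => ((c (x + z) - c x) * \1_V x) * (v (x + z) * g x))); last first.
  move=> x; have [xV|xV] := pselect (V x); first by rewrite indicE mem_set//= mulr1; ring.
  have -> : g x = 0 by apply: tsupp_out; have [_ _ gV] := tg; move=> /gV.
  by rewrite !mulr0 subrr.
apply: (le_trans (cauchy_schwarz dV2 vg2)); apply: ler_pM; rewrite ?nrm2_ge0//.
apply: (le_trans (translation_bound c1 c2 dc2 wc zs)).
apply: (@le_trans _ _ (\sum_(i < n) e * N)).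
  by apply: ler_sum => i _; apply: ler_pM; rewrite ?nrm2_ge0.
by rewrite sumr_const card_ord -[_ *+ n]mulr_natl mulrCA.
Qed.

End commutator.

(** * Energy estimate for the mollified third derivatives *)

Section caccioppoli.
Context {R : realType} {n : nat}.
Notation T := 'rV[R]_n.
Notation mu := (@lebm R n).
Notation U := (eball 1 : set T).
Notation V := (eball (3 / 4) : set T).
Implicit Types (x y z : T) (i j k l : 'I_n).
Context (u : T -> R) (u1 : 'I_n -> T -> R) (v : 'I_n -> 'I_n -> T -> R)
  (c : 'I_n -> 'I_n -> 'I_n -> 'I_n -> T -> R) (f : 'I_n -> 'I_n -> T -> R)
  (dc : 'I_n -> 'I_n -> 'I_n -> 'I_n -> 'I_n -> T -> R) (df : 'I_n -> 'I_n -> 'I_n -> T -> R)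
  (M Nc Nf Lam : R).
Context (u_L1 : L1 mu u) (M0 : 0 <= M) (Nc0 : 0 <= Nc) (Nf0 : 0 <= Nf) (Lam0 : 0 < Lam)
  (u1_meas : forall i, measurable_fun setT (u1 i)) (u1_bound : forall i x, `|u1 i x| <= M)
  (u1_weak : forall i, weak U [:: i] u (u1 i))
  (v_L1 : forall i j, L1 mu (v i j)) (v_L2 : forall i j, L2 mu (v i j)) (v_bound : forall i j x, `|v i j x| <= M)
  (v_weak : forall i j, weak U [:: i; j] u (v i j))
  (c_L1 : forall i j k l, L1 mu (c i j k l)) (c_L2 : forall i j k l, L2 mu (c i j k l))
  (c_bound : forall i j k l, nrm2 mu (c i j k l) <= Nc)
  (dc_L2 : forall p i j k l, L2 mu (dc p i j k l))
  (dc_bound : forall p i j k l, nrm2 mu (dc p i j k l) <= Nc)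
  (dc_weak : forall p i j k l, weak U [:: p] (c i j k l) (dc p i j k l))
  (f_L1 : forall k l, L1 mu (f k l)) (f_L2 : forall k l, L2 mu (f k l))
  (f_out : forall k l x, ~ U x -> f k l x = 0)
  (df_L2 : forall p k l, L2 mu (df p k l)) (df_bound : forall p k l, nrm2 mu (df p k l) <= Nf)
  (df_weak : forall p k l, weak U [:: p] (f k l) (df p k l))
  (elliptic : {ae mu, forall x, U x -> forall xi : 'M[R]_n, xi^T = xi ->
        Lam * (\sum_i \sum_j xi i j ^+ 2) <=
        \sum_i \sum_j \sum_k \sum_l c i j k l x * xi i j * xi k l})
  (equation : forall eta, test_function U eta ->
    rint mu (fun x => \sum_k \sum_l
      ((\sum_i \sum_j c i j k l x * v i j x) + f k l x) * pderiv [:: k; l] eta x) = 0).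

Section mollified.
Context (Phi g rho : T -> R) (K Kr e : R) (p : 'I_n).
Context (Phi_test : test_function V Phi) (g_meas : measurable_fun setT g)
  (g01 : forall x, 0 <= g x <= 1) (K0 : 0 <= K) (Phi_g : forall x, Phi x = g x ^+ 2)
  (dPhi : forall i x, `|partial i Phi x| <= K * g x)
  (ddPhi : forall i j x, `|partial i (partial j Phi) x| <= K * g x)
  (e0 : 0 < e) (e_small : e <= @shift_size R n)
  (rho_test : test_function (cball e) rho) (rho0 : forall x, 0 <= rho x)
  (rho1 : rint mu rho = 1) (drho : rint mu (fun x => `|partial p rho x|) <= Kr / e).

Let w := partial p rho.
(** On [V] this is minus d_i d_j [D], where [D] is d_p of the mollified u; the sign comes from the
    reflected kernel. Written as a correlation with u_ij, it is exactly what the commutator estimate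
    produces. *)
Let xi i j := corr (v i j) w.
Let D := partial p (corr u rho).
Let psi x := Phi x * D x.

Let w_test : test_function (cball e) w. Proof. exact: test_partial. Qed.

Let near_U x : V x -> forall y, cball e (y - x) -> U y.
Proof.
move=> xV y yx; have -> : y = x + (y - x) by rewrite addrC subrK.
apply: eball_shift => // i.
by apply: le_trans e_small; apply: cball_coord; [exact: ltW|].
Qed.

Let Dsmooth : smooth D. Proof. exact/smooth_partial/(smooth_corr u_L1 rho_test). Qed.

Let D_bound x : V x -> `|D x| <= M.
Proof.
move=> xV; rewrite /D -[partial p _]/(pderiv [:: p] _).
rewrite (weak_pderiv_corr (u1_weak p) u_L1 rho_test (near_U xV)).
have r1 := test_L1 rho_test; apply: (le_trans (corr_bound x (u1_meas p) (u1_bound p) r1)).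
rewrite (@rint_ext _ _ _ _ _ rho) ?rho1 ?mulr1// => y.
by rewrite ger0_norm.
Qed.

Let dD_bound l x : V x -> `|partial l D x| <= M.
Proof.
move=> xV; rewrite /D -[partial l _]/(pderiv [:: l; p] _).
rewrite (weak_pderiv_corr (v_weak l p) u_L1 rho_test (near_U xV)).
have r1 := test_L1 rho_test; apply: (le_trans (corr_bound x _ (v_bound l p) r1)).
  by case: (v_L2 l p).
rewrite (@rint_ext _ _ _ _ _ rho) ?rho1 ?mulr1// => y.
by rewrite ger0_norm.
Qed.

Let xi_u k l x : V x -> xi k l x = corr u (pderiv [:: k; l] w) x.
Proof.
by move=> xV; rewrite (weak_corr (v_weak k l) w_test (near_U xV)) /= expr2 mulrNN !mulr1 mul1r.
Qed.

Let ddD k l x : V x -> partial k (partial l D) x = - xi k l x.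
Proof.
move=> xV; rewrite xi_u// /D -[partial k _]/(pderiv [:: k; l; p] _).
by rewrite (pderiv_corr _ _ u_L1 rho_test) /= exprS expr2 mulrNN !mulr1 mulN1r.
Qed.

(** Ellipticity is assumed for symmetric matrices only. The symmetry is inherited from the kernel,
    whose classical derivatives commute. *)
Let xi_sym k l x : V x -> xi k l x = xi l k x.
Proof.
move=> xV; rewrite (xi_u _ _ xV) (xi_u _ _ xV).
by have /(congr1 (fun h => corr u h x)) := partialC k l w_test.
Qed.

Let g_out x : ~ V x -> g x = 0.
Proof.
move=> xV; have : Phi x = 0 by apply: tsupp_out; have [_ _ PV] := Phi_test; move=> /PV.
by rewrite Phi_g => /eqP; rewrite expf_eq0 => /eqP.
Qed.

(** The part of d_k d_l (Phi D) in which at least one derivative falls on Phi. Each term has a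
    factor at most K g and a factor D u^e or D^2 u^e at most M. *)
Let L k l x := partial k (partial l Phi) x * D x + partial l Phi x * partial k D x
  + partial k Phi x * partial l D x.

Let L_bound k l x : `|L k l x| <= 3 * K * M * g x.
Proof.
have /andP[g0 _] := g01 x; have Kg : 0 <= K * g x by rewrite mulr_ge0.
have b (a b' : R) : `|a| <= K * g x -> (V x -> `|b'| <= M) -> `|a * b'| <= K * M * g x.
  move=> aK bM; have [xV|xV] := pselect (V x).
    by rewrite normrM mulrAC; apply: ler_pM => //; exact: bM.
  by move: aK; rewrite (g_out xV) !mulr0 normr_le0 => /eqP ->; rewrite mul0r normr0.
have h1 := b _ _ (ddPhi k l x) (@D_bound x); have h2 := b _ _ (dPhi l x) (@dD_bound k x).
have h3 := b _ _ (dPhi k x) (@dD_bound l x).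
have -> : 3 * K * M * g x = 3 * (K * M * g x) by rewrite !mulrA.
exact: ler_norm_add3 h1 h2 h3.
Qed.

Let psi_test : test_function V psi. Proof. exact: testMl. Qed.

Let psi_kl k l x : pderiv [:: k; l] psi x = L k l x - Phi x * xi k l x.
Proof.
have sP := test_smooth Phi_test; have sPl := smooth_partial l sP.
have sDl := smooth_partial l Dsmooth.
rewrite -[pderiv _ _]/(partial k (partial l psi)) /psi partialM; [|exact: sP|exact: Dsmooth].
rewrite partialD; [|by apply: smoothM; [exact: sPl|exact: Dsmooth]|by apply: smoothM; [exact: sP|exact: sDl]].
rewrite partialM; [|exact: sPl|exact: Dsmooth].
rewrite partialM; [|exact: sP|exact: sDl].
have -> : Phi x * partial k (partial l D) x = - (Phi x * xi k l x).
  have [xV|xV] := pselect (V x); first by rewrite (ddD _ _ xV) mulrN.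
  by rewrite Phi_g (g_out xV) expr0n !mul0r oppr0.
exact: addrA.
Qed.

Let xi_smooth k l : smooth (xi k l).
Proof. exact: smooth_corr (v_L1 k l) w_test. Qed.

(** The weight is the square root of the cutoff, so that the square of this function carries the
    weight Phi of the energy. *)
Let gxi i j x := g x * xi i j x.

Let gxi_L2 i j : L2 mu (gxi i j).
Proof.
split.
  apply: measurable_funM; first exact: g_meas.
  by apply: continuous_measurable_rV; exact: smooth_continuous (xi_smooth i j).
apply: L1_ext (test_L1 (testMl (testMl Phi_test (xi_smooth i j)) (xi_smooth i j))) => x.
by rewrite /gxi Phi_g; ring.
Qed.

Let g_L2 : L2 mu g.
Proof. by split => //; apply: L1_ext (test_L1 Phi_test) => x; rewrite Phi_g. Qed.

Let X2 := \sum_i \sum_j nrm2 mu (gxi i j) ^+ 2.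
Let X := Num.sqrt X2.

Let X2_ge0 : 0 <= X2.
Proof. by apply: sumr_ge0 => i _; apply: sumr_ge0 => j _; rewrite sqr_ge0. Qed.

Let gxi_X i j : nrm2 mu (gxi i j) <= X.
Proof.
exact: (@le_sqrt_sum2 _ _ (fun i j => nrm2 mu (gxi i j)) i j (nrm2_ge0 _ _)).
Qed.

Let P := 3 * K * M * nrm2 mu g + X.

Let psi_L2 k l : L2 mu (pderiv [:: k; l] psi).
Proof. exact: test_L2 (test_pderiv _ psi_test). Qed.

Let psi_bound k l : nrm2 mu (pderiv [:: k; l] psi) <= P.
Proof.
have KM : 0 <= 3 * K * M by rewrite !mulr_ge0.
have a2 : L2 mu (fun x => 3 * K * M * g x) by exact: L2Z.
have b2 : L2 mu (fun x => `|gxi k l x|).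
  have [m _] := gxi_L2 k l; apply: L2_le (gxi_L2 k l) _ => [|x]; last by rewrite normr_id.
  exact: measurableT_comp.
have nb : nrm2 mu (fun x => `|gxi k l x|) <= X.
  by apply: le_trans (gxi_X k l); apply: le_nrm2 => // x; rewrite normr_id.
apply: (@le_trans _ _ (nrm2 mu (fun x => 3 * K * M * g x + `|gxi k l x|))); last first.
  by apply: (le_trans (nrm2D a2 b2)); rewrite nrm2Z// ger0_norm// lerD2l.
apply: le_nrm2; [by []|exact: L2D|move=> x].
have /andP[g0 g1] := g01 x.
rewrite [X in _ <= X]ger0_norm ?addr_ge0 ?mulr_ge0// psi_kl; apply: (le_trans (ler_normB _ _)).
apply: lerD; first exact: L_bound.
rewrite /gxi !normrM Phi_g normrX ger0_norm// ler_wpM2r// expr2 ler_piMr//.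
Qed.

Let L_smooth k l : test_function V (fun x => L k l x).
Proof.
have sD := Dsmooth; have tl := test_partial l Phi_test; have tk := test_partial k Phi_test.
apply: testD; last exact: testMl tk (smooth_partial l sD).
apply: testD; last exact: testMl tl (smooth_partial k sD).
exact: testMl (test_partial k tl) sD.
Qed.

Let cLxi_L1 i j k l : L1 mu (fun x => c i j k l x * (L k l x * xi i j x)).
Proof. by apply: L2M => //; exact: test_L2 (testMl (L_smooth k l) (xi_smooth i j)). Qed.

Let cxixi_L1 i j k l : L1 mu (fun x => c i j k l x * (Phi x * xi i j x * xi k l x)).
Proof.
apply: L2M => //; exact: test_L2 (testMl (testMl Phi_test (xi_smooth i j)) (xi_smooth k l)).
Qed.

(** The factor g contained in the bound of [L] is given to [xi], and what remains is an L^2 pairing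
    of [c] with [gxi]. *)
Let cLxi_bound i j k l :
  `|rint mu (fun x => c i j k l x * (L k l x * xi i j x))| <= 3 * K * M * Nc * X.
Proof.
have KM : 0 <= 3 * K * M by rewrite !mulr_ge0.
apply: (le_trans (@le_cauchy_schwarz _ _ _ _ _ (3 * K * M) (cLxi_L1 i j k l) (c_L2 i j k l) (gxi_L2 i j) KM _)).
  move=> x; have /andP[g0 _] := g01 x; have := L_bound k l x.
  have := normr_ge0 (c i j k l x); have := normr_ge0 (xi i j x).
  rewrite /gxi !normrM (ger0_norm g0) => x0 c0 Lb.
  rewrite (_ : 3 * K * M * _ = `|c i j k l x| * (3 * K * M * g x * `|xi i j x|)); last by ring.
  by rewrite ler_wpM2l// ler_wpM2r.
rewrite -[X in _ <= X]mulrA ler_wpM2l//; apply: ler_pM; rewrite ?nrm2_ge0//; exact: gxi_X.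
Qed.

(** Ellipticity is applied at almost every x to the matrix xi(x), then multiplied by g^2 = Phi and
    integrated. *)
Let energy_lower : Lam * X2 <= \sum_i \sum_j \sum_k \sum_l
  rint mu (fun x => c i j k l x * (Phi x * xi i j x * xi k l x)).
Proof.
have sq i j : L1 mu (fun x => gxi i j x ^+ 2) by case: (gxi_L2 i j).
have -> : Lam * X2 = rint mu (fun x => Lam * \sum_i \sum_j gxi i j x ^+ 2).
  rewrite rintZ; last by apply: L1_sum => i; apply: L1_sum.
  rewrite rint_sum; last by move=> i; apply: L1_sum.
  congr (_ * _); apply: eq_bigr => i _; rewrite rint_sum//.
  by apply: eq_bigr => j _; rewrite nrm2_sqr.
under [X in _ <= X]eq_bigr => i _.
  under eq_bigr => j _.
    under eq_bigr => k _ do rewrite -rint_sum//.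
    rewrite -rint_sum; last by move=> k; apply: L1_sum.
    over.
  rewrite -rint_sum; last by move=> j; apply: L1_sum => k; apply: L1_sum.
  over.
rewrite -rint_sum; last by move=> i; apply: L1_sum => j; apply: L1_sum => k; apply: L1_sum.
apply: le_rint_ae; [by apply: L1Z; apply: L1_sum => i; apply: L1_sum
  |by apply: L1_sum => i; apply: L1_sum => j; apply: L1_sum => k; apply: L1_sum|].
apply: filterS elliptic => x H.
(* Off [V] the weight makes both sides zero; symmetry of xi is known only on [V]. *)
have [xV|xV] := pselect (V x); last first.
  rewrite big1 ?mulr0.
    apply: sumr_ge0 => i _; apply: sumr_ge0 => j _; apply: sumr_ge0 => k _; apply: sumr_ge0 => l _.
    by rewrite Phi_g g_out// expr0n !mul0r mulr0.
  by move=> i _; rewrite big1// => j _; rewrite /gxi g_out// mul0r expr0n.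
have xU : U x.
  by rewrite -[x]addr0; apply: eball_shift => // i; rewrite mxE normr0 ltW// shift_size_gt0.
have := H xU (\matrix_(i, j) xi i j x); have -> : (\matrix_(i, j) xi i j x)^T = \matrix_(i, j) xi i j x.
  by apply/matrixP => i j; rewrite !mxE xi_sym.
move=> /(_ erefl).
under eq_bigr => i _ do under eq_bigr => j _ do rewrite mxE.
under [X in _ <= X -> _]eq_bigr => i _ do under eq_bigr => j _ do under eq_bigr => k _ do under eq_bigr => l _ do rewrite !mxE.
move=> /(ler_wpM2l (sqr_ge0 (g x))); rewrite mulrCA !mulr_sumr.
congr (_ <= _).
  by apply: eq_bigr => i _; rewrite !mulr_sumr; apply: eq_bigr => j _; rewrite /gxi exprMn.
apply: eq_bigr => i _; rewrite mulr_sumr; apply: eq_bigr => j _.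
rewrite mulr_sumr; apply: eq_bigr => k _; rewrite mulr_sumr; apply: eq_bigr => l _.
by rewrite Phi_g; ring.
Qed.

Let Kr0 : 0 <= Kr.
Proof.
have h : 0 <= Kr / e by apply: le_trans drho; apply: rint_ge0.
by rewrite -(mulfVK (lt0r_neq0 e0) Kr) mulr_ge0// ltW.
Qed.

Let P0 : 0 <= P.
Proof. by rewrite /P addr_ge0 ?mulr_ge0// ?nrm2_ge0// sqrtr_ge0. Qed.

(** Here the e gained by the commutator cancels the 1/e of the mollifier, which makes the estimate
    uniform in e. *)
Let w_scale (Y : R) : 0 <= Y -> rint mu (fun z => `|w z|) * (e * Y) <= Kr * Y.
Proof. by move=> Y0; rewrite mulrA ler_wpM2r// -ler_pdivlMr. Qed.

Let cv_L2 i j k l : L2 mu (fun x => c i j k l x * v i j x).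
Proof.
have [mv _] := v_L2 i j; have [h _] := L2_bound mv (v_bound i j) (c_L2 i j k l).
by apply: L2_ext h => x; rewrite mulrC.
Qed.

Let E i j k l := rint mu (fun z : T => w z *
  rint mu (fun x : T => (c i j k l (x + z) * v i j (x + z)) * pderiv [:: k; l] psi x)).
Let Ef k l := rint mu (fun z : T => w z *
  rint mu (fun x : T => f k l (x + z) * pderiv [:: k; l] psi x)).

Let equation_E : \sum_k \sum_l \sum_i \sum_j E i j k l = - \sum_k \sum_l Ef k l.
Proof.
have F2 k l : L2 mu (fun x => (\sum_i \sum_j c i j k l x * v i j x) + f k l x).
  by apply: L2D => //; apply: L2_sum => i; apply: L2_sum => j.
have w1 := test_L1 w_test; have w2 := test_L2 w_test.
have eqn := equation_corr F2 equation psi_test w_test (ltW e0) e_small.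
suff H k l : rint mu (fun z : T => w z * rint mu (fun x : T =>
    ((\sum_i \sum_j c i j k l (x + z) * v i j (x + z)) + f k l (x + z)) * pderiv [:: k; l] psi x)) =
    (\sum_i \sum_j E i j k l) + Ef k l.
  have : \sum_k \sum_l ((\sum_i \sum_j E i j k l) + Ef k l) = 0.
    by rewrite -[RHS]eqn; apply: eq_bigr => k _; apply: eq_bigr => l _; rewrite -H.
  under eq_bigr => k _ do rewrite big_split/=.
  by rewrite big_split/= => /eqP; rewrite addr_eq0 => /eqP.
have p2 := psi_L2 k l.
have L1E i j := (fubini_corr w1 w2 (cv_L2 i j k l) p2).1.
have L1f := (fubini_corr w1 w2 (f_L2 k l) p2).1.
rewrite /E /Ef; under eq_bigr => i _ do rewrite -rint_sum//.
rewrite -rint_sum; last by move=> i; apply: L1_sum.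
rewrite -rintD//; last by apply: L1_sum => i; apply: L1_sum.
apply: rint_ext => z.
under eq_bigr => i _ do rewrite -mulr_sumr.
rewrite -mulr_sumr -mulrDr; congr (_ * _).
have L1z i j : L1 mu (fun x : T => c i j k l (x + z) * v i j (x + z) * pderiv [:: k; l] psi x).
  exact: L2M (L2_shift z (cv_L2 i j k l)) p2.
under eq_bigr => i _ do rewrite -rint_sum//.
rewrite -rint_sum; last by move=> i; apply: L1_sum.
rewrite -rintD; [|by apply: L1_sum => i; apply: L1_sum|exact: L2M (L2_shift z (f_L2 k l)) p2].
apply: rint_ext => x; rewrite mulrDl mulr_suml; congr (_ + _).
by apply: eq_bigr => i _; rewrite mulr_suml.
Qed.

(** Write f as f times the indicator of B_1 and apply the commutator estimate with f as coefficient
    and the indicator as second factor. The term with the coefficient frozen at x vanishes: for x in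
    [V] the correlation of the indicator with [w] is the integral of d_p rho. *)
Let Ef_bound k l : `|Ef k l| <= Kr * (n%:R * Nf * P).
Proof.
have mU : measurable U := measurable_eball 1.
have i2 : L2 mu (\1_U : T -> R) by apply: (@L2_indic _ _ _ 2) => // x /(@eball_cube R n 1 ltr01); rewrite mulr1.
have i1 x : `|\1_U x : R| <= 1 by rewrite indicE; case: (_ \in _); rewrite ?normr1 ?normr0.
have Z : rint mu (fun x => f k l x * pderiv [:: k; l] psi x * corr (\1_U) w x) = 0.
  rewrite -[RHS](@rint0 _ _ _ mu); apply: rint_ext => x.
  have [xV|xV] := pselect (V x); last first.
    have -> : pderiv [:: k; l] psi x = 0.
      by apply: pderiv_out; have [_ _ pV] := psi_test; move=> /pV.
    by rewrite mulr0 mul0r.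
  suff -> : corr (\1_U) w x = 0 by rewrite mulr0.
  rewrite -(rint_partial0 p rho_test) -(rint_shift (- x) (test_L1 w_test)).
  apply: rint_ext => y; have [->|wy] := eqVneq (w (y - x)) 0; first by rewrite mulr0.
  rewrite indicE mem_set ?mul1r//; apply: (near_U xV).
  by have [_ _] := w_test; apply; apply: subset_closure.
have sub0 (a b B : R) : b = 0 -> `|a - b| <= B -> `|a| <= B by move=> ->; rewrite subr0.
have h := sub0 _ _ _ Z (commutator_bound (f_L1 k l) (f_L2 k l) (fun p => df_L2 p k l)
  (fun p => df_bound p k l) (fun p => df_weak p k l) i2 i1 (test_pderiv [:: k; l] psi_test)
  w_test (ltW e0) e_small).
apply: (@le_trans _ _ (rint mu (fun z => `|w z|) * (e * (n%:R * Nf * P)))); last first.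
  by apply: w_scale; rewrite !mulr_ge0.
apply: le_trans; last first.
  apply: (le_trans h); rewrite ler_wpM2l//; first exact: rint_ge0.
  by rewrite -mulrA ler_wpM2l ?(ltW e0)// ler_wpM2l ?mulr_ge0// mul1r; exact: psi_bound.
rewrite le_eqVlt; apply/orP; left; apply/eqP; congr (`| _ |).
apply: rint_ext => z; congr (_ * _); apply: rint_ext => x; congr (_ * _).
rewrite indicE; have [xU|xU] := pselect (U (x + z)); first by rewrite mem_set// mulr1.
by rewrite (f_out _ _ xU) mul0r.
Qed.

(** Up to the commutator, [E] equals int c psi_kl xi_ij, and psi_kl = L - Phi xi_kl splits off the
    energy density with a minus sign. *)
Let Q_bound i j k l : rint mu (fun x => c i j k l x * (Phi x * xi i j x * xi k l x)) <=
  (3 * K * M * Nc * X + Kr * (n%:R * Nc * (M * P))) - E i j k l.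
Proof.
have h : `|E i j k l - rint mu (fun x => c i j k l x * pderiv [:: k; l] psi x * xi i j x)| <=
    Kr * (n%:R * Nc * (M * P)).
  apply: (le_trans (commutator_bound (c_L1 i j k l) (c_L2 i j k l) (fun p => dc_L2 p i j k l)
    (fun p => dc_bound p i j k l) (fun p => dc_weak p i j k l) (v_L2 i j) (v_bound i j)
    (test_pderiv [:: k; l] psi_test) w_test (ltW e0) e_small)).
  apply: (@le_trans _ _ (rint mu (fun z => `|w z|) * (e * (n%:R * Nc * (M * P))))); last first.
    by apply: w_scale; rewrite !mulr_ge0.
  rewrite ler_wpM2l//; first exact: rint_ge0.
  rewrite -mulrA ler_wpM2l ?(ltW e0)// ler_wpM2l ?mulr_ge0// ler_wpM2l//; exact: psi_bound.
have e1 : rint mu (fun x => c i j k l x * pderiv [:: k; l] psi x * xi i j x) =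
    rint mu (fun x => c i j k l x * (L k l x * xi i j x)) -
    rint mu (fun x => c i j k l x * (Phi x * xi i j x * xi k l x)).
  rewrite -rintB//; apply: rint_ext => x; rewrite psi_kl.
  by move: (L k l x) (xi i j x) (xi k l x) => a b d; ring.
by rewrite e1 in h; exact: le_of_dist h (cLxi_bound i j k l).
Qed.

(** The two coefficients arise by inserting P = 3 K M |g| + X: n^4 quadruples of indices contribute
    through [c] and n^2 pairs through [f]. Neither contains e, p or the mollifier. *)
Definition energy_slope : R := n%:R ^+ 4 * (3 * K * M * Nc) +
  (n%:R ^+ 4 * (Kr * (n%:R * Nc * M)) + n%:R ^+ 2 * (Kr * (n%:R * Nf))).
Definition energy_const (G : R) : R :=
  (n%:R ^+ 4 * (Kr * (n%:R * Nc * M)) + n%:R ^+ 2 * (Kr * (n%:R * Nf))) * (3 * K * M * G).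

Let energy : Lam * X ^+ 2 <= energy_slope * X + energy_const (nrm2 mu g).
Proof.
rewrite sqr_sqrtr//; apply: (le_trans energy_lower); apply: (le_trans (sum4_le Q_bound)).
rewrite equation_E opprK.
apply: (le_trans (lerD (lexx _) (le_trans (ler_norm _)
  (normr_sum_le (fun k => normr_sum_le (fun l => Ef_bound k l)))))).
rewrite le_eqVlt; apply/orP; left; apply/eqP; rewrite /energy_slope /energy_const /P.
by move: X (nrm2 mu g) => Y G; ring.
Qed.

Lemma caccioppoli i j : L2 mu (fun x => g x * corr (v i j) (partial p rho) x) /\
  nrm2 mu (fun x => g x * corr (v i j) (partial p rho) x) <=
  Num.sqrt ((energy_slope / Lam) ^+ 2 + 2 * (energy_const (nrm2 mu g) / Lam)).
Proof.
split; first exact: gxi_L2.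
apply: (le_trans (gxi_X i j)).
have X0 : 0 <= X by exact: sqrtr_ge0.
rewrite -(ger0_norm X0) -sqrtr_sqr ler_wsqrtr//.
exact: quadratic_bound Lam0 energy.
Qed.

End mollified.

Lemma third_derivative (Phi g : T -> R) (K delta Kr : R) :
  [/\ [/\ test_function V Phi, measurable_fun setT g & forall x, 0 <= g x <= 1],
     0 <= K, 0 < delta, forall x, Phi x = g x ^+ 2 &
   [/\ forall i x, `|partial i Phi x| <= K * g x,
       forall i j x, `|partial i (partial j Phi) x| <= K * g x &
       forall x, eball (1 / 2) x -> delta <= g x]] ->
  (forall e : R, 0 < e -> exists rho : T -> R,
    [/\ test_function (cball e) rho, forall x, 0 <= rho x, rint mu rho = 1 &
     forall p, rint mu (fun x => `|partial p rho x|) <= Kr / e]) ->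
  forall i j p, exists h, [/\ L2 mu h,
    nrm2 mu h <= delta^-1 *
      Num.sqrt ((energy_slope K Kr / Lam) ^+ 2 + 2 * (energy_const K Kr (nrm2 mu g) / Lam)) &
    weak (eball (1 / 2)) [:: p] (v i j) h].
Proof.
move=> [[tP mg g01] K0 d0 Pg [dP ddP gd]] moll i j p.
have di0 : 0 <= delta^-1 by rewrite invr_ge0 ltW.
set B := Num.sqrt _; have B0 : 0 <= delta^-1 * B by rewrite mulr_ge0 ?sqrtr_ge0// invr_ge0 ltW.
pose W : set T := eball (1 / 2).
have bound eta : test_function W eta -> `|rint mu (fun x => v i j x * partial p eta x)| <= delta^-1 * B * nrm2 mu eta.
  move=> te; have tp := test_partial p te; have e2 := test_L2 te; have p2 := test_L2 tp.
  (* The functional to be bounded is G 0. By [corr_by_parts] the average of [G] against rho pairs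
     eta with the mollified third derivative, which [caccioppoli] controls because g >= delta on the
     support of eta. *)
  pose G := corr (v i j) (partial p eta).
  have cG : continuous G := corr_continuous (v_L1 i j) tp.
  have G0 : G 0 = rint mu (fun x => v i j x * partial p eta x).
    by apply: rint_ext => y; rewrite subr0.
  rewrite -G0; apply/ler_addgt0Pr => r r0.
  have [s s0 sG] := continuous_coord cG r0.
  (* [s] depends on eta and on the tolerance [r], but the bound of [caccioppoli] does not depend on
     e, so [r] can be made arbitrarily small. *)
  pose e := Num.min s (@shift_size R n).
  have e0 : 0 < e by rewrite lt_min s0 shift_size_gt0.
  have [rho [tr rho0 rho1 dr]] := moll e e0.
  have es : e <= @shift_size R n by rewrite ge_min lexx orbT.
  have [X2 XB] := caccioppoli tP mg g01 K0 Pg dP ddP e0 es tr rho0 rho1 (dr p) i j.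
  have tw := test_partial p tr.
  have E := corr_by_parts p (v_L1 i j) (v_L2 i j) te tr.
  have sG' : smooth G := smooth_corr (v_L1 i j) tp.
  have es' : e <= s by rewrite ge_min lexx.
  have near := mollifier_average tr rho0 rho1 (ltW e0) es' sG' sG.
  have bX : `|rint mu (fun x => eta x * corr (v i j) (partial p rho) x)| <= delta^-1 * B * nrm2 mu eta.
    have sX : smooth (corr (v i j) (partial p rho)) := smooth_corr (v_L1 i j) tw.
    rewrite mulrAC; apply: (le_trans (@le_cauchy_schwarz _ _ _ eta _ (delta^-1) (test_L1 (testMl te sX)) e2 X2 _ _)).
    - exact: di0.
    - move=> x; rewrite normrM; have [->|ex] := eqVneq (eta x) 0; first by rewrite normr0 !mul0r mulr0.
      have xW : W x by have [_ _] := te; apply; apply: subset_closure.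
      exact: ler_scale d0 (gd x xW).
    - rewrite mulrA; apply: ler_wpM2l; last exact: XB.
      by apply: mulr_ge0; [exact: di0|exact: nrm2_ge0].
  by rewrite E in bX; exact: ler_norm_near bX near.
(* The minus sign is that of a weak derivative of order one. *)
have [|eta te|h [h2 hB hE]] := @riesz_test _ _ W (fun eta => - rint mu (fun x => v i j x * partial p eta x)) _ B0.
- move=> a eta1 eta2 t1 t2; have tp1 := test_L2 (test_partial p t1); have tp2 := test_L2 (test_partial p t2).
  have l1 := L2M (v_L2 i j) tp1; have l2 := L2M (v_L2 i j) tp2.
  rewrite mulrN -opprD -rintZ// -rintD//; last exact: L1Z.
  congr (- _); apply: rint_ext => x.
  rewrite partialD; [|exact: test_smooth (testZ a t1)|exact: test_smooth t2].
  rewrite partialZ; last exact: test_smooth t1.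
  by rewrite mulrDr mulrCA.
- by rewrite normrN; exact: bound.
exists h; split=> // eta te; rewrite -hE//= expr1 mulN1r opprK.
by [].
Qed.

End caccioppoli.

(** * Sobolev functions *)

Section conversion.
Context {R : realType} {n : nat}.
Notation T := 'rV[R]_n.
Notation mu := (@lebm R n).
Implicit Types (F f g h k : T -> R) (x y z : T) (i j : 'I_n) (s : seq 'I_n) (U A : set T).

Lemma restrict_in f A x : A x -> (f \_ A) x = f x.
Proof. by move=> Ax; rewrite patchE mem_set. Qed.

Lemma restrict_out f A x : ~ A x -> (f \_ A) x = 0.
Proof. by move=> Ax; rewrite patchE memNset. Qed.

Lemma rint_restrict F A : L1 mu (F \_ A) ->
  (\int[mu]_(x in A) (F x)%:E = (rint mu (F \_ A))%:E)%E.
Proof.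
move=> F1; rewrite -(rintE F1) [LHS]integral_mkcond; apply: eq_integral => x _.
by rewrite patchE [X in _ = X%:E]patchE; case: ifP.
Qed.

Lemma Lnorm2E f : L2 mu f -> ('N[mu]_2%:E[EFin \o f] = (nrm2 mu f)%:E)%E.
Proof.
move=> [mf ff]; rewrite unlock /nrm2.
have -> : (\int[mu]_x (`|(EFin \o f) x| `^ 2) = \int[mu]_x (f x ^+ 2)%:E)%E.
  apply: eq_integral => x _; rewrite /= powR_mulrn// real_normK// num_real//.
rewrite (rintE ff) poweR_EFin powR12_sqrt//; apply: rint_ge0 => x; exact: sqr_ge0.
Qed.

Lemma L2_Lfun f : L2 mu f -> f \in Lfun mu 2%:E.
Proof.
move=> f2; apply/andP; split; rewrite inE/=; first by case: f2.
by rewrite /finite_norm Lnorm2E// ltry.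
Qed.

Lemma Lfun_L2 f : f \in Lfun mu 2%:E -> L2 mu f.
Proof.
move=> /andP[]; rewrite inE/= => mf; rewrite inE/= /finite_norm => Nf; split => //.
apply/integrableP; split; first by apply/measurable_EFinP; exact: measurable_funX.
have -> : (\int[mu]_x `|(EFin \o (fun x => f x ^+ 2)%R) x| = 'N[mu]_2%:E[EFin \o f] `^ 2)%E.
  rewrite poweR_Lnorm//; apply: eq_integral => x _ /=.
  by rewrite powR_mulrn// real_normK ?num_real// ger0_norm// sqr_ge0.
exact: poweR_lty.
Qed.

Lemma Lfun_oo f : f \in Lfun mu +oo%E -> measurable_fun setT f /\
  {ae mu, forall x, `|f x| <= fine ('N[mu]_+oo[EFin \o f])%E}.
Proof.
move=> /andP[]; rewrite inE/= => mf; rewrite inE/= /finite_norm => Nf; split => //.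
have N0 : (0 <= 'N[mu]_+oo[EFin \o f])%E by exact: Lnorm_ge0.
have NE : ('N[mu]_+oo[EFin \o f] = (fine ('N[mu]_+oo[EFin \o f])%E)%:E)%E.
  by rewrite fineK// ge0_fin_numE.
move: NE; set M := fine _; rewrite unlock; case: ifPn => [_ E|m0 _].
  have := @ess_sup_inf.ess_sup_ge _ _ _ mu (abse \o (EFin \o f)); rewrite E.
  by apply: filterS => x; rewrite lee_fin.
(* When the whole space has measure zero the norm is 0 by convention, and the whole space serves as
   exceptional set. *)
exists setT; split=> //; apply/eqP; rewrite eq_le measure_ge0 andbT leNgt; exact: m0.
Qed.

Lemma Lnorm_oo_le f (M : R) : 0 <= M -> {ae mu, forall x, `|f x| <= M} ->
  ('N[mu]_+oo[EFin \o f] <= M%:E)%E.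
Proof.
move=> M0 H; rewrite unlock; case: ifPn => [_|_]; last by rewrite lee_fin.
by apply/ess_sup_inf.ess_supP; apply: filterS H => x; rewrite lee_fin.
Qed.

Lemma loc_L1 U f k K (C : R) : measurable U -> locally_integrable_rV U f -> compact K -> K `<=` U ->
  measurable_fun setT k -> (forall x, `|k x| <= C) -> (forall x, ~ K x -> k x = 0) ->
  L1 mu (fun x => (f \_ U) x * k x).
Proof.
move=> mU [_ fi] cK KU mk kC kK.
have mK := compact_measurable_rV cK.
have fK : L1 mu (f \_ K).
  have /(integrable_mkcond _ mK) := fi K cK KU.
  by rewrite restrict_EFin.
apply: (L1_ext (f := fun x => (f \_ K) x * k x)) => [x|].
  have [xK|xK] := pselect (K x); last by rewrite kK// !mulr0.
  by rewrite !restrict_in//; exact: KU.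
apply: L1_le (L1Z C (L1_norm fK)) _ => [|x].
  by apply: measurable_funM => //; exact: L1_measurable fK.
by rewrite normrM mulrC ler_wpM2r.
Qed.

Lemma loc_test_L1 U f k s : measurable U -> locally_integrable_rV U f -> test_function U k ->
  L1 mu (fun x => (f \_ U) x * pderiv s k x).
Proof.
move=> mU fl tk; have ts := test_pderiv s tk; have [C _ kC] := test_bounded ts.
have [_ ck kU] := tk.
by apply: (loc_L1 mU fl ck kU (test_measurable ts) kC) => x; exact: pderiv_out.
Qed.

Lemma restrict_test U f k s : test_function U k ->
  (fun x => f x * pderiv s k x) \_ U = (fun x => (f \_ U) x * pderiv s k x).
Proof.
move=> tk; apply/funext => x; have [xU|xU] := pselect (U x); first by rewrite !restrict_in.
by rewrite !restrict_out// mul0r.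
Qed.

Lemma is_weak_deriv_weak U s f g : measurable U -> is_weak_deriv U s f g ->
  weak U s (f \_ U) (g \_ U).
Proof.
move=> mU [fl gl H] eta te; have := H eta te.
have f1 := loc_test_L1 s mU fl te; have g1 := loc_test_L1 [::] mU gl te.
rewrite -(restrict_test _ _ te) in f1; rewrite -(restrict_test _ _ te) in g1.
rewrite (rint_restrict f1) (@rint_restrict (fun x => g x * eta x) _ g1) -EFinM => -[].
by rewrite (restrict_test _ s te) (restrict_test g [::] te).
Qed.

Lemma L1_loc U f : measurable U -> L1 mu (f \_ U) -> locally_integrable_rV U f.
Proof.
move=> mU f1; split; first by apply/(measurable_restrictT _ mU); exact: L1_measurable f1.
move=> K cK KU; have mK := compact_measurable_rV cK.
have : mu.-integrable U (EFin \o f) by apply/(integrable_mkcond _ mU); rewrite restrict_EFin.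
by apply: integrableS.
Qed.

Lemma weak_is_weak_deriv U s f g : measurable U -> L1 mu (f \_ U) -> L1 mu (g \_ U) ->
  weak U s (f \_ U) (g \_ U) -> is_weak_deriv U s f g.
Proof.
move=> mU f1 g1 H; have fl := L1_loc mU f1; have gl := L1_loc mU g1.
split => // eta te.
have F1 := loc_test_L1 s mU fl te; have G1 := loc_test_L1 [::] mU gl te.
have E := H eta te.
rewrite -(restrict_test _ _ te) in F1; rewrite -(restrict_test _ _ te) in G1.
rewrite (rint_restrict F1) (@rint_restrict (fun x => g x * eta x) _ G1) -EFinM; congr (_%:E).
by rewrite (restrict_test _ s te) (restrict_test g [::] te).
Qed.

Lemma is_weak_deriv_sub U A s f g : measurable U -> measurable A -> A `<=` U ->
  is_weak_deriv U s f g -> is_weak_deriv A s f g.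
Proof.
move=> mU mA AU [[mf fl] [mg gl] H].
split; [split|split|].
- exact: measurable_funS AU mf.
- by move=> K cK KA; apply: fl => //; exact: subset_trans AU.
- exact: measurable_funS AU mg.
- by move=> K cK KA; apply: gl => //; exact: subset_trans AU.
move=> eta te; have tU := test_sub AU te.
have E (F k : T -> R) s' : k = pderiv s' eta ->
    (\int[mu]_(x in A) (F x * k x)%:E = \int[mu]_(x in U) (F x * k x)%:E)%E.
  move=> ->; rewrite integral_mkcond [RHS]integral_mkcond; apply: eq_integral => x _.
  rewrite !patchE; case: ifPn => [xA|xA]; first by rewrite mem_set//; exact/AU/set_mem.
  case: ifPn => // _; rewrite (pderiv_out s') ?mulr0//.
  by have [_ _ tA] := te; move=> /tA /mem_set; exact/negP.
by rewrite (E f _ s erefl) (E g eta [::] erefl); exact: H.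
Qed.

Lemma weak_deriv_unique U s f g h : open U -> is_weak_deriv U s f g -> is_weak_deriv U s f h ->
  {ae mu, forall x, U x -> g x = h x}.
Proof.
move=> oU fg fh; have mU := open_measurable_rV oU.
have [_ gl _] := fg; have [_ hl _] := fh.
have wg := is_weak_deriv_weak mU fg; have wh := is_weak_deriv_weak mU fh.
have mg : measurable_fun setT (g \_ U) by apply/(measurable_restrictT _ mU); case: gl.
have mh : measurable_fun setT (h \_ U) by apply/(measurable_restrictT _ mU); case: hl.
have D x : ((g \_ U) x - (h \_ U) x) = 0 -> U x -> g x = h x.
  by move=> E xU; move: E; rewrite !restrict_in// => /eqP; rewrite subr_eq0 => /eqP.
suff : {ae mu, forall x, U x -> (g \_ U) x - (h \_ U) x = 0}.
  by apply: filterS => x E xU; apply: D => //; exact: E.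
apply: du_bois_reymond => //; first exact: measurable_funB.
  move=> a b abU; have cK := @kbox_compact R n a b; have mK := measurable_kbox a b.
  have mi : measurable_fun setT (\1_(kbox a b) : T -> R) by exact: measurable_indic.
  have b1 x : `|\1_(kbox a b) x : R| <= 1 by rewrite indicE; case: (_ \in _); rewrite ?normr1 ?normr0.
  have o x : ~ kbox a b x -> \1_(kbox a b) x = 0 :> R by move=> ?; rewrite indicE memNset.
  have := L1B (loc_L1 mU gl cK abU mi b1 o) (loc_L1 mU hl cK abU mi b1 o).
  by apply: L1_ext => x; rewrite mulrBl.
move=> eta te.
have G1 := loc_test_L1 [::] mU gl te; have H1 := loc_test_L1 [::] mU hl te.
rewrite (@rint_ext _ _ _ _ _ (fun x => (g \_ U) x * eta x - (h \_ U) x * eta x)); last by move=> x; rewrite mulrBl.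
rewrite rintB//; have := wg eta te; rewrite (wh eta te) => /eqP.
by rewrite -subr_eq0 -mulrBr mulf_eq0 signr_eq0/= subr_eq0 => /eqP ->; rewrite subrr.
Qed.

Lemma weak_derivP U s f g : open U -> is_weak_deriv U s f g ->
  is_weak_deriv U s f (weak_deriv U s f) /\ {ae mu, forall x, U x -> weak_deriv U s f x = g x}.
Proof.
move=> oU fg; have h : is_weak_deriv U s f (weak_deriv U s f) by apply: getPex; exists g.
by split=> //; exact: weak_deriv_unique h fg.
Qed.

End conversion.

Section sobolev_facts.
Context {R : realType} {n : nat}.
Notation T := 'rV[R]_n.
Notation mu := (@lebm R n).
Implicit Types (f g h : T -> R) (x y z : T) (s : seq 'I_n) (U A : set T) (k : nat).

Lemma L2_ae f g : L2 mu f -> measurable_fun setT g -> {ae mu, forall x, f x = g x} -> L2 mu g.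
Proof.
move=> [_ f2] mg fg; split=> //.
have [] := rint_ae_ext f2 (measurable_funX 2 mg) => //.
by apply: filterS fg => x ->.
Qed.

Lemma ae_restrict f g A : {ae mu, forall x, A x -> f x = g x} ->
  {ae mu, forall x, (f \_ A) x = (g \_ A) x}.
Proof.
apply: filterS => x fg; have [xA|xA] := pselect (A x); last by rewrite !restrict_out.
by rewrite !restrict_in// fg.
Qed.

Lemma L2_L1_restrict f A (M : R) : 0 < M -> measurable A -> A `<=` cube M ->
  L2 mu (f \_ A) -> L1 mu (f \_ A).
Proof.
move=> M0 mA AM f2; apply: L1_ext (L2M f2 (L2_indic M0 mA AM)) => x.
have [xA|xA] := pselect (A x); last by rewrite restrict_out// mul0r.
by rewrite indicE mem_set// mulr1.
Qed.

(** The Sobolev norm is the L^p norm of this single function, which dominates each derivative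
    pointwise. *)
Definition jet U k f x : R := Num.sqrt (\sum_(j < k.+1) weak_grad U j f x ^+ 2).

Lemma weak_grad_sqr U k f x : weak_grad U k f x ^+ 2 = \sum_(s : k.-tuple 'I_n) weak_deriv U s f x ^+ 2.
Proof. by rewrite sqr_sqrtr// sumr_ge0// => s _; exact: sqr_ge0. Qed.

Lemma weak_grad_restrict U k f :
  weak_grad U k f \_ U = fun x => Num.sqrt (\sum_(s : k.-tuple 'I_n) (weak_deriv U s f \_ U) x ^+ 2).
Proof.
apply/funext => x; have [xU|xU] := pselect (U x).
  by rewrite restrict_in//; congr Num.sqrt; apply: eq_bigr => s _; rewrite restrict_in.
rewrite restrict_out// big1 ?sqrtr0// => s _; by rewrite restrict_out// expr0n.
Qed.

Lemma jet_restrict U k f :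
  jet U k f \_ U = fun x => Num.sqrt (\sum_(j < k.+1) (weak_grad U j f \_ U) x ^+ 2).
Proof.
apply/funext => x; have [xU|xU] := pselect (U x).
  by rewrite restrict_in//; congr Num.sqrt; apply: eq_bigr => j _; rewrite restrict_in.
rewrite restrict_out// big1 ?sqrtr0// => j _; by rewrite restrict_out// expr0n.
Qed.

Lemma weak_deriv_le_jet U k f s x : (size s <= k)%N ->
  `|(weak_deriv U s f \_ U) x| <= `|(jet U k f \_ U) x|.
Proof.
move=> sk; have [xU|xU] := pselect (U x); last by rewrite !restrict_out.
rewrite !restrict_in// [X in _ <= X]ger0_norm ?sqrtr_ge0// -sqrtr_sqr ler_wsqrtr//.
have sk1 : (size s < k.+1)%N by [].
rewrite (bigD1 (Ordinal sk1))//= weak_grad_sqr (bigD1 (in_tuple s))//=.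
rewrite -addrA lerDl addr_ge0// sumr_ge0// => j _; exact: sqr_ge0.
Qed.

Lemma measurable_sqrt_sum (I : finType) (F : I -> T -> R) : (forall i, measurable_fun setT (F i)) ->
  measurable_fun setT (fun x => Num.sqrt (\sum_i F i x ^+ 2)).
Proof.
move=> mF; apply: (measurableT_comp (f := @Num.sqrt R)).
  by apply: continuous_measurable_fun; exact: sqrt_continuous.
by apply: measurable_sum => i; exact: measurable_funX.
Qed.

Lemma L2_sqrt_sum (I : finType) (F : I -> T -> R) : (forall i, L2 mu (F i)) ->
  L2 mu (fun x => Num.sqrt (\sum_i F i x ^+ 2)) /\
  nrm2 mu (fun x => Num.sqrt (\sum_i F i x ^+ 2)) ^+ 2 = \sum_i nrm2 mu (F i) ^+ 2.
Proof.
move=> F2; have E x : Num.sqrt (\sum_i F i x ^+ 2) ^+ 2 = \sum_i F i x ^+ 2.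
  by rewrite sqr_sqrtr// sumr_ge0// => i _; exact: sqr_ge0.
split; last first.
  rewrite nrm2_sqr (@rint_ext _ _ _ _ _ (fun x => \sum_i F i x ^+ 2))//.
  rewrite rint_sum; last by move=> i; case: (F2 i).
  by apply: eq_bigr => i _; rewrite nrm2_sqr.
split; first by apply: measurable_sqrt_sum => i; case: (F2 i).
apply: (L1_ext (f := fun x => \sum_i F i x ^+ 2)) => [x|]; first by rewrite E.
by apply: L1_sum => i; case: (F2 i).
Qed.

Lemma lebm_lebesgue : (mu : {measure set T -> \bar R}) = lebesgue_rV n.
Proof. exact: eq_measure. Qed.

Lemma in_LpE U p f : in_Lp U p f = ((f \_ U) \in Lfun mu p).
Proof. by rewrite lebm_lebesgue. Qed.

Lemma Lp_normE U p f : Lp_norm U p f = ('N[mu]_p[EFin \o (f \_ U)])%E.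
Proof. by rewrite lebm_lebesgue. Qed.

Lemma sobolev_normE U k p f :
  sobolev_norm U k p f = ('N[mu]_p[EFin \o (jet U k f \_ U)])%E.
Proof. exact: Lp_normE. Qed.

Lemma sobolev_weak_deriv U k p f s : open U -> sobolev U k p f -> (size s <= k)%N ->
  exists g, [/\ is_weak_deriv U s f (weak_deriv U s f), measurable_fun setT (weak_deriv U s f \_ U),
    in_Lp U p g & {ae mu, forall x, (weak_deriv U s f \_ U) x = (g \_ U) x}].
Proof.
move=> oU [_ H] sk; have [g fg g2] := H s sk; have mU := open_measurable_rV oU.
have [h1 h2] := weak_derivP oU fg; exists g; split=> //; last exact: ae_restrict.
by apply/(measurable_restrictT _ mU); case: h1 => _ [].
Qed.

(** Even at order zero [weak_deriv] is a chosen representative, hence equal to [f] only almost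
    everywhere. *)
Lemma weak_deriv_nil U k p f : open U -> sobolev U k p f ->
  {ae mu, forall x, (weak_deriv U [::] f \_ U) x = (f \_ U) x}.
Proof.
move=> oU [_ H]; have [g [fl _ _] _] := H [::] isT.
have ff : is_weak_deriv U [::] f f by split=> // eta te; rewrite /= expr0 mul1e.
by have [_ h] := weak_derivP oU ff; exact: ae_restrict.
Qed.

Lemma sobolev_L2 U k f s : open U -> sobolev U k 2%:E f -> (size s <= k)%N ->
  L2 mu (weak_deriv U s f \_ U).
Proof.
move=> oU sf sk; have [g [_ m g2 E]] := sobolev_weak_deriv oU sf sk.
rewrite in_LpE in g2; apply: L2_ae (Lfun_L2 g2) m _; by apply: filterS E => x ->.
Qed.

Lemma sobolev_norm2 U k f : open U -> sobolev U k 2%:E f ->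
  [/\ sobolev_norm U k 2%:E f \is a fin_num, (0 <= sobolev_norm U k 2%:E f)%E &
   forall s, (size s <= k)%N -> nrm2 mu (weak_deriv U s f \_ U) <= fine (sobolev_norm U k 2%:E f)].
Proof.
move=> oU sf.
have j2 : L2 mu (jet U k f \_ U).
  rewrite jet_restrict; apply: (L2_sqrt_sum _).1 => j; rewrite weak_grad_restrict.
  by apply: (L2_sqrt_sum _).1 => s; apply: sobolev_L2 sf _ => //; rewrite size_tuple -ltnS.
have E : sobolev_norm U k 2%:E f = (nrm2 mu (jet U k f \_ U))%:E by rewrite sobolev_normE; exact: Lnorm2E.
rewrite E; split=> //; first by rewrite lee_fin nrm2_ge0.
move=> s sk; apply: le_nrm2 => //; first exact: sobolev_L2 sf sk.
by move=> x; exact: weak_deriv_le_jet.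
Qed.

Lemma sobolev_norm2_self U k f : open U -> sobolev U k 2%:E f ->
  L2 mu (f \_ U) /\ nrm2 mu (f \_ U) <= fine (sobolev_norm U k 2%:E f).
Proof.
move=> oU sf; have f2 : L2 mu (f \_ U) by case: sf; rewrite in_LpE => /Lfun_L2.
have d2 := sobolev_L2 (s := [::]) oU sf isT.
have [_ _ /(_ [::] isT) h] := sobolev_norm2 oU sf; split=> //.
apply: le_trans h; apply: le_nrm2_ae => //.
by apply: filterS (weak_deriv_nil oU sf) => x ->.
Qed.

(** [fine] sends infinity to 0, so the norm has to be shown finite before its value can bound
    anything; the individual bounds of the derivatives provide a crude bound [B] of the jet. *)
Lemma sobolev_norm_oo U k f : open U -> sobolev U k +oo%E f ->
  0 <= fine (sobolev_norm U k +oo%E f) /\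
  forall s, (size s <= k)%N ->
    {ae mu, forall x, `|(weak_deriv U s f \_ U) x| <= fine (sobolev_norm U k +oo%E f)}.
Proof.
move=> oU sf.
have md s : (size s <= k)%N -> measurable_fun setT (weak_deriv U s f \_ U).
  by move=> sk; have [g []] := sobolev_weak_deriv oU sf sk.
have /choice[M HM] s : exists M : R, (size s <= k)%N -> {ae mu, forall x, `|(weak_deriv U s f \_ U) x| <= M}.
  have [sk|//] := boolP (size s <= k)%N; last by exists 0.
  have [g [_ _ gL E]] := sobolev_weak_deriv oU sf sk.
  rewrite in_LpE in gL; have [_ gM] := Lfun_oo gL.
  exists (fine ('N[mu]_+oo[EFin \o (g \_ U)])%E) => _.
  by apply: filterS2 E gM => x ->.
have tk (j : 'I_k.+1) (s : j.-tuple 'I_n) : (size s <= k)%N by rewrite size_tuple -ltnS.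
have mj : measurable_fun setT (jet U k f \_ U).
  rewrite jet_restrict; apply: measurable_sqrt_sum => j; rewrite weak_grad_restrict.
  by apply: measurable_sqrt_sum => s; exact: md.
pose B := Num.sqrt (\sum_(j < k.+1) \sum_(s : j.-tuple 'I_n) M s ^+ 2).
have jB : {ae mu, forall x, `|(jet U k f \_ U) x| <= B}.
  have : {ae mu, forall x, forall (j : 'I_k.+1) (s : j.-tuple 'I_n), `|(weak_deriv U s f \_ U) x| <= M s}.
    by apply: filter_forall => j; apply: filter_forall => s; exact: HM.
  apply: filterS => x Hx; have [xU|xU] := pselect (U x); last first.
    by rewrite restrict_out// normr0 sqrtr_ge0.
  rewrite restrict_in// ger0_norm ?sqrtr_ge0// ler_wsqrtr//; apply: ler_sum => j _.
  rewrite weak_grad_sqr; apply: ler_sum => s _; have := Hx j s; rewrite restrict_in// => h.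
  by rewrite -[X in X <= _]real_normK ?num_real// lerXn2r ?nnegrE// (le_trans _ h).
have jL : (jet U k f \_ U) \in Lfun mu +oo%E.
  apply/andP; split; rewrite inE//=; rewrite /finite_norm.
  by apply: le_lt_trans (Lnorm_oo_le _ jB) _; [exact: sqrtr_ge0|exact: ltry].
have [_ jE] := Lfun_oo jL; rewrite sobolev_normE; split; first by apply: fine_ge0; exact: Lnorm_ge0.
move=> s sk; apply: filterS jE => x; apply: le_trans; exact: weak_deriv_le_jet.
Qed.

(** The conclusion reproduces its own hypotheses for the sum, so that nested sums of norms are
    handled by iteration. *)
Lemma le_fine_sum (I : finType) (F : I -> \bar R) :
  (forall i, F i \is a fin_num /\ (0 <= F i)%E) ->
  ((\sum_i F i)%E \is a fin_num /\ (0 <= \sum_i F i)%E) /\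
  forall i, fine (F i) <= fine (\sum_i F i)%E.
Proof.
move=> F0; have E : (\sum_i F i = (\sum_i fine (F i))%:E)%E.
  by rewrite -sumEFin; apply: eq_bigr => i _; rewrite fineK; case: (F0 i).
have f0 i : 0 <= fine (F i) by apply: fine_ge0; case: (F0 i).
split; first by rewrite E lee_fin sumr_ge0.
by move=> i; rewrite E/= (bigD1 i)//= lerDl sumr_ge0.
Qed.

(** Turns an almost everywhere bound into an everywhere bound by changing the function on a null
    set, as the pointwise hypotheses of the energy estimate require. *)
Definition clip (M : R) h x : R := Num.max (- M) (Num.min M (h x)).

Lemma clip_measurable M h : measurable_fun setT h -> measurable_fun setT (clip M h).
Proof. by move=> mh; apply: measurable_maxr => //; exact: measurable_minr. Qed.

Lemma clip_bound M h x : 0 <= M -> `|clip M h x| <= M.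
Proof.
move=> M0; rewrite ler_norml /clip le_max lexx /= ge_max ge_min lexx andbT.
by rewrite (le_trans _ M0)// oppr_le0.
Qed.

Lemma clip_id M h x : `|h x| <= M -> clip M h x = h x.
Proof. by rewrite ler_norml /clip => /andP[h1 h2]; rewrite (min_r h2) (max_r h1). Qed.

End sobolev_facts.

(** * From the energy estimate to the Sobolev statement *)

Section assembly.
Context {R : realType} {n : nat}.
Notation T := 'rV[R]_n.
Notation mu := (@lebm R n).
Implicit Types (f g h : T -> R) (x y z : T) (s : seq 'I_n) (i j k l : 'I_n) (U A : set T).

Lemma restrictE f A x : (f \_ A) x = f x * \1_A x.
Proof.
have [xA|xA] := pselect (A x); first by rewrite restrict_in// indicE mem_set// mulr1.
by rewrite restrict_out// indicE memNset// mulr0.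
Qed.

Lemma clip_outside (M : R) h A x : 0 <= M -> ~ A x -> clip M (h \_ A) x = 0.
Proof. by move=> M0 xA; rewrite clip_id restrict_out// normr0. Qed.

Lemma bounded_L2 f (M r : R) : 0 < r -> measurable_fun setT f -> (forall x, `|f x| <= M) ->
  (forall x, ~ eball r x -> f x = 0) -> L1 mu f /\ L2 mu f.
Proof.
move=> r0 mf fM f0; have o x : f x != 0 -> forall i, `|x ord0 i| < 2 * r.
  move=> fx i; have : eball r x by apply: contrapT => /f0/eqP; exact/negP.
  by move=> /(eball_cube r0)/(_ i); rewrite /= in_itv/= -ltr_norml.
have r20 : 0 < 2 * r by rewrite mulr_gt0.
have [h1 _] := bounded_L1 r20 mf fM o; split=> //; split=> //.
have [] // := @bounded_L1 _ _ (fun x => f x ^+ 2) (M ^+ 2) (2 * r) r20.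
- exact: measurable_funX.
- by move=> x; rewrite normrX lerXn2r ?nnegrE// (le_trans _ (fM x)).
- by move=> x; rewrite expf_eq0/= => fx; apply: o.
Qed.

Lemma ae_bounded_L2 f (M r : R) : 0 < r -> 0 <= M -> measurable_fun setT (f \_ (eball r)) ->
  {ae mu, forall x, `|(f \_ (eball r)) x| <= M} -> L1 mu (f \_ (eball r)) /\ L2 mu (f \_ (eball r)).
Proof.
move=> r0 M0 mf fM.
have [c1 c2] := bounded_L2 r0 (clip_measurable M mf) (fun x => clip_bound _ x M0)
  (fun x => @clip_outside M f _ x M0).
have E : {ae mu, forall x, clip M (f \_ (eball r)) x = (f \_ (eball r)) x}.
  by apply: filterS fM => x; exact: clip_id.
by split; [have [] := rint_ae_ext c1 mf E|exact: L2_ae c2 mf E].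
Qed.

Lemma weak_ae U s f g h : (forall eta, test_function U eta -> L1 mu (fun x => g x * eta x)) ->
  measurable_fun setT h -> {ae mu, forall x, g x = h x} -> weak U s f g -> weak U s f h.
Proof.
move=> g1 mh gh wg eta te; rewrite (wg eta te); congr (_ * _).
have mt := test_measurable te.
have [] // := rint_ae_ext (g1 eta te) (measurable_funM mh mt).
by apply: filterS gh => x ->.
Qed.

(** The derivative of a test function is again a test function, so it may be inserted in the first
    identity. *)
Lemma weak_chain U A a b d f g h : A `<=` U -> weak U [:: a; b] f g -> weak A [:: d] g h ->
  weak A [:: a; b; d] f h.
Proof.
move=> AU fg gh eta te.
have := fg _ (test_sub AU (test_partial d te)); rewrite [pderiv _ (partial _ _)]/= => E.
have := gh eta te => E2; rewrite [LHS]E.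
by rewrite [X in _ * X]E2 /= mulrA -exprD.
Qed.

Lemma weak_restrict A s f g : weak A s f g -> weak A s (f \_ A) (g \_ A).
Proof.
move=> fg eta te.
have o (k : T -> R) s' : (fun x : T => (k \_ A) x * pderiv s' eta x) =1 (fun x => k x * pderiv s' eta x).
  move=> x; have [xA|xA] := pselect (A x); first by rewrite restrict_in.
  by rewrite (pderiv_out s') ?mulr0//; have [_ _ tA] := te; move=> /tA.
by rewrite (rint_ext _ (o f s)) (rint_ext _ (o g [::])); exact: fg.
Qed.

(** Carries the equation from the chosen weak derivatives on B_1 to their clipped versions on the
    whole space, which agree with them almost everywhere. *)
Lemma equation_ae (u : T -> R) (c : 'I_n -> 'I_n -> 'I_n -> 'I_n -> T -> R)
    (f : 'I_n -> 'I_n -> T -> R) (v : 'I_n -> 'I_n -> T -> R) (M : R) (eta : T -> R) U :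
  measurable U ->
  (forall i j k l, L2 mu (c i j k l \_ U)) -> (forall k l, L2 mu (f k l \_ U)) ->
  (forall i j, measurable_fun setT (v i j)) -> (forall i j x, `|v i j x| <= M) ->
  (forall i j, measurable_fun setT (weak_deriv U [:: i; j] u \_ U)) ->
  (forall i j, {ae mu, forall x, v i j x = (weak_deriv U [:: i; j] u \_ U) x}) ->
  test_function U eta ->
  (\int[mu]_(x in U) (\sum_k \sum_l
    ((\sum_i \sum_j c i j k l x * weak_deriv U [:: i; j] u x) + f k l x) * pderiv [:: k; l] eta x)%:E = 0)%E ->
  rint mu (fun x => \sum_k \sum_l
    ((\sum_i \sum_j (c i j k l \_ U) x * v i j x) + (f k l \_ U) x) * pderiv [:: k; l] eta x) = 0.
Proof.
move=> mU c2 f2 mv vM md vd te eqn.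
set G := fun x => _; pose F x := \sum_k \sum_l
  ((\sum_i \sum_j c i j k l x * weak_deriv U [:: i; j] u x) + f k l x) * pderiv [:: k; l] eta x.
have cv2 i j k l : L2 mu (fun x => (c i j k l \_ U) x * v i j x).
  have [h _] := L2_bound (mv i j) (vM i j) (c2 i j k l).
  by apply: L2_ext h => x; rewrite mulrC.
have G1 : L1 mu G.
  apply: L1_sum => k; apply: L1_sum => l; apply: L2M; last exact: test_L2 (test_pderiv _ te).
  by apply: L2D => //; apply: L2_sum => i; apply: L2_sum => j.
have FE : F \_ U = fun x => \sum_k \sum_l ((\sum_i \sum_j (c i j k l \_ U) x *
    (weak_deriv U [:: i; j] u \_ U) x) + (f k l \_ U) x) * pderiv [:: k; l] eta x.
  apply/funext => x; have [xU|xU] := pselect (U x).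
    rewrite restrict_in//; apply: eq_bigr => k _; apply: eq_bigr => l _; congr (_ * _).
    rewrite restrict_in//; congr (_ + _); apply: eq_bigr => i _; apply: eq_bigr => j _.
    by rewrite !restrict_in.
  rewrite restrict_out//; apply/esym; apply: big1 => k _; apply: big1 => l _.
  rewrite restrict_out// addr0 big1 ?mul0r// => i _; rewrite big1// => j _.
  by rewrite restrict_out// mul0r.
have mF : measurable_fun setT (F \_ U).
  rewrite FE; apply: measurable_sum => k; apply: measurable_sum => l; apply: measurable_funM.
    apply: measurable_funD; last by case: (f2 k l).
    apply: measurable_sum => i; apply: measurable_sum => j; apply: measurable_funM => //.
    by case: (c2 i j k l).
  exact: test_measurable (test_pderiv _ te).
have GF : {ae mu, forall x, G x = (F \_ U) x}.
  have : {ae mu, forall x, forall i j, v i j x = (weak_deriv U [:: i; j] u \_ U) x}.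
    by apply: filter_forall => i; apply: filter_forall => j.
  apply: filterS => x H; rewrite FE; apply: eq_bigr => k _; apply: eq_bigr => l _.
  congr ((_ + _) * _); apply: eq_bigr => i _; apply: eq_bigr => j _; by rewrite H.
have [F1 E] := rint_ae_ext G1 mF GF; rewrite E.
by have := rint_restrict F1; rewrite eqn => -[].
Qed.

Lemma third_weak_derivative (Phi g : T -> R) (K delta Kr M Nc Nf Lam : R) (u : T -> R)
    (c : 'I_n -> 'I_n -> 'I_n -> 'I_n -> T -> R) (f : 'I_n -> 'I_n -> T -> R) s :
  [/\ [/\ test_function (eball (3 / 4)) Phi, measurable_fun setT g & forall x, 0 <= g x <= 1],
     0 <= K, 0 < delta, forall x, Phi x = g x ^+ 2 &
   [/\ forall i x, `|partial i Phi x| <= K * g x,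
       forall i j x, `|partial i (partial j Phi) x| <= K * g x &
       forall x, eball (1 / 2) x -> delta <= g x]] ->
  (forall e : R, 0 < e -> exists rho : T -> R,
    [/\ test_function (cball e) rho, forall x, 0 <= rho x, rint mu rho = 1 &
     forall p, rint mu (fun x => `|partial p rho x|) <= Kr / e]) ->
  sobolev (eball 1) 2 +oo%E u ->
  (forall i j k l, sobolev (eball 1) 1 2%:E (c i j k l)) ->
  (forall k l, sobolev (eball 1) 1 2%:E (f k l)) ->
  fine (sobolev_norm (eball 1) 2 +oo%E u) <= M ->
  (forall i j k l, fine (sobolev_norm (eball 1) 1 2%:E (c i j k l)) <= Nc) ->
  (forall k l, fine (sobolev_norm (eball 1) 1 2%:E (f k l)) <= Nf) ->
  0 <= Nc -> 0 <= Nf -> 0 < Lam ->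
  {ae mu, forall x, eball 1 x ->
      forall xi : 'M[R]_n, xi^T = xi ->
        Lam * (\sum_i \sum_j xi i j ^+ 2) <=
        \sum_i \sum_j \sum_k \sum_l c i j k l x * xi i j * xi k l} ->
  (forall eta, test_function (eball 1) eta ->
      (\int[mu]_(x in eball 1)
        (\sum_k \sum_l
          ((\sum_i \sum_j c i j k l x * weak_deriv (eball 1) [:: i; j] u x)
            + f k l x) * pderiv [:: k; l] eta x)%:E = 0)%E) ->
  size s = 3%N ->
  exists h, [/\ L2 mu h, nrm2 mu h <= delta^-1 *
      Num.sqrt ((energy_slope (n := n) M Nc Nf K Kr / Lam) ^+ 2 +
        2 * (energy_const (n := n) M Nc Nf K Kr (nrm2 mu g) / Lam)) &
    weak (eball (1 / 2)) s (u \_ (eball 1)) h].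
Proof.
move=> cut moll su sc sf uM cN fN Nc0 Nf0 Lam0 ell eqn.
have oU : open (eball 1 : set T) by exact: eball_open.
have mU : measurable (eball 1 : set T) by exact: measurable_eball.
have r2 : 0 < 2 :> R by [].
have U2 : eball 1 `<=` @cube R n 2 by move=> x /(eball_cube ltr01); rewrite mulr1.
have [uM0 uB] := sobolev_norm_oo oU su; have M0 := le_trans uM0 uM.
have uBM s' : (size s' <= 2)%N -> {ae mu, forall x, `|(weak_deriv (eball 1) s' u \_ (eball 1)) x| <= M}.
  by move=> s2; apply: filterS (uB s' s2) => x h; exact: le_trans uM.
(* The version of the derivative used from here on: bounded by [M] everywhere and zero off the unit
   ball, hence in L^1 and in L^2. *)
pose V s' := clip M (weak_deriv (eball 1) s' u \_ (eball 1)).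
have md s' : (size s' <= 2)%N -> measurable_fun setT (weak_deriv (eball 1) s' u \_ (eball 1)).
  by move=> s2; have [h []] := sobolev_weak_deriv oU su s2.
have VE s' : (size s' <= 2)%N ->
    {ae mu, forall x, (weak_deriv (eball 1) s' u \_ (eball 1)) x = V s' x}.
  by move=> s2; apply: filterS (uBM s' s2) => x h; rewrite /V clip_id.
have mV s' : (size s' <= 2)%N -> measurable_fun setT (V s') by move=> /md; exact: clip_measurable.
have VM s' x : `|V s' x| <= M by exact: clip_bound.
have V12 s' : (size s' <= 2)%N -> L1 mu (V s') /\ L2 mu (V s').
  by move=> s2; apply: bounded_L2 ltr01 (mV s' s2) (VM s') _ => x; exact: clip_outside.
have Vw s' : (size s' <= 2)%N -> weak (eball 1) s' (u \_ (eball 1)) (V s').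
  move=> s2; have [h [wd _ _ _]] := sobolev_weak_deriv oU su s2.
  apply: weak_ae (mV s' s2) (VE s' s2) (is_weak_deriv_weak mU wd) => eta te.
  by have [_ dl _] := wd; exact: (loc_test_L1 [::] mU dl te).
have u1 : L1 mu (u \_ (eball 1)).
  have [uL _] := su; rewrite in_LpE in uL; have [mu' uB'] := Lfun_oo uL.
  have uB0 : 0 <= fine ('N[mu]_+oo[EFin \o (u \_ (eball 1))])%E by apply: fine_ge0; exact: Lnorm_ge0.
  by have [] := ae_bounded_L2 ltr01 uB0 mu' uB'.
have cL i j k l := sobolev_norm2_self oU (sc i j k l).
have fL k l := sobolev_norm2_self oU (sf k l).
have L21 h := @L2_L1_restrict R n h (eball 1) 2 r2 mU U2.
have sob1 h p : sobolev (eball 1) 1 2%:E h ->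
    [/\ L2 mu (weak_deriv (eball 1) [:: p] h \_ (eball 1)),
      nrm2 mu (weak_deriv (eball 1) [:: p] h \_ (eball 1)) <= fine (sobolev_norm (eball 1) 1 2%:E h) &
      weak (eball 1) [:: p] (h \_ (eball 1)) (weak_deriv (eball 1) [:: p] h \_ (eball 1))].
  move=> sh; have s1 : (size [:: p] <= 1)%N by [].
  have [_ _ H] := sobolev_norm2 oU sh.
  split; [exact: sobolev_L2 sh s1|exact: H|].
  by have [h' [wd _ _ _]] := sobolev_weak_deriv oU sh s1; exact: is_weak_deriv_weak.
have main := third_derivative u1 M0 Nc0 Nf0 Lam0
  (u1 := fun i => V [:: i]) (v := fun i j => V [:: i; j])
  (c := fun i j k l => c i j k l \_ (eball 1)) (f := fun k l => f k l \_ (eball 1))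
  (dc := fun p i j k l => weak_deriv (eball 1) [:: p] (c i j k l) \_ (eball 1))
  (df := fun p k l => weak_deriv (eball 1) [:: p] (f k l) \_ (eball 1))
  (fun i => mV [:: i] isT) (fun i => VM [:: i]) (fun i => Vw [:: i] isT)
  (fun i j => (V12 [:: i; j] isT).1) (fun i j => (V12 [:: i; j] isT).2)
  (fun i j => VM [:: i; j]) (fun i j => Vw [:: i; j] isT)
  (fun i j k l => L21 _ (cL i j k l).1) (fun i j k l => (cL i j k l).1)
  (fun i j k l => le_trans (cL i j k l).2 (cN i j k l)).
have sc1 p i j k l := sob1 _ p (sc i j k l).
have sf1 p k l := sob1 _ p (sf k l).
have {}main := main
  (fun p i j k l => let: And3 h _ _ := sc1 p i j k l in h)
  (fun p i j k l => let: And3 _ h _ := sc1 p i j k l in le_trans h (cN i j k l))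
  (fun p i j k l => let: And3 _ _ h := sc1 p i j k l in h)
  (fun k l => L21 _ (fL k l).1) (fun k l => (fL k l).1)
  (fun k l x xU => restrict_out (f k l) xU)
  (fun p k l => let: And3 h _ _ := sf1 p k l in h)
  (fun p k l => let: And3 _ h _ := sf1 p k l in le_trans h (fN k l))
  (fun p k l => let: And3 _ _ h := sf1 p k l in h).
case: s => [//|a [//|b [//|d [|//]]]] _.
have [||h [h2 hB hw]] := main _ _ Phi g K delta Kr cut moll a b d.
- apply: filterS ell => x H xU xi xiT; have := H xU xi xiT.
  congr (_ <= _); apply: eq_bigr => i _; apply: eq_bigr => j _; apply: eq_bigr => k _.
  by apply: eq_bigr => l _; rewrite restrict_in.
- move=> eta te; apply: (equation_ae mU _ _ _ _ _ _ te (eqn eta te)).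
  + by move=> i j k l; case: (cL i j k l).
  + by move=> k l; case: (fL k l).
  + by move=> i j; exact: mV.
  + by move=> i j x; exact: VM.
  + by move=> i j; exact: md.
  + by move=> i j; apply: filterS (VE [:: i; j] isT) => x ->.
exists h; split=> //; apply: weak_chain (Vw [:: a; b] isT) hw.
by rewrite /eball => x /=; lra.
Qed.

(** Derivatives of order at most two are restricted from B_1, where they are bounded and so
    square-integrable on the smaller ball; only those of order three come from the hypothesis. *)
Lemma sobolev_half (u : T -> R) (B : R) : sobolev (eball 1) 2 +oo%E u ->
  (forall s, size s = 3%N -> exists h, [/\ L2 mu h, nrm2 mu h <= B &
    weak (eball (1 / 2)) s (u \_ (eball 1)) h]) ->
  sobolev (eball (1 / 2)) 3 2%:E u /\
  (Lp_norm (eball (1 / 2)) 2%:E (weak_grad (eball (1 / 2)) 3 u) <=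
    (Num.sqrt (#|{: 3.-tuple 'I_n}|%:R * B ^+ 2))%:E)%E.
Proof.
move=> su H.
have oU : open (eball 1 : set T) by exact: eball_open.
have mU : measurable (eball 1 : set T) by exact: measurable_eball.
have oW : open (eball (1 / 2) : set T) by exact: eball_open.
have mW : measurable (eball (1 / 2) : set T) by exact: measurable_eball.
have WU : eball (1 / 2) `<=` (eball 1 : set T) by rewrite /eball => x /=; lra.
have h0 : 0 < 1 / 2 :> R by lra.
have r2 : 0 < 2 :> R by [].
have W2 : eball (1 / 2) `<=` @cube R n 2 by move=> x /WU /(eball_cube ltr01); rewrite mulr1.
have sub h (M : R) : 0 <= M -> measurable_fun setT (h \_ (eball 1)) ->
    {ae mu, forall x, `|(h \_ (eball 1)) x| <= M} ->
    L1 mu (h \_ (eball (1 / 2))) /\ L2 mu (h \_ (eball (1 / 2))).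
  move=> M0 /(measurable_restrictT _ mU) mh hM; apply: (ae_bounded_L2 h0 M0).
    by apply/(measurable_restrictT _ mW); exact: measurable_funS WU mh.
  apply: filterS hM => x hx; have [xW|xW] := pselect (eball (1 / 2) x); last by rewrite (restrict_out h xW) normr0.
  by move: hx; rewrite !restrict_in//; exact: WU.
have [u1 u2] : L1 mu (u \_ (eball (1 / 2))) /\ L2 mu (u \_ (eball (1 / 2))).
  have [uL _] := su; rewrite in_LpE in uL; have [mu' uB'] := Lfun_oo uL.
  by apply: sub mu' uB'; apply: fine_ge0; exact: Lnorm_ge0.
have third s : size s = 3%N -> exists h, [/\ L2 mu (h \_ (eball (1 / 2))),
    nrm2 mu (h \_ (eball (1 / 2))) <= B & is_weak_deriv (eball (1 / 2)) s u h].
  move=> /H[h [h2 hB hw]]; exists h; have [r1 rn] := L2_restrict h2 mW.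
  have h2' : L2 mu (h \_ (eball (1 / 2))) by apply: L2_ext r1 => x; rewrite restrictE.
  split=> //.
    by apply: le_trans hB; apply: le_trans rn; rewrite (nrm2_ext _ (restrictE h (eball (1 / 2)))).
  apply: weak_is_weak_deriv => //; first exact: L2_L1_restrict W2 h2'.
  have E : (u \_ (eball 1)) \_ (eball (1 / 2)) = u \_ (eball (1 / 2)).
    apply/funext => x; have [xW|xW] := pselect (eball (1 / 2) x); last by rewrite !restrict_out.
    by rewrite !restrict_in//; exact: WU.
  by rewrite -E; exact: weak_restrict.
have sW : sobolev (eball (1 / 2)) 3 2%:E u.
  split; first by rewrite in_LpE; exact: L2_Lfun.
  move=> s; rewrite leq_eqVlt => /orP[/eqP/third[h [h2 _ hw]]|s2].
    by exists h => //; rewrite in_LpE; exact: L2_Lfun.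
  have [M0 uM] := sobolev_norm_oo oU su.
  have [h [wd md _ _]] := sobolev_weak_deriv oU su s2.
  exists (weak_deriv (eball 1) s u); first exact: is_weak_deriv_sub wd.
  by rewrite in_LpE; apply: L2_Lfun; have [_] := sub _ _ M0 md (uM s s2).
split=> //.
have d2 (s : 3.-tuple 'I_n) : L2 mu (weak_deriv (eball (1 / 2)) s u \_ (eball (1 / 2))).
  by apply: sobolev_L2 sW _ => //; rewrite size_tuple.
have [g2 gE] := L2_sqrt_sum d2.
have mE : weak_grad (eball (1 / 2)) 3 u \_ (eball (1 / 2)) = _ := weak_grad_restrict _ _ _.
rewrite Lp_normE mE Lnorm2E// lee_fin -(ger0_norm (nrm2_ge0 _ _)) -sqrtr_sqr gE.
(* Each of the n^3 third derivatives contributes at most B^2, since the representative in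
   [weak_grad] agrees almost everywhere with the [h] that carries the bound. *)
apply: ler_wsqrtr; rewrite mulr_natl -sumr_const; apply: ler_sum => s _.
have [h [h2 hB hw]] := third s (size_tuple s).
rewrite lerXn2r ?nnegrE ?nrm2_ge0//; first by apply: le_trans hB; exact: nrm2_ge0.
apply: le_trans hB; apply: le_nrm2_ae => //.
have [_ /ae_restrict] := weak_derivP oW hw.
by apply: filterS => x ->.
Qed.

End assembly.

Theorem proposition1p3 (R : realType) (n : nat) (n_ge1 : (1 <= n)%N) :
  exists C : R -> R -> R -> R -> R,
  forall (u : 'rV[R]_n -> R)
         (c : 'I_n -> 'I_n -> 'I_n -> 'I_n -> 'rV[R]_n -> R)
         (f : 'I_n -> 'I_n -> 'rV[R]_n -> R)
         (Lambda : R),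
    sobolev (eball 1) 2 +oo%E u ->
    (forall i j k l, sobolev (eball 1) 1 2%:E (c i j k l)) ->
    (forall k l, sobolev (eball 1) 1 2%:E (f k l)) ->
    0 < Lambda ->
    {ae lebesgue_rV n, forall x, eball 1 x ->
      forall xi : 'M[R]_n, xi^T = xi ->
        Lambda * (\sum_i \sum_j xi i j ^+ 2) <=
        \sum_i \sum_j \sum_k \sum_l c i j k l x * xi i j * xi k l} ->
    (forall eta : 'rV[R]_n -> R, test_function (eball 1) eta ->
      (\int[lebesgue_rV n]_(x in eball 1)
        (\sum_k \sum_l
          ((\sum_i \sum_j c i j k l x * weak_deriv (eball 1) [:: i; j] u x)
            + f k l x) * pderiv [:: k; l] eta x)%:E = 0)%E) ->
    sobolev (eball (1 / 2)) 3 2%:E u /\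
    (Lp_norm (eball (1 / 2)) 2%:E (weak_grad (eball (1 / 2)) 3 u) <=
      (C (fine (sobolev_norm (eball 1) 2 +oo%E u))
         (fine (\sum_k \sum_l sobolev_norm (eball 1) 1 2%:E (f k l)))
         (fine (\sum_i \sum_j \sum_k \sum_l
                  sobolev_norm (eball 1) 1 2%:E (c i j k l)))
         Lambda)%:E)%E.
Proof.
have [Phi [g [K [delta cut]]]] := @cutoff R n.
have [Kr _ moll] := @mollifier R n.
(* [m], [a] and [b] receive the norms of u, f and c. The remaining constants come from the cutoff
   and the mollifier, which are fixed before u, c and f are introduced. *)
exists (fun m a b Lam => Num.sqrt (#|{: 3.-tuple 'I_n}|%:R * (delta^-1 *
  Num.sqrt ((energy_slope (n := n) m b a K Kr / Lam) ^+ 2 +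
  2 * (energy_const (n := n) m b a K Kr (nrm2 (@lebm R n) g) / Lam))) ^+ 2)).
move=> u c f Lam su sc sf Lam0 ell eqn; apply: sobolev_half => // s s3.
have oU : open (eball 1 : set 'rV[R]_n) by exact: eball_open.
have fin1 (h : 'rV[R]_n -> R) : sobolev (eball 1) 1 2%:E h ->
    sobolev_norm (eball 1) 1 2%:E h \is a fin_num /\ (0 <= sobolev_norm (eball 1) 1 2%:E h)%E.
  by move=> sh; case: (sobolev_norm2 oU sh).
have f1 k := le_fine_sum (fun l => fin1 _ (sf k l)).
have f2 := le_fine_sum (fun k => (f1 k).1).
have c1 i j k := le_fine_sum (fun l => fin1 _ (sc i j k l)).
have c2 i j := le_fine_sum (fun k => (c1 i j k).1).
have c3 i := le_fine_sum (fun j => (c2 i j).1).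
have c4 := le_fine_sum (fun i => (c3 i).1).
apply: (third_weak_derivative cut moll su sc sf _ _ _ _ _ Lam0 ell eqn s3).
- exact: lexx.
- move=> i j k l.
  exact: le_trans ((c1 i j k).2 l) (le_trans ((c2 i j).2 k) (le_trans ((c3 i).2 j) (c4.2 i))).
- move=> k l; exact: le_trans ((f1 k).2 l) (f2.2 k).
- by apply: fine_ge0; case: c4 => -[].
- by apply: fine_ge0; case: f2 => -[].
Qed.
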